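(* Consider a discounted constrained MDP satisfying the Slater condition with constant $\xi>0$, and log-linear policies with features satisfying $\|\phi_{s,a}\|\le B$. Fix a state distribution $\rho$, a state-action distribution $\nu_0$, and integers $T,K>0$. Let $\{(\theta^{(t)},\lambda^{(t)})\}_{t=0}^{T-1}$ be generated by the sample-based NPG-PD algorithm for log-linear policies (see context) with $\eta_1=\eta_2=1/\sqrt T$ and $\alpha_k=2/(\sigma_F(k+1))$, using $K$ rounds of trajectory samples at each time $t$, where $\sigma_F>0$ is such that $\mathbb E_{(s,a)\sim\nu^{(t)}}[\phi_{s,a}\phi_{s,a}^\top]\succeq\sigma_FI$ for all $t$. Assume that $\mathcal E_{\diamond,\mathrm{bias}}^{(t)}\le\epsilon_{\mathrm{bias}}$ for all $t$ and $\diamond\in\{r,g\}$, and that the relative condition number $\kappa$ is finite. Then $$\mathbb E\Big[\frac1T\sum_{t=0}^{T-1}\big(V_r^\star(\rho)-V_r^{(t)}(\rho)\big)\Big]\le\frac{C_5}{(1-\gamma)^5}\frac1{\sqrt T}+\frac{2+4/\xi}{(1-\gamma)^3}\Big(\sqrt{|A|\epsilon_{\mathrm{bias}}}+\sqrt{\frac{2\kappa|A|G^2}{\sigma_F(K+1)}}\Big),$$ $$\mathbb E\Big(\Big[\frac1T\sum_{t=0}^{T-1}\big(b-V_g^{(t)}(\rho)\big)\Big]_+\Big)\le\frac{C_6}{(1-\gamma)^4}\frac1{\sqrt T}+\frac{4+2\xi}{(1-\gamma)^2}\Big(\sqrt{|A|\epsilon_{\mathrm{bias}}}+\sqrt{\frac{2\kappa|A|G^2}{\sigma_F(K+1)}}\Big),$$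 where $\beta=B^2$, $C_5=2+\log|A|+5\beta W^2/\xi^2$, $C_6=(2+\log|A|+\beta W^2)\xi+(2+4\beta W^2)/\xi$, and $G^2=4\big(W^2B^2+2/(1-\gamma)^2\big)B^2$.
   Context: Constrained MDP: $S$, $A$ finite state and action spaces; $P(s'\mid s,a)$ transition probabilities; $r,g:S\times A\to[0,1]$ reward and utility; $\gamma\in[0,1)$; $b\in(0,1/(1-\gamma)]$; $\rho\in\Delta_S$ initial state distribution ($\Delta_X$ is the set of probability distributions on $X$). A policy is $\pi:S\to\Delta_A$; $\Pi$ is the set of all policies. For $\diamond\in\{r,g\}$: $V_\diamond^\pi(s)=\mathbb E[\sum_{t\ge0}\gamma^t\diamond(s_t,a_t)\mid\pi,s_0=s]$, $Q_\diamond^\pi(s,a)=\mathbb E[\sum_{t\ge0}\gamma^t\diamond(s_t,a_t)\mid\pi,s_0=s,a_0=a]$, $V_\diamond^\pi(\rho)=\mathbb E_{s\sim\rho}[V_\diamond^\pi(s)]$. Problem: maximize $V_r^\pi(\rho)$ over $\pi\in\Pi$ subject to $V_g^\pi(\rho)\ge b$; $\pi^\star$ is an optimal solution, $V_\diamond^\star(\rho)=V_\diamond^{\pi^\star}(\rho)$. Slater condition with constant $\xi>0$: some $\bar\pi\in\Pi$ has $V_g^{\bar\pi}(\rho)-b\ge\xi$. $[x]_+=\max(x,0)$. Visitation distributions: $d_\rho^\pi(s)=(1-\gamma)\mathbb E_{s_0\sim\rho}\sum_{t\ge0}\gamma^tP^\pi(s_t=s\mid s_0)$ and $\nu_{\nu_0}^\pi(s,a)=(1-\gamma)\mathbb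 E_{(s_0,a_0)\sim\nu_0}\sum_{t\ge0}\gamma^tP^\pi(s_t=s,a_t=a\mid s_0,a_0)$. Log-linear policies: $\pi_\theta(a\mid s)=\exp(\theta^\top\phi_{s,a})/\sum_{a'}\exp(\theta^\top\phi_{s,a'})$, $\phi_{s,a},\theta\in\mathbb R^d$. Superscript $(t)$ means evaluated at $\pi^{(t)}=\pi_{\theta^{(t)}}$; $\nu^{(t)}=\nu_{\nu_0}^{\pi^{(t)}}$. Transfer error: with $\mathcal E_\diamond^\nu(w;\theta)=\mathbb E_{(s,a)\sim\nu}[(Q_\diamond^{\pi_\theta}(s,a)-w^\top\phi_{s,a})^2]$, $W>0$ fixed, $w_{\diamond,\star}^{(t)}\in\arg\min_{\|w\|_2\le W}\mathcal E_\diamond^{\nu^{(t)}}(w;\theta^{(t)})$ and $\nu^\star(s,a)=d_\rho^{\pi^\star}(s)\cdot\frac1{|A|}$, set $\mathcal E_{\diamond,\mathrm{bias}}^{(t)}=\mathbb E[\mathcal E_\diamond^{\nu^\star}(w_{\diamond,\star}^{(t)};\theta^{(t)})]$. Relative condition number: $\Sigma_\nu=\mathbb E_{(s,a)\sim\nu}[\phi_{s,a}\phi_{s,a}^\top]$, $\kappa=\sup_{w\in\mathbb R^d}\frac{w^\top\Sigma_{\nu^\star}w}{w^\top\Sigma_{\nu_0}w}$ (convention $0/0=0$, $c/0=+\infty$ for $c>0$). Sampling: a rollout ''with termination probability $1-\gamma$'' has random length $K'\ge1$, geometric with $P(K'-1\ge k)=\gamma^k$, independent of the trajectory. $Q$-estimate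 for policy $\pi$: draw $(s_0,a_0)\sim\nu_0$, follow $\pi$, continuing at each step with probability $\gamma$ and otherwise stopping and accepting the current pair $(s,a)$ (so $(s,a)\sim\nu_{\nu_0}^\pi$); from $(s,a)$ roll out $\pi$ with termination probability $1-\gamma$ and let $\hat Q_\diamond(s,a)$ be the undiscounted sum of rewards/utilities. Value estimate $\hat V_g(\rho)$: draw $s_0\sim\rho$, roll out $\pi$ with termination probability $1-\gamma$ and take the undiscounted sum of utilities. Sample-based NPG-PD (log-linear): $\theta^{(0)}=0$, $\lambda^{(0)}=0$; for $t=0,\dots,T-1$: set $w_{r,0}=w_{g,0}=0$; for $k=0,\dots,K-1$ draw a fresh $Q$-estimate under $\pi^{(t)}$ and set, for $\diamond\in\{r,g\}$, $$w_{\diamond,k+1}=\mathcal P_{\|w\|\le W}\big(w_{\diamond,k}-2\alpha_k(\phi_{s,a}^\top w_{\diamond,k}-\hat Q_\diamond(s,a))\phi_{s,a}\big);$$ set $\hat w_\diamond^{(t)}=\frac2{K(K+1)}\sum_{k=0}^{K-1}(k+1)w_{\diamond,k}$, $\hat w^{(t)}=\hat w_r^{(t)}+\lambda^{(t)}\hat w_g^{(t)}$; draw a fresh value estimate $\hat V_g^{(t)}(\rho)$ under $\pi^{(t)}$; update $$\theta^{(t+1)}=\theta^{(t)}+\frac{\eta_1}{1-\gamma}\hat w^{(t)},\qquad\lambda^{(t+1)}=\mathcal P_{[0,2/((1-\gamma)\xi)]}\big(\lambda^{(t)}-\eta_2(\hat V_g^{(t)}(\rho)-b)\big).$$ $\mathcal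 P$ denotes Euclidean projection; expectations are over all sampling randomness. *)

(* Defs.v *)
From HB Require Import structures.
From mathcomp Require Import all_boot all_order all_algebra.
From mathcomp Require Import all_classical all_reals all_analysis.

Set Implicit Arguments.
Unset Strict Implicit.
Unset Printing Implicit Defensive.

Import Order.TTheory GRing.Theory Num.Theory.
Import numFieldNormedType.Exports.

Local Open Scope classical_set_scope.
Local Open Scope ring_scope.

Definition is_distr (R : realType) (X : finType) (p : X -> R) : Prop :=
  (forall x, 0 <= p x) /\ \sum_x p x = 1.

(* The index ranging over {r, g} (reward, utility). *)
Variant objective := obj_r | obj_g.

Record cmdp (R : realType) (S A : finType) := CMDP {
  trans : S * A -> S -> R;
  payoff : objective -> S * A -> R;
  discount : R;
  threshold : R;
  trans_distr : forall x, is_distr (trans x);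
  payoff_itv : forall o x, 0 <= payoff o x <= 1;
  discount_itv : 0 <= discount < 1;
  threshold_itv : 0 < threshold <= (1 - discount)^-1
}.

Definition is_policy (R : realType) (S A : finType) (pi : S -> A -> R) : Prop :=
  forall s, is_distr (pi s).

(* A nonempty finite trajectory (s_0,a_0), (s_1,a_1), ...: its head and the
   sequence of the subsequent state-action pairs. *)
Definition trajectory (S A : finType) : Type := ((S * A) * seq (S * A))%type.

Section Trajectories.
Context (R : realType) (S A : finType) (M : cmdp R S A).
Local Notation gamma := (discount M).

Fixpoint follow_prob (pi : S -> A -> R) (x : S * A) (p : seq (S * A)) : R :=
  if p is y :: p' then trans M x y.1 * pi y.1 y.2 * follow_prob pi y p' else 1.

(* Probability that the process with (s_0,a_0) ~ mu, following pi, starts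
   with tau. *)
Definition traj_prob (mu : S * A -> R) (pi : S -> A -> R)
    (tau : trajectory S A) : R :=
  mu tau.1 * follow_prob pi tau.1 tau.2.

(* Expectation of f((s_0,a_0), ..., (s_n,a_n)). *)
Definition traj_expect (mu : S * A -> R) (pi : S -> A -> R) (n : nat)
    (f : trajectory S A -> R) : R :=
  \sum_(x : S * A) \sum_(p : n.-tuple (S * A))
    traj_prob mu pi (x, tval p) * f (x, tval p).

Definition from_distr (rho : S -> R) (pi : S -> A -> R) : S * A -> R :=
  fun x => rho x.1 * pi x.1 x.2.
Definition from_state (s : S) : (S -> A -> R) -> S * A -> R :=
  from_distr (fun s' => (s' == s)%:R).
Definition from_pair (x : S * A) : S * A -> R := fun y => (y == x)%:R.

Definition accepted (tau : trajectory S A) : S * A := last tau.1 tau.2.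

Definition traj_discounted (c : S * A -> R) (tau : trajectory S A) : R :=
  \sum_(i < (size tau.2).+1) gamma ^+ i * c (nth tau.1 (tau.1 :: tau.2) i).
Definition traj_total (c : S * A -> R) (tau : trajectory S A) : R :=
  \sum_(x <- tau.1 :: tau.2) c x.

(* Expectations over infinite trajectories are limits of expectations over
   their prefixes. *)
Definition Vs (o : objective) (pi : S -> A -> R) (s : S) : R :=
  limn (fun n => traj_expect (from_state s pi) pi n
                   (traj_discounted (payoff M o))).
Definition Q (o : objective) (pi : S -> A -> R) (x : S * A) : R :=
  limn (fun n => traj_expect (from_pair x) pi n
                   (traj_discounted (payoff M o))).
Definition V (rho : S -> R) (o : objective) (pi : S -> A -> R) : R :=
  \sum_s rho s * Vs o pi s.

Definition d_visit (rho : S -> R) (pi : S -> A -> R) (s : S) : R :=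
  (1 - gamma) * \sum_(s0 : S) rho s0 *
    limn (series (fun t => gamma ^+ t *
      traj_expect (from_state s0 pi) pi t
        (fun tau => ((accepted tau).1 == s)%:R))).
Definition nu_visit (nu0 : S * A -> R) (pi : S -> A -> R) (x : S * A) : R :=
  (1 - gamma) * \sum_(x0 : S * A) nu0 x0 *
    limn (series (fun t => gamma ^+ t *
      traj_expect (from_pair x0) pi t (fun tau => (accepted tau == x)%:R))).

Definition feasible (rho : S -> R) (pi : S -> A -> R) : Prop :=
  is_policy pi /\ threshold M <= V rho obj_g pi.
Definition optimal (rho : S -> R) (pi : S -> A -> R) : Prop :=
  feasible rho pi /\
  forall pi', feasible rho pi' -> V rho obj_r pi' <= V rho obj_r pi.
Definition slater (rho : S -> R) (xi : R) : Prop :=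
  exists pi, is_policy pi /\ xi <= V rho obj_g pi - threshold M.

(* Law of a trajectory whose number K' of pairs is geometric,
   P(K' = n + 1) = gamma^n (1 - gamma), independently of the pairs visited. *)
Definition rollout_law (mu : S * A -> R) (pi : S -> A -> R)
    (tau : trajectory S A) : R :=
  traj_prob mu pi tau * (discount M ^+ size tau.2 * (1 - discount M)).

(* A draw for the Q-estimate: the run from nu0 whose last pair is accepted,
   and the rollout from the accepted pair. *)
Definition qdraw : Type := (trajectory S A * trajectory S A)%type.
Definition qdraw_law (nu0 : S * A -> R) (pi : S -> A -> R) (z : qdraw) : R :=
  rollout_law nu0 pi z.1 * rollout_law (from_pair (accepted z.1)) pi z.2.
Definition Qhat (o : objective) (z : qdraw) : R :=
  traj_total (payoff M o) z.2.

Definition vdraw_law (rho : S -> R) (pi : S -> A -> R) : trajectory S A -> R :=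
  rollout_law (from_distr rho pi) pi.
Definition Vhat_g (z : trajectory S A) : R := traj_total (payoff M obj_g) z.

End Trajectories.

Section Euclidean.
Context (R : realType).

Definition dot (d : nat) (u v : 'cV[R]_d) : R := (u^T *m v) 0 0.
(* The library's norm on matrices is the sup norm. *)
Definition norm2 (d : nat) (u : 'cV[R]_d) : R := Num.sqrt (dot u u).
Definition ball2 (d : nat) (W : R) : set 'cV[R]_d := [set w | norm2 w <= W].
Definition qform (d : nat) (H : 'M[R]_d) (w : 'cV[R]_d) : R :=
  dot w (H *m w).
Definition loewner_le (d : nat) (H1 H2 : 'M[R]_d) : Prop :=
  forall w, 0 <= qform (H2 - H1) w.

Definition is_argmin (T : Type) (D : set T) (f : T -> R) (x : T) : Prop :=
  D x /\ forall y, D y -> f x <= f y.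
Definition proj (E : zmodType) (nrm : E -> R) (D : set E) (x : E) : E :=
  xget x [set y | is_argmin D (fun z => nrm (x - z)) y].

End Euclidean.

Section LogLinear.
Context (R : realType) (S A : finType) (M : cmdp R S A).
Context (d : nat) (phi : S * A -> 'cV[R]_d).

Definition log_linear (theta : 'cV[R]_d) (s : S) (a : A) : R :=
  expR (dot theta (phi (s, a))) / \sum_(a' : A) expR (dot theta (phi (s, a'))).

Definition fit_error (o : objective) (nu : S * A -> R) (w theta : 'cV[R]_d) : R :=
  \sum_x nu x * (Q M o (log_linear theta) x - dot w (phi x)) ^+ 2.

Definition Sigma (nu : S * A -> R) : 'M[R]_d :=
  \sum_x nu x *: (phi x *m (phi x)^T).

Definition nu_star (rho : S -> R) (pistar : S -> A -> R) (x : S * A) : R :=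
  d_visit M rho pistar x.1 * (#|A|%:R)^-1.

(* In \bar R, 0^-1 = +oo and 0 * +oo = 0, so 0/0 = 0 and c/0 = +oo for c > 0. *)
Definition rel_cond (nustar nu0 : S * A -> R) : \bar R :=
  ereal_sup (range (fun w : 'cV[R]_d =>
    ((qform (Sigma nustar) w)%:E / (qform (Sigma nu0) w)%:E)%E)).

End LogLinear.

Section NPGPD.
Context (R : realType) (S A : finType) (M : cmdp R S A).
Context (d : nat) (phi : S * A -> 'cV[R]_d).
Context (W xi eta1 eta2 : R) (alpha : nat -> R) (K : nat).

Fixpoint sgd (o : objective) (z : nat -> qdraw S A) (k : nat) : 'cV[R]_d :=
  if k is k'.+1 then
    let w := sgd o z k' in
    let x := accepted (z k').1 in
    proj (@norm2 R d) (ball2 W)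
      (w - (2 * alpha k' * (dot (phi x) w - Qhat M o (z k'))) *: phi x)
  else 0.

Definition what (o : objective) (z : nat -> qdraw S A) : 'cV[R]_d :=
  (2 / (K%:R * K.+1%:R)) *: \sum_(k < K) k.+1%:R *: sgd o z k.

(* The iterate (theta^(t), lambda^(t)) as a function of the tables of all
   draws: zq t k is the k-th Q-draw and zv t the value draw of round t. *)
Fixpoint npg_pd (zq : nat -> nat -> qdraw S A) (zv : nat -> trajectory S A)
    (t : nat) : 'cV[R]_d * R :=
  if t is t'.+1 then
    let: (theta, lambda) := npg_pd zq zv t' in
    (theta + (eta1 / (1 - discount M)) *:
       (what obj_r (zq t') + lambda *: what obj_g (zq t')),
     proj Num.norm `[0, 2 / ((1 - discount M) * xi)]
       (lambda - eta2 * (Vhat_g M (zv t') - threshold M)))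
  else (0, 0).

(* X t k and Y t, for t < T and k < K, are the random draws of the algorithm:
   conditionally on all previous draws, each one has the law prescribed for the
   current policy, i.e. (chain rule) the joint probability mass function is the
   product below. The factors of round t only involve the draws of the rounds
   before t, through theta^(t). The value spaces are countable and carry the
   discrete sigma-algebra. *)
Definition npg_pd_sampling (nu0 : S * A -> R) (rho : S -> R) (T : nat)
    (disp : measure_display) (Omega : measurableType disp)
    (P : probability Omega R)
    (X : nat -> nat -> Omega -> qdraw S A)
    (Y : nat -> Omega -> trajectory S A) : Prop :=
  [/\ forall t k B, measurable (X t k @^-1` B),
      forall t B, measurable (Y t @^-1` B) &
      forall (zq : nat -> nat -> qdraw S A) (zv : nat -> trajectory S A),
      P [set om | forall t, (t < T)%N ->
           (forall k, (k < K)%N -> X t k om = zq t k) /\ Y t om = zv t] =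
      (\prod_(t < T)
         let pi := log_linear phi (npg_pd zq zv t).1 in
         (\prod_(k < K) qdraw_law M nu0 pi (zq t k)) *
         vdraw_law M rho pi (zv t))%:E].

End NPGPD.

(* Main.v *)
(* Natural policy gradient on log-linear policies is mirror descent for the
   mean log-likelihood Phi_t of the policy pi_t under d_rho^{pistar} x pistar,
   and the multiplier performs projected gradient descent. By the performance
   difference lemma and the quadratic bound on log-partition functions,
     eta (gap_r + lambda_t gap_g) <= Phi_{t+1} - Phi_t
       + eta (regression errors) / (1 - gamma) + O(eta^2),
   which telescopes. The regression errors split into the bias and the distance
   from the SGD output to the best fit; under nu^(t) the latter is O(1/K) in
   mean square by strong convexity and the weighted averaging, and it passes to
   nu^star through the relative condition number.

   The estimation noise of the utility value is a martingale difference. For the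
   constraint violation the dual regret is taken against the multiplier
   2/((1-gamma) xi) if the average violation is positive and 0 otherwise. This
   comparator depends on the draws, so it is paired with the accumulated noise
   through the second moment of the latter. A violation v lets the optimality
   gap drop by at most v / ((1 - gamma) xi): mixing the average occupancy
   measure with that of the Slater policy gives a feasible policy. *)

Require Import Defs.
From HB Require Import structures.
From mathcomp Require Import all_boot all_order all_algebra.
From mathcomp Require Import all_classical all_reals all_analysis.
From mathcomp Require Import ring lra measurable_realfun.

Set Implicit Arguments.
Unset Strict Implicit.
Unset Printing Implicit Defensive.

Import Order.TTheory GRing.Theory Num.Theory.
Import numFieldNormedType.Exports.

Local Open Scope classical_set_scope.
Local Open Scope ring_scope.

(** * Discounted Markov decision processes *)

(** Every discounted quantity is a value of one operator, the resolvent of the transition kernel of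
    a policy. It is the only solution of its fixed-point equation, so most identities reduce to
    checking a candidate instead of manipulating series. On the sampling side the obstacle is that
    rollouts have unbounded length: the estimates are unbounded, integrability has to be proved each
    time, and what is available is a second moment, [2 u^2 - u] with [u = 1/(1 - gamma)], that of a
    geometric length. Conditional expectations are avoided: the draws are countable, so conditioning
    on the past is a sum against an explicit kernel. In the regression terms the powers of [u] have
    three sources: the cap [2 u / xi] of the multiplier, the division of the performance difference
    by [1 - gamma], and a [u] in front of the statistical error. The last is the root of [u^2]: one
    factor comes from comparing [nu0] with [nu^(t)], the other from bounding the SGD noise by [G^2].
    The cap is twice [u / xi] because the duality gap uses up one half and the other half bounds the
    violation. *)

Lemma cvg_sumr {R : realType} {I : Type} (r : seq I) (f : I -> R^nat) (l : I -> R) :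
  (forall i, f i n @[n --> \oo] --> l i) ->
  \sum_(i <- r) f i n @[n --> \oo] --> \sum_(i <- r) l i.
Proof.
move=> cf; elim: r => [|i r IHr].
  by rewrite big_nil; under eq_cvg do rewrite big_nil; exact: cvg_cst.
by rewrite big_cons; under eq_cvg do rewrite big_cons; exact: cvgD.
Qed.

Section Resolvent.
Context {R : realType} {S A : finType} (M : cmdp R S A).
Local Notation gamma := (discount M).
Implicit Types (pi : S -> A -> R) (f g : S * A -> R).

Definition transition pi f (x : S * A) : R :=
  \sum_(y : S * A) trans M x y.1 * pi y.1 y.2 * f y.

(** The Neumann series of [(I - gamma P)^-1] with [P = transition pi]. Q, V and both visitation
    distributions are averages of it. *)
Definition resolvent pi f (x : S * A) : R :=
  limn (series (fun t => gamma ^+ t * iter t (transition pi) f x)).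

Lemma discount_ge0 : 0 <= gamma.
Proof. by case/andP: (discount_itv M). Qed.

Lemma discount_lt1 : gamma < 1.
Proof. by case/andP: (discount_itv M). Qed.

Lemma subr1_discount_gt0 : 0 < 1 - gamma.
Proof. by rewrite subr_gt0 discount_lt1. Qed.

Lemma transitionE pi f x : transition pi f x =
  \sum_s trans M x s * \sum_a pi s a * f (s, a).
Proof.
under [RHS]eq_bigr do rewrite big_distrr /=.
by rewrite pair_bigA; apply: eq_bigr => -[s a] _ /=; rewrite mulrA.
Qed.

Lemma transition_state pi (f : S -> R) x : is_policy pi ->
  transition pi (f \o fst) x = \sum_s trans M x s * f s.
Proof.
move=> hpi; rewrite transitionE; apply: eq_bigr => s _ /=.
by rewrite -big_distrl /= (hpi s).2 mul1r.
Qed.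

Lemma transitionD pi f g x : transition pi (fun y => f y + g y) x =
  transition pi f x + transition pi g x.
Proof. by rewrite -big_split; apply: eq_bigr => y _; rewrite mulrDr. Qed.

Lemma transitionZ pi c f x : transition pi (fun y => c * f y) x =
  c * transition pi f x.
Proof. by rewrite big_distrr; apply: eq_bigr => y _ /=; rewrite mulrCA. Qed.

Lemma transition_weight_ge0 pi x y : is_policy pi ->
  0 <= trans M x y.1 * pi y.1 y.2.
Proof.
by move=> hpi; rewrite mulr_ge0 // ?(trans_distr M x).1 ?(hpi _).1.
Qed.

Lemma transition_cst pi c x : is_policy pi -> transition pi (fun=> c) x = c.
Proof.
move=> hpi; have := @transition_state pi (fun=> c) x hpi.
by rewrite -big_distrl /= (trans_distr M x).2 mul1r.
Qed.

Lemma le_transition pi f g x : is_policy pi -> (forall y, f y <= g y) ->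
  transition pi f x <= transition pi g x.
Proof.
by move=> hpi fg; apply: ler_sum => y _; rewrite ler_wpM2l ?transition_weight_ge0.
Qed.

Lemma iter_transition_itv pi f n x b : is_policy pi -> (forall y, 0 <= f y <= b) ->
  0 <= iter n (transition pi) f x <= b.
Proof.
move=> hpi fb; elim: n x => [|n IHn] x //=; apply/andP; split.
  by rewrite -(transition_cst 0 x hpi) le_transition // => y; case/andP: (IHn y).
by rewrite -(transition_cst b x hpi) le_transition // => y; case/andP: (IHn y).
Qed.

Lemma norm_iter_transition pi f n x b : is_policy pi -> (forall y, `|f y| <= b) ->
  `|iter n (transition pi) f x| <= b.
Proof.
move=> hpi fb; elim: n x => [|n IHn] x //=.
rewrite -[leRHS](transition_cst b x hpi) (le_trans (ler_norm_sum _ _ _)) //.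
apply: ler_sum => y _; rewrite normrM (ger0_norm (transition_weight_ge0 _ _ _)) //.
by rewrite ler_wpM2l ?transition_weight_ge0.
Qed.

Lemma fin_fun_bounded {T : finType} (f : T -> R) : exists2 b, 0 <= b & forall y, `|f y| <= b.
Proof.
exists (\sum_y `|f y|) => [|y]; first exact: sumr_ge0.
by rewrite (bigD1 y) //= lerDl sumr_ge0.
Qed.

Lemma cvg_series_discounted (u : nat -> R) b : (forall n, `|u n| <= b) ->
  cvgn (series (fun t => gamma ^+ t * u t)).
Proof.
move=> ub; apply: normed_cvg.
apply: (@series_le_cvg _ _ (geometric b gamma)) => [n|n|n|].
- exact: normr_ge0.
- by rewrite mulr_ge0 ?exprn_ge0 ?discount_ge0 // (le_trans _ (ub 0%N)).
- rewrite /= normrM ger0_norm ?exprn_ge0 ?discount_ge0 //.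
  by rewrite mulrC ler_wpM2r ?exprn_ge0 ?discount_ge0.
apply: is_cvg_geometric_series.
by rewrite ger0_norm ?discount_ge0 ?discount_lt1.
Qed.

Lemma cvg_resolvent pi f x : is_policy pi ->
  series (fun t => gamma ^+ t * iter t (transition pi) f x) @ \oo --> resolvent pi f x.
Proof.
move=> hpi; have [b _ fb] := fin_fun_bounded f.
by apply: cvg_series_discounted => n; exact: norm_iter_transition.
Qed.

Lemma series_transition_recl pi f x n :
  series (fun t => gamma ^+ t * iter t (transition pi) f x) n.+1 =
  f x + gamma * transition pi (fun y =>
    series (fun t => gamma ^+ t * iter t (transition pi) f y) n) x.
Proof.
rewrite /series /= big_nat_recl //= expr0 mul1r.
congr (_ + _); rewrite -transitionZ /transition.
under [RHS]eq_bigr do rewrite !big_distrr /=.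
rewrite exchange_big /=; apply: eq_bigr => i _; rewrite big_distrr /=.
by apply: eq_bigr => y _; rewrite exprS; ring.
Qed.

Lemma resolventE pi f x : is_policy pi ->
  resolvent pi f x = f x + gamma * transition pi (resolvent pi f) x.
Proof.
move=> hpi; set u := series (fun t => gamma ^+ t * iter t (transition pi) f x).
have c1 : u n.+1 @[n --> \oo] --> resolvent pi f x.
  by have := cvg_resolvent (f:=f) (x:=x) hpi; rewrite -/u -(cvg_shiftS u).
have c2 : u n.+1 @[n --> \oo] --> f x + gamma * transition pi (resolvent pi f) x.
  under eq_cvg do rewrite /u series_transition_recl.
  apply: cvgD; first exact: cvg_cst.
  apply: cvgMr; rewrite /transition.
  by apply: cvg_sumr => y; apply: cvgMr; exact: cvg_resolvent.
by rewrite -(cvg_lim (@norm_hausdorff _ R) c1); exact: cvg_lim.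
Qed.

(** The difference [e] of two solutions satisfies [e = gamma P e], and [P] does not increase the sup
    norm; where [|e|] is maximal this reads [|e| <= gamma |e|]. Most of the algebra of the resolvent
    follows by substituting a candidate here. *)
Lemma eq_resolvent pi f g : is_policy pi ->
  (forall x, g x = f x + gamma * transition pi g x) -> resolvent pi f =1 g.
Proof.
move=> hpi hg x; pose e y := g y - resolvent pi f y.
have eE y : e y = gamma * transition pi e y.
  have -> : transition pi e y =
      transition pi g y + transition pi (fun z => -1 * resolvent pi f z) y.
    by rewrite -transitionD; congr (transition _ _ _); apply/funext => z; rewrite /e mulN1r.
  by rewrite transitionZ /e hg resolventE //; ring.
pose x0 := [arg max_(y > x) `|e y|]%O.
have x0P y : `|e y| <= `|e x0|.
  by rewrite /x0; case: Order.TotalTheory.arg_maxP => // z _ /(_ y); exact.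
have : `|e x0| <= gamma * `|e x0|.
  rewrite [X in `|X| <= _]eE normrM ger0_norm ?discount_ge0 // ler_wpM2l ?discount_ge0 //.
  exact: (@norm_iter_transition _ _ 1).
rewrite -subr_ge0 -{2}[`|e x0|]mul1r -mulrBl => h.
have e0 : `|e x0| <= 0.
  rewrite leNgt; apply/negP => e0; move: h; apply/negP; rewrite -ltNge.
  by rewrite nmulr_rlt0 // subr_lt0 discount_lt1.
have := le_trans (x0P x) e0; rewrite normr_le0 /e subr_eq0 => /eqP ->.
by [].
Qed.

Lemma resolventD pi f g x : is_policy pi ->
  resolvent pi (fun y => f y + g y) x = resolvent pi f x + resolvent pi g x.
Proof.
move=> hpi; apply: (eq_resolvent (g := fun y => resolvent pi f y + resolvent pi g y)) => // y.
by rewrite transitionD (resolventE f) // (resolventE g) //; ring.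
Qed.

Lemma resolventZ pi c f x : is_policy pi ->
  resolvent pi (fun y => c * f y) x = c * resolvent pi f x.
Proof.
move=> hpi; apply: (eq_resolvent (g := fun y => c * resolvent pi f y)) => // y.
by rewrite transitionZ (resolventE f) //; ring.
Qed.

Lemma resolvent_cst pi c x : is_policy pi -> resolvent pi (fun=> c) x = c / (1 - gamma).
Proof.
move=> hpi; apply: (eq_resolvent (g := fun=> c / (1 - gamma))) => // y.
rewrite transition_cst //; have := subr1_discount_gt0 => h0; field; lra.
Qed.

Lemma resolvent_ge0 pi f x : is_policy pi -> (forall y, 0 <= f y) -> 0 <= resolvent pi f x.
Proof.
move=> hpi f0; have [b _ fb] := fin_fun_bounded f.
apply: limr_ge; first exact: cvgP (cvg_resolvent hpi).
apply: nearW => n; apply: sumr_ge0 => t _; rewrite mulr_ge0 ?exprn_ge0 ?discount_ge0 //.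
have /(iter_transition_itv (f:=f) t x hpi) /andP[] // : forall y, 0 <= f y <= b.
by move=> y; rewrite f0 (le_trans (ler_norm _)).
Qed.

Lemma le_resolvent pi f g x : is_policy pi -> (forall y, f y <= g y) ->
  resolvent pi f x <= resolvent pi g x.
Proof.
move=> hpi fg; rewrite -subr_ge0 -mulN1r -resolventZ // -resolventD //.
by apply: resolvent_ge0 => // y; rewrite mulN1r subr_ge0.
Qed.

Lemma resolvent_self_le pi f x : is_policy pi -> (forall y, 0 <= f y) -> f x <= resolvent pi f x.
Proof.
move=> hpi f0; rewrite resolventE // lerDl mulr_ge0 ?discount_ge0 //.
rewrite -[leLHS](transition_cst 0 x hpi); apply: le_transition => // y.
exact: resolvent_ge0.
Qed.

(** The resolvent commutes with [transition pi], so the first step can be split off on the inside as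
    well; [resolventE] splits it off on the outside. In the inner form [f] is averaged by the policy
    before it is accumulated. *)
Lemma resolvent_shift pi f x : is_policy pi ->
  resolvent pi f x = f x + gamma * resolvent pi (transition pi f) x.
Proof.
move=> hpi.
apply: (eq_resolvent (g := fun y => f y + gamma * resolvent pi (transition pi f) y)) => // y.
by rewrite transitionD transitionZ {1}resolventE.
Qed.

Lemma resolvent_sum pi (I : finType) (w : I -> R) (F : I -> S * A -> R) x : is_policy pi ->
  resolvent pi (fun y => \sum_i w i * F i y) x = \sum_i w i * resolvent pi (F i) x.
Proof.
move=> hpi; apply: (eq_resolvent (g := fun y => \sum_i w i * resolvent pi (F i) y)) => // y.
under eq_bigr do rewrite resolventE // mulrDr.
rewrite big_split; congr (_ + _); rewrite /transition big_distrr /=.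
under [RHS]eq_bigr do rewrite !big_distrr /=.
rewrite exchange_big; apply: eq_bigr => i _; rewrite !big_distrr /=.
by apply: eq_bigr => z _; ring.
Qed.

Lemma resolvent_basis pi f x : is_policy pi ->
  resolvent pi f x = \sum_y f y * resolvent pi (fun z => (z == y)%:R) x.
Proof.
move=> hpi; rewrite -resolvent_sum //; congr (resolvent _ _ _); apply/funext => z.
rewrite (bigD1 z) //= eqxx mulr1 big1 ?addr0 // => y yz.
by rewrite eq_sym (negbTE yz) mulr0.
Qed.

End Resolvent.

Lemma sum_tuple_cons {R : nmodType} {T : finType} n (F : seq T -> R) :
  \sum_(p : n.+1.-tuple T) F p = \sum_y \sum_(p : n.-tuple T) F (y :: p).
Proof.
rewrite pair_bigA /=.
rewrite (reindex (fun yp : T * n.-tuple T => [tuple of yp.1 :: yp.2])) //=.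
exists (fun p : n.+1.-tuple T => (thead p, [tuple of behead p])) => [[y p] _|p _] /=.
  by congr pair; apply/val_inj.
by rewrite [p in RHS]tuple_eta; apply/val_inj.
Qed.

Lemma mean_itv {R : realType} (X : finType) (p f : X -> R) (b : R) : is_distr p ->
  (forall z, 0 <= f z <= b) -> 0 <= \sum_z p z * f z <= b.
Proof.
move=> hp fb; apply/andP; split.
  by apply: sumr_ge0 => z _; rewrite mulr_ge0 ?hp.1 //; case/andP: (fb z).
rewrite -[b]mul1r -hp.2 mulr_suml; apply: ler_sum => z _.
by rewrite ler_wpM2l ?hp.1 //; case/andP: (fb z).
Qed.

(** * Trajectory expectations, occupancy measures, performance difference *)

Section Trajectories.
Context {R : realType} {S A : finType} (M : cmdp R S A).
Local Notation gamma := (discount M).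
Implicit Types (pi : S -> A -> R) (F : trajectory S A -> R) (x : S * A).

Definition expect_from pi n F x : R :=
  \sum_(p : n.-tuple (S * A)) follow_prob M pi x p * F (x, tval p).

Lemma traj_expectE mu pi n F :
  traj_expect M mu pi n F = \sum_x mu x * expect_from pi n F x.
Proof.
apply: eq_bigr => x _; rewrite big_distrr; apply: eq_bigr => p _.
by rewrite /traj_prob /= mulrA.
Qed.

Lemma expect_from0 pi F x : expect_from pi 0 F x = F (x, [::]).
Proof.
rewrite /expect_from (big_pred1 [tuple]) /= ?mul1r // => p.
by rewrite [p]tuple0; apply/esym/eqP.
Qed.

Lemma expect_fromS pi n F x : expect_from pi n.+1 F x =
  transition M pi (expect_from pi n (fun tau => F (x, tau.1 :: tau.2))) x.
Proof.
rewrite /expect_from (@sum_tuple_cons _ _ n (fun p => follow_prob M pi x p * F (x, p))).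
apply: eq_bigr => y _; rewrite big_distrr; apply: eq_bigr => p _ /=.
by rewrite mulrA.
Qed.

Lemma eq_expect_from pi n F F' x :
  (forall p, size p = n -> F (x, p) = F' (x, p)) ->
  expect_from pi n F x = expect_from pi n F' x.
Proof. by move=> FF'; apply: eq_bigr => p _; rewrite FF' ?size_tuple. Qed.

Lemma expect_fromD pi n F F' x :
  expect_from pi n (fun tau => F tau + F' tau) x =
  expect_from pi n F x + expect_from pi n F' x.
Proof. by rewrite -big_split; apply: eq_bigr => p _; rewrite mulrDr. Qed.

Lemma expect_fromZ pi n c F x :
  expect_from pi n (fun tau => c * F tau) x = c * expect_from pi n F x.
Proof. by rewrite big_distrr; apply: eq_bigr => p _ /=; rewrite mulrCA. Qed.

Lemma expect_from_accepted pi n f x :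
  expect_from pi n (fun tau => f (accepted tau)) x = iter n (transition M pi) f x.
Proof.
elim: n x => [|n IHn] x; first by rewrite expect_from0.
rewrite expect_fromS /=; congr (transition _ _ _ _); apply/funext => y.
exact: IHn.
Qed.

Lemma expect_from_cst pi n c x : is_policy pi -> expect_from pi n (fun=> c) x = c.
Proof.
move=> hpi; rewrite (@expect_from_accepted pi n (fun=> c)).
by elim: n x => [|n IHn] x //=; rewrite (_ : iter _ _ _ = fun=> c) ?transition_cst //; exact/funext.
Qed.

Lemma traj_discounted_cons c x y p :
  traj_discounted M c (x, y :: p) = c x + gamma * traj_discounted M c (y, p).
Proof.
rewrite /traj_discounted /= big_ord_recl expr0 mul1r; congr (_ + _).
rewrite big_distrr; apply: eq_bigr => i _ /=; rewrite exprS -mulrA.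
by rewrite (set_nth_default y) //= ltn_ord.
Qed.

Lemma expect_from_discounted pi c n x : is_policy pi ->
  expect_from pi n (traj_discounted M c) x =
  series (fun t => gamma ^+ t * iter t (transition M pi) c x) n.+1.
Proof.
move=> hpi; elim: n x => [|n IHn] x.
  by rewrite expect_from0 /traj_discounted /series /= big_ord1 big_nat1.
rewrite expect_fromS series_transition_recl.
rewrite -transitionZ -[X in X + _](transition_cst M (c x) x hpi) -transitionD.
congr (transition _ _ _ _); apply/funext => y; rewrite -IHn -expect_fromZ.
rewrite -[X in X + _](expect_from_cst n (c x) y hpi) -expect_fromD.
by apply: eq_expect_from => p _; rewrite traj_discounted_cons.
Qed.

Lemma limn_expect_discounted (mu : S * A -> R) pi c : is_policy pi ->
  limn (fun n => traj_expect M mu pi n (traj_discounted M c)) =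
  \sum_x mu x * resolvent M pi c x.
Proof.
move=> hpi; apply: cvg_lim => //; under eq_cvg do rewrite traj_expectE.
apply: cvg_sumr => x; apply: cvgMr; under eq_cvg do rewrite expect_from_discounted //.
have := cvg_resolvent (M:=M) (f:=c) (x:=x) hpi.
by rewrite -(cvg_shiftS (series _)).
Qed.

Lemma limn_expect_visits (mu : S * A -> R) pi f : is_policy pi ->
  limn (series (fun t => gamma ^+ t *
    traj_expect M mu pi t (fun tau => f (accepted tau)))) =
  \sum_x mu x * resolvent M pi f x.
Proof.
move=> hpi; apply: cvg_lim => //.
have -> : series (fun t => gamma ^+ t *
    traj_expect M mu pi t (fun tau => f (accepted tau))) =
  fun n => \sum_x mu x * series (fun t => gamma ^+ t * iter t (transition M pi) f x) n.
  apply/funext => n; rewrite /series /=.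
  under [RHS]eq_bigr do rewrite big_distrr.
  rewrite exchange_big; apply: eq_bigr => t _.
  rewrite traj_expectE big_distrr; apply: eq_bigr => x _.
  by rewrite expect_from_accepted /= mulrCA.
apply: cvg_sumr => x; apply: cvgMr; exact: cvg_resolvent.
Qed.

Lemma QE o pi x : is_policy pi -> Q M o pi x = resolvent M pi (payoff M o) x.
Proof.
move=> hpi; rewrite /Q limn_expect_discounted // (bigD1 x) //= /from_pair eqxx mul1r.
by rewrite big1 ?addr0 // => y yx; rewrite (negbTE yx) mul0r.
Qed.

Lemma sum_from_distr (rho : S -> R) pi (f : S * A -> R) :
  \sum_x from_distr rho pi x * f x = \sum_s rho s * \sum_a pi s a * f (s, a).
Proof.
under [RHS]eq_bigr do rewrite big_distrr /=.
by rewrite pair_bigA; apply: eq_bigr => -[s a] _ /=; rewrite mulrA.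
Qed.

Lemma sum_from_state s pi (f : S * A -> R) :
  \sum_x from_state s pi x * f x = \sum_a pi s a * f (s, a).
Proof.
rewrite sum_from_distr (bigD1 s) //= eqxx mul1r [X in _ + X]big1 ?addr0 // => s' ss'.
by rewrite (negbTE ss') mul0r.
Qed.

Lemma VsE o pi s : is_policy pi -> Vs M o pi s = \sum_a pi s a * Q M o pi (s, a).
Proof.
move=> hpi; rewrite /Vs limn_expect_discounted // sum_from_state.
by apply: eq_bigr => a _; rewrite QE.
Qed.

Lemma VE rho o pi : is_policy pi ->
  V M rho o pi = \sum_x from_distr rho pi x * Q M o pi x.
Proof.
by move=> hpi; rewrite sum_from_distr; apply: eq_bigr => s _; rewrite VsE.
Qed.

Lemma sum_nu_visit nu0 pi f : is_policy pi ->
  \sum_x nu_visit M nu0 pi x * f x = (1 - gamma) * \sum_x nu0 x * resolvent M pi f x.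
Proof.
move=> hpi; rewrite /nu_visit.
transitivity (\sum_x (1 - gamma) * (f x * \sum_x0 nu0 x0 *
    resolvent M pi (fun z => (z == x)%:R) x0)).
  apply: eq_bigr => x _; rewrite -mulrA; congr (_ * _); rewrite mulrC; congr (_ * _).
  apply: eq_bigr => x0 _; congr (_ * _).
  rewrite (limn_expect_visits (from_pair R x0) (fun z => (z == x)%:R) hpi).
  rewrite (bigD1 x0) //= /from_pair eqxx mul1r big1 ?addr0 // => y yx.
  by rewrite (negbTE yx) mul0r.
rewrite -big_distrr /=; congr (_ * _).
under eq_bigr do rewrite big_distrr /=.
rewrite exchange_big; apply: eq_bigr => y _; rewrite (resolvent_basis M f) // big_distrr.
by apply: eq_bigr => z _ /=; rewrite mulrCA.
Qed.

Lemma nu_visitE nu0 pi x : is_policy pi -> nu_visit M nu0 pi x =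
  (1 - gamma) * \sum_y nu0 y * resolvent M pi (fun z => (z == x)%:R) y.
Proof.
move=> hpi; rewrite -sum_nu_visit // (bigD1 x) //= eqxx mulr1 big1 ?addr0 // => y yx.
by rewrite (negbTE yx) mulr0.
Qed.

Lemma d_visitE rho pi s : is_policy pi ->
  d_visit M rho pi s =
  (1 - gamma) * \sum_x from_distr rho pi x * resolvent M pi (fun z => (z.1 == s)%:R) x.
Proof.
move=> hpi; rewrite /d_visit; congr (_ * _); rewrite sum_from_distr.
apply: eq_bigr => s0 _; congr (_ * _).
by rewrite (limn_expect_visits (from_state s0 pi) (fun z => (z.1 == s)%:R) hpi) sum_from_state.
Qed.

Lemma sum_d_visit_state rho pi (f : S -> R) : is_policy pi ->
  \sum_s d_visit M rho pi s * f s =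
  (1 - gamma) * \sum_x from_distr rho pi x * resolvent M pi (f \o fst) x.
Proof.
move=> hpi.
under eq_bigr do rewrite d_visitE // -mulrA.
rewrite -big_distrr /=; congr (_ * _).
under eq_bigr do rewrite mulrC big_distrr /=.
rewrite exchange_big; apply: eq_bigr => x _.
have -> : f \o fst = (fun z : S * A => \sum_s f s * (z.1 == s)%:R).
  apply/funext => z /=; rewrite (bigD1 z.1) //= eqxx mulr1 big1 ?addr0 // => s sz.
  by rewrite eq_sym (negbTE sz) mulr0.
rewrite resolvent_sum // big_distrr; apply: eq_bigr => s _ /=; exact: mulrCA.
Qed.

Definition policy_mean pi (f : S * A -> R) (s : S) : R := \sum_a pi s a * f (s, a).

(** At every time the action is drawn from [pi] given the state, both initially under [from_distr]
    and after a transition, so replacing [f] by its policy mean changes nothing. [resolvent_shift]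
    separates these two places. *)
Lemma sum_d_visit rho pi f : is_policy pi ->
  \sum_s d_visit M rho pi s * policy_mean pi f s =
  (1 - gamma) * \sum_x from_distr rho pi x * resolvent M pi f x.
Proof.
move=> hpi; rewrite sum_d_visit_state //; congr (_ * _).
under eq_bigr do rewrite resolvent_shift // mulrDr.
under [RHS]eq_bigr do rewrite resolvent_shift // mulrDr.
have -> : transition M pi (policy_mean pi f \o fst) = transition M pi f.
  by apply/funext => x; rewrite transition_state // transitionE.
rewrite !big_split; congr (_ + _); rewrite !sum_from_distr.
by apply: eq_bigr => s _ /=; rewrite -mulr_suml (hpi s).2 mul1r.
Qed.

(** Flow balance of the occupancy measure: initial mass plus discounted inflow. The converse
    direction is [sum_flow_payoff], where the balance alone determines the values; together they
    identify the values of a mixture. *)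
Lemma d_visit_flow rho pi (f : S -> R) : is_policy pi ->
  \sum_s d_visit M rho pi s * f s = (1 - gamma) * \sum_s rho s * f s +
  gamma * \sum_s d_visit M rho pi s *
    policy_mean pi (fun x => \sum_s' trans M x s' * f s') s.
Proof.
move=> hpi; rewrite sum_d_visit // sum_d_visit_state //.
under eq_bigr do rewrite resolvent_shift // mulrDr.
rewrite big_split mulrDr; congr (_ + _).
  congr (_ * _); rewrite sum_from_distr; apply: eq_bigr => s _ /=.
  by rewrite -mulr_suml (hpi s).2 mul1r.
rewrite [RHS]mulrCA; congr (_ * _); rewrite big_distrr; apply: eq_bigr => x _ /=.
rewrite mulrCA; congr (_ * (_ * _)); congr (resolvent _ _ _ _); apply/funext => y.
exact: transition_state.
Qed.

Lemma nu_visit_distr nu0 pi : is_policy pi -> is_distr nu0 -> is_distr (nu_visit M nu0 pi).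
Proof.
move=> hpi hnu; split=> [x|].
  rewrite nu_visitE // mulr_ge0 ?(ltW (subr1_discount_gt0 M)) // sumr_ge0 // => y _.
  by rewrite mulr_ge0 ?hnu.1 // resolvent_ge0.
have := sum_nu_visit nu0 (fun=> 1) hpi.
under eq_bigr do rewrite mulr1.
move=> ->; under eq_bigr do rewrite resolvent_cst //.
rewrite -mulr_suml hnu.2 !mul1r divff //.
by rewrite gt_eqF // subr1_discount_gt0.
Qed.

(** Only the visit at time 0 is kept. This carries the relative condition number, stated against
    [nu0], over to [nu^(t)] at the cost of one factor [1/(1 - gamma)]. *)
Lemma nu_visit_ge nu0 pi x : is_policy pi -> is_distr nu0 ->
  (1 - gamma) * nu0 x <= nu_visit M nu0 pi x.
Proof.
move=> hpi hnu; rewrite nu_visitE // ler_wpM2l ?(ltW (subr1_discount_gt0 M)) //.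
rewrite (bigD1 x) //= -[leLHS]addr0 lerD //.
  rewrite -[leLHS]mulr1 ler_wpM2l ?hnu.1 //.
  have := @resolvent_self_le _ _ _ M pi (fun z => (z == x)%:R) x hpi.
  by rewrite eqxx; apply.
by rewrite sumr_ge0 // => y _; rewrite mulr_ge0 ?hnu.1 // resolvent_ge0.
Qed.

Lemma d_visit_distr rho pi : is_policy pi -> is_distr rho -> is_distr (d_visit M rho pi).
Proof.
move=> hpi hrho; split=> [s|].
  rewrite d_visitE // mulr_ge0 ?(ltW (subr1_discount_gt0 M)) // sumr_ge0 // => x _.
  by rewrite mulr_ge0 ?resolvent_ge0 // mulr_ge0 ?hrho.1 ?(hpi _).1.
have := sum_d_visit_state rho (fun=> 1) hpi.
under eq_bigr do rewrite mulr1.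
move=> ->; under eq_bigr do rewrite (resolvent_cst _ 1) //.
rewrite sum_from_distr; under eq_bigr do rewrite -mulr_suml (hpi _).2 mul1r.
rewrite -mulr_suml hrho.2 !mul1r divff //.
by rewrite gt_eqF // subr1_discount_gt0.
Qed.

Lemma Q_itv o pi x : is_policy pi -> 0 <= Q M o pi x <= (1 - gamma)^-1.
Proof.
move=> hpi; rewrite QE //; apply/andP; split.
  by apply: resolvent_ge0 => // y; case/andP: (payoff_itv M o y).
rewrite -[leRHS]mul1r -(resolvent_cst M 1 x hpi); apply: le_resolvent => // y.
by case/andP: (payoff_itv M o y).
Qed.

Lemma Vs_itv o pi s : is_policy pi -> 0 <= Vs M o pi s <= (1 - gamma)^-1.
Proof.
by move=> hpi; rewrite VsE //; apply: mean_itv => // a; exact: Q_itv.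
Qed.

Lemma V_itv rho o pi : is_policy pi -> is_distr rho ->
  0 <= V M rho o pi <= (1 - gamma)^-1.
Proof.
by move=> hpi hrho; apply: mean_itv => // s; exact: Vs_itv.
Qed.

Lemma Q_bellman o pi x : is_policy pi ->
  Q M o pi x = payoff M o x + gamma * \sum_s trans M x s * Vs M o pi s.
Proof.
move=> hpi; rewrite QE // resolventE // transitionE; congr (_ + _ * _).
apply: eq_bigr => s _; rewrite VsE //; congr (_ * _).
by apply: eq_bigr => a _; rewrite QE.
Qed.

(** The resolvent under [pi'] of the mean advantage [h] is [Q^{pi'} - Q^{pi} + h]: the Bellman
    equations of both policies verify its fixed-point equation. Averaging over the initial action
    then leaves [V^{pi'} - V^{pi}]. *)
Lemma performance_difference rho o pi pi' : is_policy pi -> is_policy pi' ->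
  \sum_s d_visit M rho pi' s * (policy_mean pi' (Q M o pi) s - Vs M o pi s) =
  (1 - gamma) * (V M rho o pi' - V M rho o pi).
Proof.
move=> hpi hpi'; pose h s := policy_mean pi' (Q M o pi) s - Vs M o pi s.
rewrite (sum_d_visit_state _ h) //; congr (_ * _).
have gE : resolvent M pi' (h \o fst) =1 fun x => Q M o pi' x - Q M o pi x + h x.1.
  apply: eq_resolvent => // x.
  have -> : transition M pi' (fun x => Q M o pi' x - Q M o pi x + h x.1) x =
      transition M pi' (Q M o pi') x - \sum_s trans M x s * Vs M o pi s.
    transitivity (transition M pi' (Q M o pi') x + -1 * transition M pi' (Q M o pi) x +
        transition M pi' (h \o fst) x).
      rewrite -transitionZ -!transitionD; congr (transition _ _ _ _).
      by apply/funext => y; rewrite mulN1r.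
    rewrite transition_state // (transitionE M pi' (Q M o pi)).
    under [X in _ + X]eq_bigr do rewrite mulrBr.
    by rewrite sumrB /policy_mean; ring.
  have QT : Q M o pi' x = payoff M o x + gamma * transition M pi' (Q M o pi') x.
    rewrite {1}QE // resolventE // (_ : resolvent _ _ _ = Q M o pi') //.
    by apply/funext => y; rewrite QE.
  by rewrite {1}QT (Q_bellman o x hpi) /=; ring.
under eq_bigr do rewrite gE.
rewrite sum_from_distr /V -sumrB; apply: eq_bigr => s _; rewrite -mulrBr; congr (_ * _).
under eq_bigr do rewrite mulrDr mulrBr.
rewrite big_split sumrB /= -mulr_suml (hpi' s).2 mul1r -VsE //.
by rewrite /h /policy_mean; ring.
Qed.

(** The flow equation is tested against the value function of [pi]. By the Bellman equation the
    payoff is the value minus its discounted expected successor, so everything but the initial term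
    cancels. *)
Lemma sum_flow_payoff rho o pi (D : S -> R) : is_policy pi ->
  (forall f, \sum_s D s * f s = (1 - gamma) * \sum_s rho s * f s +
    gamma * \sum_s D s * policy_mean pi (fun x => \sum_s' trans M x s' * f s') s) ->
  \sum_s D s * policy_mean pi (payoff M o) s = (1 - gamma) * V M rho o pi.
Proof.
move=> hpi flow.
have -> : policy_mean pi (payoff M o) = fun s => Vs M o pi s - gamma *
    policy_mean pi (fun x => \sum_s' trans M x s' * Vs M o pi s') s.
  apply/funext => s; rewrite VsE // /policy_mean mulr_sumr -sumrB.
  by apply: eq_bigr => a _; rewrite Q_bellman //; ring.
under eq_bigr do rewrite mulrBr mulrCA.
by rewrite sumrB -mulr_sumr flow /V; ring.
Qed.

(** Values are not linear in the policy, but they are linear in the occupancy measure. [D] and [N]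
    are the mixed state and state-action masses, [pi] is the conditional law of the action under
    [N], and the flow equations of the [p i] add up to that of [pi]. *)
Lemma policy_mixture rho (I : finType) (w : I -> R) (p : I -> S -> A -> R) :
  is_distr rho -> is_distr w -> (forall i, is_policy (p i)) ->
  exists pi, is_policy pi /\ forall o, V M rho o pi = \sum_i w i * V M rho o (p i).
Proof.
move=> hrho hw hp.
have [i0 _ | I0] := pickP (@predT I); last first.
  by have := hw.2; rewrite big_pred0 // => /esym/eqP; rewrite oner_eq0.
pose d i := d_visit M rho (p i).
have d0 i s : 0 <= d i s by exact: (d_visit_distr (hp i) hrho).1.
have wd0 i s : 0 <= w i * d i s by rewrite mulr_ge0 ?hw.1.
pose D s := \sum_i w i * d i s.
pose N s a := \sum_i w i * d i s * p i s a.
(* A state of mass 0 receives an arbitrary policy of the family; there every [w i * d i s] vanishes,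
   so [N] vanishes too and [DE] still holds. *)
pose pi s a := if D s == 0 then p i0 s a else N s a / D s.
have hpi : is_policy pi.
  move=> s; rewrite /pi; case: eqVneq => [_|Ds0]; first exact: hp.
  split=> [a|].
    rewrite divr_ge0 //; apply: sumr_ge0 => i _ //.
    by rewrite mulr_ge0 // (hp i s).1.
  rewrite -mulr_suml exchange_big /=.
  under eq_bigr do rewrite -mulr_sumr (hp _ s).2 mulr1.
  by rewrite divff.
have DE f : \sum_s D s * policy_mean pi f s = \sum_i w i * \sum_s d i s * policy_mean (p i) f s.
  under [RHS]eq_bigr do rewrite mulr_sumr.
  rewrite [RHS]exchange_big; apply: eq_bigr => s _ /=.
  transitivity (\sum_a N s a * f (s, a)).
    rewrite /policy_mean mulr_sumr; apply: eq_bigr => a _; rewrite mulrA; congr (_ * _).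
    rewrite /pi; case: eqVneq => [Ds0|Ds0]; last by rewrite mulrC divfK.
    rewrite Ds0 mul0r /N big1 // => i _; have /eqP := Ds0.
    by rewrite psumr_eq0 // => /allP /(_ i); rewrite mem_index_enum => /(_ isT) /eqP ->; rewrite mul0r.
  transitivity (\sum_a \sum_i w i * d i s * p i s a * f (s, a)).
    by apply: eq_bigr => a _; rewrite -mulr_suml.
  rewrite exchange_big; apply: eq_bigr => i _ /=; rewrite /policy_mean mulrA mulr_sumr.
  by apply: eq_bigr => a _; rewrite mulrA.
exists pi; split=> // o.
apply: (@mulfI _ (1 - gamma)); first by rewrite gt_eqF // subr1_discount_gt0.
rewrite -(@sum_flow_payoff rho o pi D hpi) => [|f].
  rewrite DE mulr_sumr; apply: eq_bigr => i _; rewrite mulrCA; congr (_ * _).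
  rewrite sum_d_visit // VE //; congr (_ * _); apply: eq_bigr => x _.
  by rewrite QE.
rewrite DE; under eq_bigr do rewrite mulr_suml.
rewrite exchange_big /=.
transitivity (\sum_i w i * \sum_s d i s * f s).
  by apply: eq_bigr => i _; rewrite mulr_sumr; apply: eq_bigr => s _; rewrite mulrA.
transitivity (\sum_i w i * ((1 - gamma) * \sum_s rho s * f s + gamma *
    \sum_s d i s * policy_mean (p i) (fun x => \sum_s' trans M x s' * f s') s)).
  by apply: eq_bigr => i _; rewrite -(d_visit_flow rho f (hp i)).
under [LHS]eq_bigr do rewrite mulrDr.
rewrite big_split /= -mulr_suml hw.2 mul1r; congr (_ + _).
by rewrite mulr_sumr; apply: eq_bigr => i _; rewrite mulrCA.
Qed.

End Trajectories.

(** * Sums over random-length rollouts *)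

Section CountableSums.
Context {R : realType}.
Local Open Scope ereal_scope.

Lemma esum_finType (T : finType) (f : T -> \bar R) : (forall x, 0 <= f x) ->
  \esum_(x in [set: T]) f x = \sum_x f x.
Proof.
move=> f0; rewrite esum_fset //; last exact: finite_finset.
have -> : [set: T] = [set` index_enum T].
  by apply/seteqP; split => // x _ /=; rewrite mem_index_enum.
by rewrite -fsbig_seq // index_enum_uniq.
Qed.

Lemma esum_pair (T1 T2 : choiceType) (f : T1 * T2 -> \bar R) : (forall x, 0 <= f x) ->
  \esum_(x in [set: T1 * T2]) f x = \esum_(x in [set: T1]) \esum_(y in [set: T2]) f (x, y).
Proof.
move=> f0; rewrite esum_esum //.
have -> : [set: T1] `*`` (fun=> [set: T2]) = [set: T1 * T2] by apply/seteqP; split.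
by apply: eq_esum => -[].
Qed.

(** One inequality is read off finite partial sums; applied to the inverse factor it gives the
    other. *)
Lemma esumZ (T : choiceType) (c : R) (f : T -> \bar R) : (0 <= c)%R -> (forall x, 0 <= f x) ->
  \esum_(x in [set: T]) (c%:E * f x) = c%:E * \esum_(x in [set: T]) f x.
Proof.
have le (d : R) (g : T -> \bar R) : (0 <= d)%R -> (forall x, 0 <= g x) ->
    \esum_(x in [set: T]) (d%:E * g x) <= d%:E * \esum_(x in [set: T]) g x.
  move=> d0 g0; apply: ge_ereal_sup => _ [X [finX _] <-].
  rewrite -ge0_mule_fsumr //; apply: lee_wpmul2l; first by rewrite lee_fin.
  by apply: esum_ge; exists X.
move=> c0 f0; apply/eqP; rewrite eq_le le //=.
have [->|cn0] := eqVneq c 0%R; first by rewrite mul0e esum_ge0 // => x _; rewrite mul0e.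
have {c0 cn0} c0 : (0 < c)%R by rewrite lt_def cn0.
have := le (c^-1)%R (fun x => c%:E * f x).
under eq_esum do rewrite muleA -EFinM mulVf ?gt_eqF // mul1e.
rewrite invr_ge0 (ltW c0) => /(_ isT) h.
have c1 : c%:E * (c^-1)%:E = 1 by rewrite -EFinM divff // gt_eqF.
rewrite -[leRHS]mul1e -c1 -muleA lee_wpmul2l ?lee_fin ?(ltW c0) //.
by apply: h => x; rewrite mule_ge0 // lee_fin ltW.
Qed.

Lemma eq_nneseries_lim (u : nat -> R) l : (forall n, 0 <= u n)%R ->
  series u @ \oo --> l -> \sum_(n <oo) (u n)%:E = l%:E.
Proof.
move=> u0 ul; rewrite -(cvg_lim (@norm_hausdorff _ R) ul).
rewrite -EFin_lim; last exact: cvgP ul.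
by congr (limn _); apply/funext => n /=; rewrite sumEFin.
Qed.

(** Sorting trajectories by length leaves a series of finite sums, in which the geometric
    termination probability is constant on each term. *)
Lemma esum_trajectory (S A : finType) (g : trajectory S A -> \bar R) :
  (forall tau, 0 <= g tau) ->
  \esum_(tau in [set: trajectory S A]) g tau =
  \sum_(n <oo) \sum_(x : S * A) \sum_(p : n.-tuple (S * A)) g (x, tval p).
Proof.
move=> g0; rewrite nneseries_esumT => [|n]; last by do 2 apply: sume_ge0 => ? _.
have -> : [set: trajectory S A] = \bigcup_(n in [set: nat]) [set tau | size tau.2 = n].
  by apply/seteqP; split => // tau _; exists (size tau.2).
rewrite esum_bigcupT //; last first.
  by apply/trivIsetP => i j _ _ /eqP ij; apply/seteqP; split => // tau /= [ti tj]; apply: ij; rewrite -ti.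
apply: eq_esum => n _.
rewrite pair_bigA /= -esum_finType => [|x]; last exact: g0.
apply: (@reindex_esum _ _ _ _ _ (fun xp : (S * A) * n.-tuple (S * A) => (xp.1, tval xp.2))); split => /=.
- by move=> xp _ /=; rewrite size_tuple.
- by move=> [x p] [y q] _ _ /= [-> /val_inj ->].
- move=> [x p] /= /eqP sp; by exists (x, Tuple sp).
Qed.

End CountableSums.

(** * Rollouts of geometric length: unbiasedness and second moments *)

Section Rollouts.
Context {R : realType} {S A : finType} (M : cmdp R S A).
Local Notation gamma := (discount M).
Local Notation u := ((1 - gamma)^-1).
Implicit Types (pi : S -> A -> R) (mu : S * A -> R) (F : trajectory S A -> R).

Lemma follow_prob_ge0 pi x p : is_policy pi -> 0 <= follow_prob M pi x p.
Proof.
move=> hpi; elim: p x => [|y p IHp] x //=.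
by rewrite mulr_ge0 // transition_weight_ge0.
Qed.

Lemma rollout_law_ge0 mu pi tau : is_policy pi -> (forall x, 0 <= mu x) ->
  0 <= rollout_law M mu pi tau.
Proof.
move=> hpi mu0; rewrite !mulr_ge0 ?exprn_ge0 ?discount_ge0 ?follow_prob_ge0 //.
exact: ltW (subr1_discount_gt0 M).
Qed.

Lemma expect_from_ge0 pi n F x : is_policy pi -> (forall tau, 0 <= F tau) ->
  0 <= expect_from M pi n F x.
Proof.
by move=> hpi F0; apply: sumr_ge0 => p _; rewrite mulr_ge0 ?follow_prob_ge0.
Qed.

Lemma esum_rollout mu pi F : is_policy pi -> (forall x, 0 <= mu x) ->
  (forall tau, 0 <= F tau) ->
  (\esum_(tau in [set: trajectory S A]) (rollout_law M mu pi tau * F tau)%:E =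
  \sum_(n <oo) (gamma ^+ n * (1 - gamma) * traj_expect M mu pi n F)%:E)%E.
Proof.
move=> hpi mu0 F0; rewrite esum_trajectory => [|tau]; last first.
  by rewrite lee_fin mulr_ge0 ?rollout_law_ge0.
apply: eq_eseriesr => n _; rewrite mulr_sumr -sumEFin; apply: eq_bigr => x _.
rewrite mulr_sumr -sumEFin; apply: eq_bigr => p _; congr (_%:E).
by rewrite /rollout_law /= size_tuple; ring.
Qed.

Lemma esum_rollout_accepted mu pi f : is_policy pi -> (forall x, 0 <= mu x) ->
  (forall x, 0 <= f x) ->
  (\esum_(tau in [set: trajectory S A]) (rollout_law M mu pi tau * f (accepted tau))%:E =
  ((1 - gamma) * \sum_x mu x * resolvent M pi f x)%:E)%E.
Proof.
move=> hpi mu0 f0; rewrite (esum_rollout (F := fun tau => f (accepted tau))) //.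
apply: eq_nneseries_lim => [n|].
  rewrite !mulr_ge0 ?exprn_ge0 ?discount_ge0 ?(ltW (subr1_discount_gt0 M)) //.
  rewrite traj_expectE; apply: sumr_ge0 => x _.
  by rewrite mulr_ge0 ?expect_from_ge0.
have -> : series (fun n => gamma ^+ n * (1 - gamma) *
    traj_expect M mu pi n (fun tau => f (accepted tau))) =
    fun n => (1 - gamma) * \sum_x mu x *
      series (fun t => gamma ^+ t * iter t (transition M pi) f x) n.
  apply/funext => n; rewrite /series /=.
  under [in RHS]eq_bigr do rewrite mulr_sumr.
  rewrite exchange_big mulr_sumr; apply: eq_bigr => t _ /=.
  rewrite traj_expectE !mulr_sumr; apply: eq_bigr => x _.
  by rewrite expect_from_accepted; ring.
by apply: cvgMr; apply: cvg_sumr => x; apply: cvgMr; exact: cvg_resolvent.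
Qed.

Lemma esum_rollout_law mu pi : is_policy pi -> is_distr mu ->
  (\esum_(tau in [set: trajectory S A]) (rollout_law M mu pi tau)%:E = 1)%E.
Proof.
move=> hpi [mu0 mu1].
have := @esum_rollout_accepted mu pi (fun=> 1) hpi mu0.
under eq_bigr do rewrite resolvent_cst // mul1r.
under eq_esum do rewrite mulr1.
move=> -> //; rewrite -mulr_suml mu1 mul1r divff //.
by rewrite gt_eqF // subr1_discount_gt0.
Qed.

(** The limit is the mean of [(a + K')^2] for a geometric [K'] of mean [u] and second moment
    [2 u^2 - u]. By memorylessness the missing tail is [gamma ^+ N] times the same expression with
    [a + N] for [a], which makes the induction exact. *)
Lemma sum_geometric_sq a N :
  \sum_(n < N) gamma ^+ n * (1 - gamma) * (a + n.+1%:R) ^+ 2 =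
  a ^+ 2 + 2 * a * u + 2 * u ^+ 2 - u -
  gamma ^+ N * ((a + N%:R) ^+ 2 + 2 * (a + N%:R) * u + 2 * u ^+ 2 - u).
Proof.
have h := subr1_discount_gt0 M.
elim: N => [|N IHN]; first by rewrite big_ord0 expr0 addr0 mul1r subrr.
rewrite big_ord_recr /= IHN [gamma ^+ N.+1]exprS -[N.+1%:R]natr1.
have : gamma = 1 - (1 - gamma) by ring.
move: (gamma ^+ N) (N%:R : R) => g n; move: (1 - gamma) h => v v0 ->; field.
by rewrite gt_eqF.
Qed.

Lemma sum_geometric_sq_le a N : 0 <= a ->
  \sum_(n < N) gamma ^+ n * (1 - gamma) * (a + n.+1%:R) ^+ 2 <=
  a ^+ 2 + 2 * a * u + 2 * u ^+ 2 - u.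
Proof.
move=> a0; rewrite sum_geometric_sq gerBl mulr_ge0 ?exprn_ge0 ?discount_ge0 //.
have u1 : 1 <= u.
  by rewrite invf_ge1 ?subr1_discount_gt0 // gerBl discount_ge0.
have aN : 0 <= a + N%:R by rewrite addr_ge0.
nra.
Qed.

(** The partial sums of [sum_geometric_sq] at [a = 0] are monotone and bounded, so the terms of that
    series vanish in the limit, and [n <= (n + 1)^2]. *)
Lemma natr_expr_cvg0 : (gamma ^+ n * n%:R) @[n --> \oo] --> (0 : R).
Proof.
have h := subr1_discount_gt0 M.
have c : cvgn (series (fun n => gamma ^+ n * (1 - gamma) * (0 + n.+1%:R) ^+ 2)).
  apply: nondecreasing_is_cvgn.
    apply/nondecreasing_seqP => n; rewrite /series /= big_nat_recr //= lerDl.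
    by rewrite !mulr_ge0 ?exprn_ge0 ?discount_ge0 // ltW.
  exists (0 ^+ 2 + 2 * 0 * u + 2 * u ^+ 2 - u) => _ [n _ <-].
  by rewrite /series /= big_mkord sum_geometric_sq_le.
have /(@cvgMr _ _ _ _ _ u) := cvg_series_cvg_0 c.
rewrite mulr0; apply: squeeze_cvgr; last exact: cvg_cst.
apply: nearW => n; rewrite mulr_ge0 ?exprn_ge0 ?discount_ge0 //=.
have -> : u * (gamma ^+ n * (1 - gamma) * (0 + n.+1%:R) ^+ 2) = gamma ^+ n * n.+1%:R ^+ 2.
  by rewrite add0r; field; rewrite gt_eqF.
rewrite ler_wpM2l ?exprn_ge0 ?discount_ge0 // -natrX ler_nat.
by rewrite -mulnn (leq_trans (leqnSn n)) // leq_pmulr.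
Qed.

Lemma transition_sum pi n (F : 'I_n -> S * A -> R) x :
  transition M pi (fun y => \sum_i F i y) x = \sum_i transition M pi (F i) x.
Proof.
by rewrite exchange_big; apply: eq_bigr => y _; rewrite mulr_sumr.
Qed.

Lemma expect_from_total pi c n x : is_policy pi ->
  expect_from M pi n (traj_total c) x = \sum_(i < n.+1) iter i (transition M pi) c x.
Proof.
move=> hpi; elim: n x => [|n IHn] x.
  by rewrite expect_from0 /traj_total big_ord1 /= big_cons big_nil addr0.
rewrite expect_fromS big_ord_recl /=.
transitivity (transition M pi (fun y => c x + \sum_(i < n.+1) iter i (transition M pi) c y) x).
  congr (transition _ _ _ _); apply/funext => y; rewrite -IHn.
  rewrite -[X in X + _](expect_from_cst M n (c x) y hpi) -expect_fromD.
  by apply: eq_expect_from => p _; rewrite /traj_total /= big_cons.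
rewrite transitionD transition_cst //; congr (_ + _).
exact: transition_sum.
Qed.

(** Summation by parts: step [i] is counted by all rollouts longer than [i], an event of probability
    [gamma ^+ i]. Hence the undiscounted sum over a geometric length estimates the discounted sum
    without bias; the subtracted term is due to rollouts longer than [N]. *)
Lemma series_rollout_total pi c x : is_policy pi ->
  series (fun n => gamma ^+ n * (1 - gamma) * expect_from M pi n (traj_total c) x) =
  fun N => series (fun t => gamma ^+ t * iter t (transition M pi) c x) N -
    gamma ^+ N * \sum_(i < N) iter i (transition M pi) c x.
Proof.
move=> hpi; apply/funext; elim=> [|N IHN].
  by rewrite /series /= !big_geq // big_ord0 mulr0 subr0.
rewrite /series /= big_nat_recr // [in RHS]big_nat_recr //= -!/(series _ _).
move: IHN; rewrite /series /= => ->; rewrite expect_from_total // big_ord_recr /= exprS.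
by ring.
Qed.

Lemma cvg_rollout_total pi c x : is_policy pi ->
  series (fun n => gamma ^+ n * (1 - gamma) * expect_from M pi n (traj_total c) x) @ \oo
  --> resolvent M pi c x.
Proof.
move=> hpi; rewrite series_rollout_total // -[X in _ --> X]subr0.
apply: cvgB; first exact: cvg_resolvent.
have [b b0 cb] := fin_fun_bounded c.
apply/norm_cvg0P/squeeze_cvgr; last 2 first.
- exact: (cvg_cst 0).
- have := @cvgMr _ _ _ _ _ b _ natr_expr_cvg0.
  by rewrite mulr0; exact.
apply: nearW => n; rewrite normr_ge0 /= normrM ger0_norm ?exprn_ge0 ?discount_ge0 //.
rewrite mulrCA ler_wpM2l ?exprn_ge0 ?discount_ge0 //.
rewrite (le_trans (ler_norm_sum _ _ _)) //.
apply: (@le_trans _ _ (\sum_(i < n) b)).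
  by apply: ler_sum => i _; exact: norm_iter_transition.
by rewrite sumr_const card_ord mulr_natr.
Qed.

Lemma traj_total_ge0 (c : S * A -> R) tau : (forall x, 0 <= c x) -> 0 <= traj_total c tau.
Proof. by move=> c0; apply: sumr_ge0. Qed.

Lemma esum_rollout_total mu pi c : is_policy pi -> (forall x, 0 <= mu x) ->
  (forall x, 0 <= c x) ->
  (\esum_(tau in [set: trajectory S A]) (rollout_law M mu pi tau * traj_total c tau)%:E =
  (\sum_x mu x * resolvent M pi c x)%:E)%E.
Proof.
move=> hpi mu0 c0; rewrite esum_rollout // => [|tau]; last exact: traj_total_ge0.
apply: eq_nneseries_lim => [n|].
  rewrite !mulr_ge0 ?exprn_ge0 ?discount_ge0 ?(ltW (subr1_discount_gt0 M)) //.
  rewrite traj_expectE; apply: sumr_ge0 => x _.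
  by rewrite mulr_ge0 ?expect_from_ge0 // => tau; exact: traj_total_ge0.
have -> : series (fun n => gamma ^+ n * (1 - gamma) *
    traj_expect M mu pi n (traj_total c)) =
    fun n => \sum_x mu x *
      series (fun n => gamma ^+ n * (1 - gamma) * expect_from M pi n (traj_total c) x) n.
  apply/funext => n; rewrite /series /=.
  under [in RHS]eq_bigr do rewrite mulr_sumr.
  rewrite exchange_big; apply: eq_bigr => t _ /=.
  by rewrite traj_expectE !mulr_sumr; apply: eq_bigr => x _; ring.
by apply: cvg_sumr => x; apply: cvgMr; exact: cvg_rollout_total.
Qed.

Lemma esum_rollout_size_sq mu pi a : is_policy pi -> is_distr mu -> 0 <= a ->
  (\esum_(tau in [set: trajectory S A])
     (rollout_law M mu pi tau * (a + (size tau.2).+1%:R) ^+ 2)%:E <=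
  (a ^+ 2 + 2 * a * u + 2 * u ^+ 2 - u)%:E)%E.
Proof.
move=> hpi [mu0 mu1] a0.
rewrite (esum_rollout (F := fun tau => (a + (size tau.2).+1%:R) ^+ 2)) => [|||tau]//.
  2: by rewrite exprn_ge0 // addr_ge0.
have e n : traj_expect M mu pi n (fun tau => (a + (size tau.2).+1%:R) ^+ 2) =
    (a + n.+1%:R) ^+ 2.
  rewrite traj_expectE.
  under eq_bigr => x _.
    rewrite (@eq_expect_from _ _ _ _ _ _ _ (fun=> (a + n.+1%:R) ^+ 2)) => [|p /= ->//].
    rewrite expect_from_cst //; over.
  by rewrite -mulr_suml mu1 mul1r.
under eq_eseriesr do rewrite e.
apply: lime_le.
  apply: is_cvg_nneseries => n _ _; rewrite lee_fin.
  by rewrite !mulr_ge0 ?exprn_ge0 ?discount_ge0 ?(ltW (subr1_discount_gt0 M)) // addr_ge0.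
by apply: nearW => n; rewrite sumEFin lee_fin big_mkord sum_geometric_sq_le.
Qed.

End Rollouts.

(** * The log-partition bound *)

Lemma is_derive_sumr {R : realType} {I : Type} (r : seq I) (f : I -> R -> R) (df : I -> R) (t : R) :
  (forall i, is_derive t (1 : R) (f i) (df i)) ->
  is_derive t (1 : R) (fun s => \sum_(i <- r) f i s) (\sum_(i <- r) df i).
Proof.
move=> hf; elim: r => [|i r IHr].
  rewrite big_nil (_ : (fun s => _) = cst 0); first exact: is_derive_cst.
  by apply/funext => s; rewrite big_nil.
rewrite big_cons (_ : (fun s => _) = f i + (fun s => \sum_(i <- r) f i s)).
  exact: is_deriveD.
by apply/funext => s; rewrite big_cons.
Qed.

Lemma le_of_derive_le0 {R : realType} (f df : R -> R) :
  (forall t, is_derive t (1 : R) f (df t)) -> (forall t, 0 < t -> df t <= 0) ->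
  forall t, 0 <= t -> f t <= f 0.
Proof.
move=> hf df0 t t0; apply: (@ler0_derive1_nincr R f 0 t) => //.
- by move=> s; rewrite in_itv /= => /andP[s0 _]; rewrite derive1E derive_val df0.
- by apply: derivable_within_continuous => s _; apply: ex_derive.
Qed.

Section LogPartition.
Context {R : realType} {A : finType} (p x : A -> R) (m : R).
Hypotheses (p_distr : is_distr p) (xm : forall a, `|x a| <= m).

Let mu := \sum_a p a * x a.
Let S0 (t : R) := \sum_a p a * expR (t * x a).
Let S1 (t : R) := \sum_a p a * x a * expR (t * x a).
Let S2 (t : R) := \sum_a p a * x a ^+ 2 * expR (t * x a).
(** The exponent of a sub-Gaussian bound: the goal of the section is [S0 t <= expR (e t)] at
    [t = 1]. *)
Let e (t : R) := mu * t + m ^+ 2 / 2 * t ^+ 2.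

Let derive_term (c y t : R) :
  is_derive t (1 : R) (fun s => c * expR (s * y)) (c * y * expR (t * y)).
Proof.
have h : is_derive t (1 : R) (fun s : R => s * y) y.
  rewrite (_ : (fun s => _) = y \*: id); last by apply/funext => s; rewrite /= mulrC.
  by apply: is_derive_eq; rewrite /GRing.scale /= mulr1.
have h2 := @is_derive1_comp _ expR (fun s : R => s * y) t _ _ (is_derive_expR (t * y)) h.
rewrite (_ : (fun s => _) = c \*: (expR \o (fun s => s * y))) //.
by apply: is_derive_eq; rewrite /GRing.scale /= -mulrA [expR _ * _]mulrC.
Qed.

Let derive_S0 t : is_derive t (1 : R) S0 (S1 t).
Proof. exact: is_derive_sumr. Qed.

Let derive_S1 t : is_derive t (1 : R) S1 (S2 t).
Proof.
rewrite /S2; under eq_bigr do rewrite expr2 mulrA.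
exact: is_derive_sumr.
Qed.

Let derive_e t : is_derive t (1 : R) e (mu + m ^+ 2 * t).
Proof.
rewrite (_ : e = mu \*: id + (m ^+ 2 / 2) \*: (id ^+ 2 : R -> R)).
  by apply: is_derive_eq; rewrite /GRing.scale /= expr1; field.
by apply/funext => s; rewrite /e !fctE.
Qed.

Let derive_expe (c t : R) : is_derive t (1 : R) (fun s => expR (c * e s))
  (c * (mu + m ^+ 2 * t) * expR (c * e t)).
Proof.
have h : is_derive t (1 : R) (c \*: e) (c * (mu + m ^+ 2 * t)) by exact: (is_deriveZ c (derive_e t)).
have := @is_derive1_comp _ expR (c \*: e) t _ _ (is_derive_expR (c * e t)) h.
by rewrite mulrC.
Qed.

(** Two integrations replace the second derivative of the log-partition function. With
    [H = S1 - e' S0], the bound [S2 <= m^2 S0] makes [H * expR e] nonincreasing from the value 0, so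
    [H <= 0]; hence [S0 * expR (- e)] is nonincreasing from the value 1. *)
Lemma log_partition_le : ln (\sum_a p a * expR (x a)) <= mu + m ^+ 2 / 2.
Proof.
have p0 := p_distr.1.
have S0_gt0 t : 0 < S0 t.
  rewrite lt_def; apply/andP; split; last first.
    by apply: sumr_ge0 => a _; rewrite mulr_ge0 ?expR_ge0.
  apply/eqP => h; have : \sum_a p a = 0.
    apply: big1 => a _; move/eqP: h; rewrite psumr_eq0 => [|i _]; last first.
      by rewrite mulr_ge0 ?expR_ge0.
    move=> /allP /(_ a); rewrite mem_index_enum => /(_ isT).
    by rewrite mulf_eq0 (gt_eqF (expR_gt0 _)) orbF => /eqP.
  by rewrite p_distr.2 => /eqP; rewrite oner_eq0.
have S2_le t : S2 t <= m ^+ 2 * S0 t.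
  rewrite mulr_sumr; apply: ler_sum => a _; rewrite mulrA ler_wpM2r ?expR_ge0 //.
  rewrite mulrC ler_wpM2r // -real_normK ?num_real // lerXn2r ?nnegrE //.
  exact: le_trans (normr_ge0 _) (xm a).
pose H t := S1 t - (mu + m ^+ 2 * t) * S0 t.
have derive_lin t : is_derive t (1 : R) (fun t => mu + m ^+ 2 * t) (m ^+ 2).
  rewrite (_ : (fun s => _) = cst mu + (m ^+ 2) \*: id) //.
  by apply: is_derive_eq; rewrite /GRing.scale /= mulr1 add0r.
have derive_H t : is_derive t (1 : R) H (S2 t - m ^+ 2 * S0 t - (mu + m ^+ 2 * t) * S1 t).
  rewrite (_ : H = S1 - (fun t => mu + m ^+ 2 * t) * S0) //.
  apply: is_derive_eq.
    exact: (is_deriveB (derive_S1 t) (is_deriveM (derive_lin t) (derive_S0 t))).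
  by rewrite /GRing.scale /=; ring.
have H0 t : 0 <= t -> H t <= 0.
  move=> t0.
  have := @le_of_derive_le0 _ (fun t => H t * expR (1 * e t))
    (fun t => (S2 t - m ^+ 2 * S0 t - (mu + m ^+ 2 * t) ^+ 2 * S0 t) * expR (1 * e t)) _ _ t t0.
  have -> : H 0 = 0.
    rewrite /H /S1 /S0 mulr0 addr0.
    under eq_bigr do rewrite mul0r expR0 mulr1.
    under [X in _ * X]eq_bigr do rewrite mul0r expR0 mulr1.
    by rewrite p_distr.2 mulr1 subrr.
  rewrite mul0r pmulr_lle0 ?expR_gt0 //; apply.
    move=> s; rewrite (_ : (fun t => _) = H * (fun t => expR (1 * e t))) //.
    apply: (is_derive_eq (is_deriveM (derive_H s) (derive_expe 1 s))).
    by rewrite /GRing.scale /= /H; ring.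
  move=> s _; rewrite pmulr_lle0 ?expR_gt0 // -addrA -opprD subr_le0.
  by rewrite (le_trans (S2_le s)) // lerDl mulr_ge0 ?sqr_ge0 // ltW.
have := @le_of_derive_le0 _ (fun t => S0 t * expR (-1 * e t))
    (fun t => H t * expR (-1 * e t)) _ _ 1 ler01.
have -> : S0 0 * expR (-1 * e 0) = 1.
  rewrite /S0 /e expr0n /= !mulr0 addr0 mulr0 expR0 mulr1.
  by under eq_bigr do rewrite mul0r expR0 mulr1; rewrite p_distr.2.
rewrite mulN1r expRN -ler_pdivlMr ?invr_gt0 ?expR_gt0 // invrK mul1r.
have -> : S0 1 = \sum_a p a * expR (x a) by apply: eq_bigr => a _; rewrite mul1r.
have -> : e 1 = mu + m ^+ 2 / 2 by rewrite /e expr1n !mulr1.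
move=> h; rewrite -[leRHS]expRK ler_ln ?posrE ?expR_gt0 //; last first.
  by have := S0_gt0 1; rewrite /S0; under eq_bigr do rewrite mul1r.
apply: h => [t|t t0]; last by rewrite pmulr_lle0 ?expR_gt0 ?H0 // ltW.
rewrite (_ : (fun t => _) = S0 * (fun t => expR (-1 * e t))) //.
apply: (is_derive_eq (is_deriveM (derive_S0 t) (derive_expe (-1) t))).
by rewrite /GRing.scale /= /H; ring.
Qed.

End LogPartition.

(** * Euclidean projections and least squares *)

Section EuclideanSpace.
Context {R : realType} {d : nat}.
Implicit Types (u v w x y z : 'cV[R]_d).

Lemma dotE u v : dot u v = \sum_i u i 0 * v i 0.
Proof. by rewrite /dot mxE; apply: eq_bigr => i _; rewrite mxE. Qed.

Lemma dotC u v : dot u v = dot v u.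
Proof. by rewrite !dotE; apply: eq_bigr => i _; rewrite mulrC. Qed.

Lemma dotDl u v w : dot (u + v) w = dot u w + dot v w.
Proof. by rewrite !dotE -big_split; apply: eq_bigr => i _; rewrite mxE mulrDl. Qed.

Lemma dotZl c u v : dot (c *: u) v = c * dot u v.
Proof. by rewrite !dotE mulr_sumr; apply: eq_bigr => i _; rewrite mxE mulrA. Qed.

Lemma dotDr u v w : dot w (u + v) = dot w u + dot w v.
Proof. by rewrite dotC dotDl !(dotC w). Qed.

Lemma dotZr c u v : dot v (c *: u) = c * dot v u.
Proof. by rewrite dotC dotZl (dotC v). Qed.

Lemma dotNl u v : dot (- u) v = - dot u v.
Proof. by rewrite -scaleN1r dotZl mulN1r. Qed.

Lemma dotNr u v : dot v (- u) = - dot v u.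
Proof. by rewrite dotC dotNl dotC. Qed.

Lemma dot0l v : dot 0 v = 0.
Proof. by rewrite -(scale0r v) dotZl mul0r. Qed.

Lemma dot_suml (I : finType) (F : I -> 'cV[R]_d) v : dot (\sum_i F i) v = \sum_i dot (F i) v.
Proof.
by apply: (big_morph (fun w => dot w v)) => [a b|]; rewrite ?dotDl ?dot0l.
Qed.

Definition dot_lin := (dotDl, dotDr, dotNl, dotNr, dotZl, dotZr).

Lemma dot_ge0 u : 0 <= dot u u.
Proof. by rewrite dotE; apply: sumr_ge0 => i _; rewrite -expr2 sqr_ge0. Qed.

Lemma dot_eq0 u : dot u u = 0 -> u = 0.
Proof.
rewrite dotE => /eqP; rewrite psumr_eq0 => [|i _]; last by rewrite -expr2 sqr_ge0.
move=> /allP h; apply/matrixP => i j; rewrite ord1 mxE.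
by have := h i; rewrite mem_index_enum => /(_ isT); rewrite -expr2 sqrf_eq0 => /eqP.
Qed.

Lemma norm2_ge0 u : 0 <= norm2 u.
Proof. exact: sqrtr_ge0. Qed.

Lemma sqr_norm2 u : norm2 u ^+ 2 = dot u u.
Proof. by rewrite sqr_sqrtr // dot_ge0. Qed.

Lemma norm2_0 : norm2 (0 : 'cV[R]_d) = 0.
Proof. by rewrite /norm2 dot0l sqrtr0. Qed.

Lemma norm2_le u c : 0 <= c -> (norm2 u <= c) = (dot u u <= c ^+ 2).
Proof. by move=> c0; rewrite -sqr_norm2 ler_sqr ?nnegrE ?norm2_ge0. Qed.

Lemma cauchy_schwarz u v : `|dot u v| <= norm2 u * norm2 v.
Proof.
rewrite -ler_sqr ?nnegrE ?mulr_ge0 ?norm2_ge0 // real_normK ?num_real //.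
rewrite exprMn !sqr_norm2.
have [/dot_eq0 ->|v0] := eqVneq (dot v v) 0; first by rewrite dotC !dot0l mulr0 expr0n.
have vv : 0 < dot v v by rewrite lt_def v0 dot_ge0.
have := dot_ge0 (dot v v *: u - dot u v *: v).
rewrite !dot_lin (dotC v u) => h.
rewrite -(ler_pM2l vv); nra.
Qed.

Lemma norm2Z c u : norm2 (c *: u) = `|c| * norm2 u.
Proof.
rewrite /norm2 dotZl dotZr mulrA -expr2 sqrtrM ?sqr_ge0 //.
by rewrite sqrtr_sqr.
Qed.

Lemma ler_norm2D u v : norm2 (u + v) <= norm2 u + norm2 v.
Proof.
rewrite norm2_le ?addr_ge0 ?norm2_ge0 // sqrrD !sqr_norm2 !dot_lin (dotC v u).
have := le_trans (ler_norm _) (cauchy_schwarz u v); lra.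
Qed.

Lemma norm2N u : norm2 (- u) = norm2 u.
Proof. by rewrite -scaleN1r norm2Z normrN1 mul1r. Qed.

Lemma ler_norm2B u v : norm2 (u - v) <= norm2 u + norm2 v.
Proof. by rewrite (le_trans (ler_norm2D _ _)) ?norm2N. Qed.

Lemma ler_norm2_sum (I : finType) (F : I -> 'cV[R]_d) :
  norm2 (\sum_i F i) <= \sum_i norm2 (F i).
Proof.
elim/big_ind2: _ => [|a b a' b' ha hb|i _ //]; first by rewrite norm2_0.
by rewrite (le_trans (ler_norm2D _ _)) ?lerD.
Qed.

Lemma ball2_segment W y z t : 0 <= t <= 1 -> ball2 W y -> ball2 W z ->
  ball2 W (y + t *: (z - y)).
Proof.
move=> /andP[t0 t1]; rewrite /ball2 /= => hy hz.
have -> : y + t *: (z - y) = (1 - t) *: y + t *: z.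
  by rewrite scalerBr scalerBl scale1r addrAC addrA.
rewrite (le_trans (ler_norm2D _ _)) // !norm2Z !ger0_norm ?subr_ge0 //.
have := norm2_ge0 y; have := norm2_ge0 z; nra.
Qed.

(** First-order optimality without derivatives: [h] is the slope and [c] the curvature of an
    objective along a segment that starts at a minimizer. *)
Lemma linear_ge0_of_quadratic (h c : R) :
  (forall t, 0 <= t <= 1 -> 0 <= t * h + t ^+ 2 * c) -> 0 <= h.
Proof.
move=> H; rewrite leNgt; apply/negP => h0.
have k0 : 0 < `|c| - h by rewrite subr_gt0 (lt_le_trans h0).
have k1 : 0 < 1 + (`|c| - h) by rewrite addr_gt0.
(* Small enough for [t <= 1] and [t * |c| <= - h / 2], so that the quadratic term cannot compensate
   a negative slope. *)
pose t := - h / (2 * (1 + (`|c| - h))).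
have t0 : 0 < t by rewrite divr_gt0 ?oppr_gt0 // mulr_gt0.
have t1 : t <= 1.
  by rewrite ler_pdivrMr ?mulr_gt0 // mul1r; have := normr_ge0 c; lra.
have tc : t * `|c| <= - h / 2.
  have E : t * (2 * (1 + (`|c| - h))) = - h by rewrite divfK // gt_eqF // mulr_gt0.
  have := normr_ge0 c; nra.
have := H t; rewrite (ltW t0) t1 => /(_ isT).
have := ler_norm c; nra.
Qed.

(** Optimality along the segment from [y] to [z] gives [dot (x - y) (y - z) >= 0]; then
    [x - z = (x - y) + (y - z)] is at least as long as [y - z]. *)
Lemma argmin_ball_nonexpansive W x y z :
  is_argmin (ball2 W) (fun w => norm2 (x - w)) y -> ball2 W z ->
  dot (y - z) (y - z) <= dot (x - z) (x - z).
Proof.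
move=> [hy ymin] hz.
have : 0 <= 2 * dot (x - y) (y - z).
  apply: (@linear_ge0_of_quadratic _ (dot (z - y) (z - y))) => t ht.
  have := ymin _ (ball2_segment ht hy hz).
  rewrite norm2_le ?norm2_ge0 // sqr_norm2.
  rewrite !dot_lin !(dotC y _) !(dotC z x); nra.
have := dot_ge0 (x - y); rewrite !dot_lin !(dotC y _) !(dotC z _) => h1 h2; nra.
Qed.

(** [proj] is a choice that returns the point itself when there is no minimizer, so existence must
    be exhibited: outside the ball, the minimizer is the radial rescaling. *)
Lemma ball2_argmin_exists W x : 0 <= W ->
  exists y, is_argmin (ball2 W) (fun w => norm2 (x - w)) y.
Proof.
move=> W0; have [xW|Wx] := leP (norm2 x) W.
  by exists x; split => // z _; rewrite subrr norm2_0 norm2_ge0.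
have x0 : 0 < norm2 x by exact: le_lt_trans Wx.
exists ((W / norm2 x) *: x); split => [|z].
  by rewrite /ball2 /= norm2Z ger0_norm ?divr_ge0 // ?divfK ?gt_eqF // ltW.
rewrite /ball2 /= => zW; rewrite -{1}[x]scale1r -scalerBl norm2Z.
rewrite ger0_norm ?subr_ge0 ?ler_pdivrMr ?mul1r ?(ltW Wx) //.
rewrite mulrBl mul1r divfK ?gt_eqF //.
have := ler_norm2D (x - z) z; rewrite subrK; lra.
Qed.

Lemma proj_ball2P W x : 0 <= W ->
  is_argmin (ball2 W) (fun w => norm2 (x - w)) (Defs.proj (@norm2 R d) (ball2 W) x).
Proof.
move=> /(ball2_argmin_exists x) [y hy].
exact: (@xgetPex _ x [set y | is_argmin (ball2 W) (fun w => norm2 (x - w)) y] (ex_intro _ y hy)).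
Qed.

Lemma proj_ball2_in W x : 0 <= W -> norm2 (Defs.proj (@norm2 R d) (ball2 W) x) <= W.
Proof. by move=> /(proj_ball2P x)[]. Qed.

Lemma proj_ball2_nonexpansive W x z : 0 <= W -> norm2 z <= W ->
  let p := Defs.proj (@norm2 R d) (ball2 W) x in
  dot (p - z) (p - z) <= dot (x - z) (x - z).
Proof. by move=> W0 zW; exact: (argmin_ball_nonexpansive (proj_ball2P x W0) zW). Qed.

Section QuadraticForms.
Context {X : finType} (phi : X -> 'cV[R]_d).

Lemma qform_sum (nu : X -> R) w :
  qform (\sum_x nu x *: (phi x *m (phi x)^T)) w = \sum_x nu x * dot (phi x) w ^+ 2.
Proof.
rewrite /qform mulmx_suml dotC dot_suml; apply: eq_bigr => x _.
rewrite -scalemxAl dotZl -mulmxA; congr (_ * _).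
rewrite [(phi x)^T *m w]mx11_scalar -/(dot (phi x) w) mul_mx_scalar dotZl expr2.
by [].
Qed.

(** Convexity of the quadratic form: for each [x] the difference of the two sides is a variance
    under [p]. It transfers bounds on the SGD iterates to their weighted average. *)
Lemma sum_dot_sq_convex (nu : X -> R) (I : finType) (p : I -> R) (F : I -> 'cV[R]_d) :
  (forall x : X, 0 <= nu x) -> is_distr p ->
  \sum_x nu x * dot (phi x) (\sum_i p i *: F i) ^+ 2 <=
  \sum_i p i * \sum_x nu x * dot (phi x) (F i) ^+ 2.
Proof.
move=> nu0 [p0 p1].
under [leRHS]eq_bigr do rewrite mulr_sumr.
rewrite exchange_big; apply: ler_sum => x _ /=.
under [leRHS]eq_bigr do rewrite mulrCA.
rewrite -mulr_sumr ler_wpM2l // dotC dot_suml.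
under eq_bigr do rewrite dotZl dotC.
set m := \sum_i _.
rewrite -subr_ge0.
have -> : \sum_i p i * dot (phi x) (F i) ^+ 2 - m ^+ 2 =
    \sum_i p i * (dot (phi x) (F i) - m) ^+ 2.
  transitivity (\sum_i (p i * dot (phi x) (F i) ^+ 2 - 2 * m * (p i * dot (phi x) (F i)) + m ^+ 2 * p i)).
    by rewrite big_split sumrB /= -!mulr_sumr p1 -/m; ring.
  by apply: eq_bigr => i _; ring.
by apply: sumr_ge0 => i _; rewrite mulr_ge0 ?sqr_ge0.
Qed.

Lemma argmin_least_squares (nu q : X -> R) W w0 w :
  is_argmin (ball2 W) (fun w => \sum_x nu x * (q x - dot w (phi x)) ^+ 2) w0 ->
  norm2 w <= W ->
  0 <= \sum_x nu x * ((dot w0 (phi x) - q x) * dot (w - w0) (phi x)).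
Proof.
move=> [hw0 w0min] hw; rewrite -(pmulr_rge0 _ (ltr0n R 2)).
apply: (@linear_ge0_of_quadratic _ (\sum_x nu x * dot (w - w0) (phi x) ^+ 2)) => t ht.
have := w0min _ (ball2_segment ht hw0 hw).
rewrite -subr_ge0 -sumrB; congr (0 <= _).
rewrite !mulr_sumr -big_split; apply: eq_bigr => x _ /=.
by rewrite !dot_lin; ring.
Qed.

End QuadraticForms.

End EuclideanSpace.

Lemma proj_itv_nonexpansive {R : realType} (L x : R) : 0 <= L ->
  let p := Defs.proj Num.norm `[0, L] x in
  0 <= p <= L /\ forall z, 0 <= z <= L -> (p - z) ^+ 2 <= (x - z) ^+ 2.
Proof.
move=> L0 p.
have [hp pmin] : is_argmin `[0, L] (fun z => `|x - z|) p.
  apply: (@xgetPex _ x [set y | is_argmin `[0, L] (fun z => `|x - z|) y]).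
  exists (Num.max 0 (Num.min x L)); split => [|z] /=; rewrite in_itv /=.
    by rewrite le_max lexx /= ge_max L0 ge_min lexx orbT.
  move=> /andP[z0 zL]; have [x0|x0] := leP x 0.
    rewrite (min_idPl (le_trans x0 L0)) (max_idPl x0) subr0 !ler0_norm //; lra.
  have [xL|xL] := leP x L; first by rewrite (max_idPr (ltW x0)) subrr normr0.
  rewrite (max_idPr L0) !ger0_norm; lra.
move: hp; rewrite /= in_itv /= => hp; split => // z hz.
move/andP: (hp) => [p0 pL]; move/andP: (hz) => [z0 zL].
have : 0 <= 2 * ((x - p) * (p - z)).
  apply: (@linear_ge0_of_quadratic _ _ ((z - p) ^+ 2)) => t /andP[t0 t1].
  have : (`[0, L]%classic : set R) (p + t * (z - p)) by rewrite /= in_itv /=; apply/andP; split; nra.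
  move=> /pmin; rewrite -ler_sqr ?nnegrE // !real_normK ?num_real //; nra.
move=> h; rewrite -subr_ge0.
rewrite (_ : _ - _ = (x - p) ^+ 2 + 2 * ((x - p) * (p - z))); last by ring.
by rewrite addr_ge0 ?sqr_ge0.
Qed.

(** * Expectations of sequentially sampled discrete variables *)

Section DiscreteMeasurability.
Context {disp : measure_display} {Omega : measurableType disp}.

(** Measurability for the discrete sigma-algebra, without putting a measurable structure on [D]; it
    is stable under arbitrary functions. *)
Definition discrete_rv {D : Type} (h : Omega -> D) : Prop :=
  forall B : set D, measurable (h @^-1` B).

Lemma discrete_rv_comp {D D' : Type} (F : D -> D') (h : Omega -> D) :
  discrete_rv h -> discrete_rv (fun om => F (h om)).
Proof. by move=> hh B; exact: (hh (F @^-1` B)). Qed.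

Lemma countable_discrete_rv {D : countType} (h : Omega -> D) :
  (forall d, measurable (h @^-1` [set d])) -> discrete_rv h.
Proof.
move=> hh B.
rewrite (_ : _ @^-1` _ = \bigcup_(n in [set: nat])
    (if unpickle n is Some d then h @^-1` ([set d] `&` B) else set0)).
  apply: bigcup_measurable => n _; case: (unpickle n) => [d|//].
  have [Bd|nBd] := pselect (B d).
    by rewrite (_ : _ `&` _ = [set d]) //; apply/seteqP; split => x //= [] // ->.
  rewrite (_ : _ `&` _ = set0) ?preimage_set0 //.
  by apply/seteqP; split => x //= [->].
apply/seteqP; split => [om Bom|om [n _]] /=.
  by exists (pickle (h om)) => //; rewrite pickleK.
by case: (unpickle n) => // d [].
Qed.

Lemma discrete_rv_pair {D D' : countType} (h : Omega -> D) (h' : Omega -> D') :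
  discrete_rv h -> discrete_rv h' ->
  discrete_rv (fun om => (h om, h' om)).
Proof.
move=> hh hh'; apply: countable_discrete_rv => -[x y].
rewrite (_ : _ @^-1` _ = h @^-1` [set x] `&` h' @^-1` [set y]).
  exact: measurableI.
by apply/seteqP; split => om /= [-> ->].
Qed.

Lemma measurable_fun_discrete {d' : measure_display} {D : measurableType d'} (h : Omega -> D) :
  discrete_rv h -> measurable_fun setT h.
Proof. by move=> hh _ B _; rewrite setTI; exact: hh. Qed.

Context {R : realType} (P : probability Omega R).
Local Open Scope ereal_scope.

(** The fibres of [h] form a countable partition. They are numbered through [pickle], and a number
    that is not a code has an empty fibre. *)
Lemma ge0_integral_discrete {D : countType} (h : Omega -> D) (f : Omega -> \bar R) :
  discrete_rv h -> measurable_fun setT f -> (forall om, 0 <= f om) ->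
  \int[P]_om f om = \esum_(d in [set: D]) \int[P]_(om in h @^-1` [set d]) f om.
Proof.
move=> hh mf f0; pose F k := [set om | pickle (h om) = k].
have FT : \bigcup_k F k = setT by apply/seteqP; split => // om _; exists (pickle (h om)).
have mF k : measurable (F k) by exact: (hh [set d | pickle d = k]).
rewrite -[X in \int[_]_(_ in X) _]FT ge0_integral_bigcup //; last 2 first.
- by rewrite FT.
- by apply/trivIsetP => i j _ _ /eqP ij; apply/seteqP; split => // om /= [hi hj]; apply: ij; rewrite -hi.
rewrite nneseries_esumT => [|k]; last exact: integral_ge0.
rewrite (esum_mkcond [set: nat]) //.
transitivity (\esum_(k in range (pickle : D -> nat)) \int[P]_(om in F k) f om).
  rewrite [RHS]esum_mkcond; apply: eq_esum => k _; rewrite in_setT.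
  case: ifPn => // /negP kr; rewrite (_ : F k = set0) ?integral_set0 //.
  by apply/seteqP; split => // om /= hk; apply: kr; apply/mem_set; exists (h om).
rewrite (@reindex_esum _ _ _ [set: D] _ pickle); last first.
  split; [by move=> d _; exists d| |by move=> k].
  by move=> x y _ _ /(pcan_inj pickleK).
apply: eq_esum => d _; congr (integral _ _ _); apply/seteqP; split => om /=.
  by move=> /(pcan_inj pickleK).
by rewrite /F /= => ->.
Qed.

Lemma ge0_integral_comp_discrete {D : countType} (h : Omega -> D) (F : D -> \bar R) :
  discrete_rv h -> (forall x, 0 <= F x) ->
  \int[P]_om F (h om) = \esum_(x in [set: D]) (F x * P (h @^-1` [set x])).
Proof.
move=> hh F0; rewrite (ge0_integral_discrete hh) //; last first.
  by apply: measurable_fun_discrete; exact: discrete_rv_comp.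
apply: eq_esum => x _; rewrite -integral_cst; last exact: hh.
by apply: eq_integral => om; rewrite inE => /= ->.
Qed.

Lemma probability_discrete {D : countType} (h : Omega -> D) (E : set Omega) :
  discrete_rv h -> measurable E ->
  P E = \esum_(x in [set: D]) P (E `&` h @^-1` [set x]).
Proof.
move=> hh mE; rewrite -[E in LHS]setIT -integral_indic //.
rewrite (ge0_integral_discrete hh) //; last first.
  by apply/measurable_EFinP; exact: measurable_indic.
by apply: eq_esum => x _; rewrite integral_indic.
Qed.

End DiscreteMeasurability.

Section Expectation.
Context {disp : measure_display} {Omega : measurableType disp}.
Context {R : realType} (P : probability Omega R).
Implicit Types f g : Omega -> R.

Definition integrable_rv f : Prop := P.-integrable setT (EFin \o f).
Definition mean f : R := \int[P]_om f om.

Lemma meanE f : integrable_rv f -> (\int[P]_om (f om)%:E)%E = (mean f)%:E.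
Proof. by move=> hf; rewrite /mean /Rintegral fineK //; exact: integrable_fin_num. Qed.

Lemma expectationE f : integrable_rv f -> ('E_P[f])%E = (mean f)%:E.
Proof. by move=> hf; rewrite unlock meanE. Qed.

Lemma integrable_rv_measurable f : integrable_rv f -> measurable_fun setT f.
Proof. by move=> /measurable_int /measurable_EFinP. Qed.

Lemma le_integrable_rv f g : measurable_fun setT f ->
  (forall om, `|f om| <= g om) -> integrable_rv g -> integrable_rv f.
Proof.
move=> mf fg; apply: le_integrable => //; first exact/measurable_EFinP.
by move=> om _ /=; rewrite lee_fin (le_trans (fg om)) // ler_norm.
Qed.

Lemma integrable_rv_cst c : integrable_rv (fun=> c).
Proof.
by apply: (@finite_measure_integrable_cst _ _ _ P).
Qed.

Lemma bounded_integrable_rv f c : discrete_rv f -> (forall om, `|f om| <= c) ->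
  integrable_rv f.
Proof.
move=> hf fc; apply: (@le_integrable_rv _ (fun=> c)) => //; last exact: integrable_rv_cst.
exact: measurable_fun_discrete.
Qed.

Lemma integrable_rvD f g : integrable_rv f -> integrable_rv g ->
  integrable_rv (fun om => f om + g om).
Proof. by move=> hf hg; exact: (integrableD measurableT hf hg). Qed.

Lemma integrable_rvZ c f : integrable_rv f -> integrable_rv (fun om => c * f om).
Proof. by move=> hf; exact: (integrableZl measurableT c hf). Qed.

Lemma integrable_rvN f : integrable_rv f -> integrable_rv (fun om => - f om).
Proof. move=> hf; rewrite (_ : (fun om => _) = fun om => -1 * f om); first exact: integrable_rvZ.
by apply/funext => om; rewrite mulN1r. Qed.

Lemma integrable_rvB f g : integrable_rv f -> integrable_rv g ->
  integrable_rv (fun om => f om - g om).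
Proof. by move=> hf hg; apply: integrable_rvD => //; exact: integrable_rvN. Qed.

Lemma integrable_rv_sum (I : Type) (r : seq I) (F : I -> Omega -> R) :
  (forall i, integrable_rv (F i)) -> integrable_rv (fun om => \sum_(i <- r) F i om).
Proof.
move=> hF; elim: r => [|i r IHr].
  by under eq_fun do rewrite big_nil; exact: integrable_rv_cst.
by under eq_fun do rewrite big_cons; exact: integrable_rvD.
Qed.

Lemma mean_cst c : mean (fun=> c) = c.
Proof. rewrite /mean Rintegral_cst // [X in fine X](_ : _ = 1%E) ?mulr1 //.
exact: probability_setT. Qed.

Lemma meanD f g : integrable_rv f -> integrable_rv g ->
  mean (fun om => f om + g om) = mean f + mean g.
Proof. by move=> hf hg; exact: RintegralD. Qed.

Lemma meanZ c f : integrable_rv f -> mean (fun om => c * f om) = c * mean f.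
Proof. by move=> hf; exact: RintegralZl. Qed.

Lemma meanB f g : integrable_rv f -> integrable_rv g ->
  mean (fun om => f om - g om) = mean f - mean g.
Proof. by move=> hf hg; exact: RintegralB. Qed.

Lemma mean_sum (I : Type) (r : seq I) (F : I -> Omega -> R) :
  (forall i, integrable_rv (F i)) ->
  mean (fun om => \sum_(i <- r) F i om) = \sum_(i <- r) mean (F i).
Proof.
move=> hF; elim: r => [|i r IHr].
  rewrite big_nil -[RHS](mean_cst 0); congr (mean _).
  by apply/funext => om; rewrite big_nil.
rewrite big_cons -IHr -meanD //; last exact: integrable_rv_sum.
by congr (mean _); apply/funext => om; rewrite big_cons.
Qed.

Lemma le_mean f g : integrable_rv f -> integrable_rv g ->
  (forall om, f om <= g om) -> mean f <= mean g.
Proof. by move=> hf hg fg; apply: le_Rintegral. Qed.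

Lemma mean_ge0 f : (forall om, 0 <= f om) -> 0 <= mean f.
Proof. by move=> f0; apply: Rintegral_ge0. Qed.

Lemma ae_le_mean f g : integrable_rv f -> integrable_rv g ->
  (forall om, 0 <= f om) -> (forall om, 0 <= g om) ->
  {ae P, forall om, f om <= g om} -> mean f <= mean g.
Proof.
move=> hf hg f0 g0 fg; rewrite -lee_fin -!meanE //.
apply: ae_ge0_le_integral => //.
- by move=> om _; rewrite lee_fin.
- exact: measurable_int hf.
- by move=> om _; rewrite lee_fin.
- exact: measurable_int hg.
by apply: filterS fg => om h _; rewrite lee_fin.
Qed.

(** Jensen for the square root through its tangents, [sqrt f <= f / (2 c) + c / 2]: [c = 1] gives
    integrability, [c = sqrt v] is the best choice, and for [v = 0] all small [c] are used. *)
Lemma mean_sqrt_le f v : integrable_rv f -> (forall om, 0 <= f om) -> mean f <= v ->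
  integrable_rv (fun om => Num.sqrt (f om)) /\
  mean (fun om => Num.sqrt (f om)) <= Num.sqrt v.
Proof.
move=> hf f0 fv.
have amgm c om : 0 < c -> Num.sqrt (f om) <= (2 * c)^-1 * f om + c / 2.
  move=> c0; rewrite -{2}(sqr_sqrtr (f0 om)); set s := Num.sqrt _.
  rewrite -subr_ge0.
  have -> : (2 * c)^-1 * s ^+ 2 + c / 2 - s = (2 * c)^-1 * (s - c) ^+ 2.
    by field; rewrite gt_eqF.
  by rewrite mulr_ge0 ?sqr_ge0 // invr_ge0 mulr_ge0 // ltW.
have hc c : integrable_rv (fun om => (2 * c)^-1 * f om + c / 2).
  by apply: integrable_rvD (integrable_rv_cst _); exact: integrable_rvZ.
have hs : integrable_rv (fun om => Num.sqrt (f om)).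
  apply: le_integrable_rv (hc 1).
    apply: measurableT_comp; last exact: integrable_rv_measurable.
    exact: continuous_measurable_fun (@sqrt_continuous R).
  by move=> om; rewrite ger0_norm ?sqrtr_ge0 // amgm.
split => //.
have v0 : 0 <= v by apply: le_trans fv; exact: mean_ge0.
have H c : 0 < c -> mean (fun om => Num.sqrt (f om)) <= (2 * c)^-1 * v + c / 2.
  move=> c0; apply: (@le_trans _ _ ((2 * c)^-1 * mean f + c / 2)).
    rewrite -[X in _ + X]mean_cst -meanZ // -meanD //; first by apply: le_mean => // om; exact: amgm.
      exact: integrable_rvZ.
    exact: integrable_rv_cst.
  by rewrite lerD2r ler_wpM2l // invr_ge0 mulr_ge0 // ltW.
have [v00|vn0] := eqVneq v 0.
  rewrite v00 sqrtr0; apply/ler_addgt0Pr => e e0; rewrite add0r.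
  have := H e e0; rewrite v00 mulr0 add0r; lra.
have sv0 : 0 < Num.sqrt v by rewrite sqrtr_gt0 lt_def vn0.
apply: le_trans (H _ sv0) _; rewrite -{2}(sqr_sqrtr v0); set s := Num.sqrt v in sv0 *.
have -> : (2 * s)^-1 * s ^+ 2 + s / 2 = s by field; rewrite gt_eqF.
exact: lexx.
Qed.

End Expectation.

(** * Sequences of draws whose kernels depend on the past *)

Section SequentialSampling.
Context {disp : measure_display} {Omega : measurableType disp}.
Context {R : realType} (P : probability Omega R) {C : countType}.
Context (Z : nat -> Omega -> C) (N : nat) (kernel : seq C -> C -> R) (c0 : C).
Hypothesis Z_meas : forall n, discrete_rv (Z n).
Hypothesis kernel_ge0 : forall s c, 0 <= kernel s c.
Hypothesis kernel_sum : forall s, (size s < N)%N ->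
  (\esum_(c in [set: C]) (kernel s c)%:E = 1)%E.

Definition history n om : seq C := mkseq (fun i => Z i om) n.

Definition path_prob (s : seq C) : R :=
  \prod_(i < size s) kernel (take i s) (nth c0 s i).

Hypothesis Z_law : forall s, size s = N ->
  P [set om | history N om = s] = (path_prob s)%:E.

Lemma historyS n om : history n.+1 om = rcons (history n om) (Z n om).
Proof. exact: mkseqS. Qed.

Lemma size_history n om : size (history n om) = n.
Proof. exact: size_mkseq. Qed.

Lemma history_measurable n : discrete_rv (history n).
Proof.
elim: n => [|n IHn] B.
  have [hB|hB] := pselect (B [::]).
    by rewrite (_ : _ @^-1` _ = setT) //; apply/seteqP; split.
  by rewrite (_ : _ @^-1` _ = set0) //; apply/seteqP; split.
have := discrete_rv_comp (fun p => rcons p.1 p.2)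
  (discrete_rv_pair IHn (Z_meas n)).
move=> /(_ B); congr (measurable _); apply/seteqP; split => om /=; by rewrite historyS.
Qed.

Lemma path_prob_rcons s c : path_prob (rcons s c) = path_prob s * kernel s c.
Proof.
rewrite /path_prob size_rcons big_ord_recr /=; congr (_ * _).
  apply: eq_bigr => i _; rewrite nth_rcons ltn_ord -cats1 takel_cat //.
  exact: ltnW.
by rewrite nth_rcons ltnn eqxx -cats1 take_size_cat.
Qed.

Lemma path_prob_ge0 s : 0 <= path_prob s.
Proof. exact: prodr_ge0. Qed.

(** The law is given for complete sequences of [N] draws only. Descending from [N], the sum over the
    last draw removes one kernel factor, of total mass 1. *)
Lemma history_law n s : (n <= N)%N -> size s = n ->
  P [set om | history n om = s] = (path_prob s)%:E.
Proof.
move=> nN; move: s; rewrite -(subKn nN); elim: (N - n)%N (leq_subr n N) => [|k IHk] kN s sz.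
  by rewrite subn0 in sz *; exact: Z_law.
have Sk : (N - k = (N - k.+1).+1)%N by rewrite subnS prednK // subn_gt0.
set m := (N - k.+1)%N in Sk sz *.
have mE : measurable [set om | history m om = s] by exact: (history_measurable m [set s]).
rewrite (probability_discrete P (Z_meas m) mE).
transitivity (\esum_(c in [set: C]) ((path_prob s)%:E * (kernel s c)%:E))%E.
  apply: eq_esum => c _; rewrite -EFinM -path_prob_rcons -IHk ?(ltnW kN) //; last first.
    by rewrite size_rcons sz.
  rewrite Sk; congr (P _); apply/seteqP; split => om /=; rewrite historyS.
    by move=> [-> ->].
  by move=> /rcons_inj [-> ->].
rewrite esumZ ?path_prob_ge0 // => [|c]; last by rewrite lee_fin.
by rewrite kernel_sum ?mule1 // sz /m ltn_subrL /= (leq_trans _ kN).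
Qed.

(** The tower property: both sides are expanded over pairs of a past and a next draw, whose
    probabilities factor by [history_law]. Lists of another length correspond to empty events. *)
Lemma ge0_integral_next n (H : seq C -> C -> \bar R) : (n < N)%N ->
  (forall s c, 0 <= H s c)%E ->
  (\int[P]_om H (history n om) (Z n om) = \int[P]_om
    \esum_(c in [set: C]) ((kernel (history n om) c)%:E * H (history n om) c))%E.
Proof.
move=> nN H0.
have mh := history_measurable n.
rewrite (ge0_integral_comp_discrete P (F := fun p => H p.1 p.2)
  (discrete_rv_pair mh (Z_meas n))) => [|[]//].
rewrite (ge0_integral_comp_discrete P
  (F := fun s => \esum_(c in [set: C]) ((kernel s c)%:E * H s c)%E) mh) => [|s]; last first.
  by apply: esum_ge0 => c _; rewrite mule_ge0 // lee_fin.
rewrite esum_pair => [|p]; last by rewrite mule_ge0.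
apply: eq_esum => s _ /=.
have [sz|sz] := eqVneq (size s) n; last first.
  have e0 (E : set Omega) : E `<=` [set om | history n om = s] -> P E = 0%E.
    move=> Es; rewrite (_ : E = set0) ?measure0 //; apply/seteqP; split => // om /Es /= hs.
    by move: sz; rewrite -hs size_history eqxx.
  rewrite (e0 (history n @^-1` [set s])) // mule0.
  by apply: esum1 => c _; rewrite e0 ?mule0 // => om [].
rewrite (history_law (ltnW nN) sz) muleC -esumZ ?path_prob_ge0 //; last first.
  by move=> c; rewrite mule_ge0 // lee_fin.
apply: eq_esum => c _.
rewrite [X in P X](_ : _ = [set om | history n.+1 om = rcons s c]); last first.
  apply/seteqP; split => om /=; rewrite historyS; first by move=> [-> ->].
  by move=> /rcons_inj [-> ->].
rewrite history_law ?size_rcons ?sz // path_prob_rcons EFinM.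
by rewrite muleC muleA.
Qed.

Lemma next_integrable n (G : C -> R) b : (n < N)%N -> (forall c, 0 <= G c) ->
  (forall s, size s = n -> (\esum_(c in [set: C]) (kernel s c * G c)%:E <= b%:E)%E) ->
  integrable_rv P (fun om => G (Z n om)) /\ mean P (fun om => G (Z n om)) <= b.
Proof.
move=> nN G0 Gb.
have le : (\int[P]_om (G (Z n om))%:E <= b%:E)%E.
  rewrite (@ge0_integral_next n (fun _ c => (G c)%:E)) //.
  apply: (@le_trans _ _ (\int[P]_om b%:E)%E); last first.
    rewrite integral_cst // [X in (_ * X)%E](_ : _ = 1%E) ?mule1 //.
    exact: probability_setT.
  have m0 : forall om, (0 <= \esum_(c in [set: C])
      ((kernel (history n om) c)%:E * (G c)%:E))%E.
    by move=> om; apply: esum_ge0 => c _; rewrite mule_ge0 ?lee_fin.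
  have mle : forall om, (\esum_(c in [set: C])
      ((kernel (history n om) c)%:E * (G c)%:E) <= b%:E)%E.
    move=> om; under eq_esum do rewrite -EFinM.
    by apply: Gb; rewrite size_history.
  apply: ge0_le_integral => //.
  by apply: measurable_fun_discrete; apply: (discrete_rv_comp
    (fun s => \esum_(c in [set: C]) ((kernel s c)%:E * (G c)%:E))%E); exact: history_measurable.
have mG : discrete_rv (fun om => G (Z n om)) by exact: discrete_rv_comp.
have hG : integrable_rv P (fun om => G (Z n om)).
  apply/integrableP; split; first exact/measurable_EFinP/measurable_fun_discrete.
  under eq_integral do rewrite gee0_abs ?lee_fin //.
  exact: le_lt_trans le (ltry _).
by split=> //; rewrite -lee_fin -meanE.
Qed.

(** An unbounded [G] is exchanged for its conditional mean, in front of any integrable function of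
    the past; [b] bounds the conditional mean, not [G]. Countable sums want nonnegative terms, so
    [f] is split into its positive and negative parts. *)
Lemma mean_next n (f : seq C -> R) (G : C -> R) (Gbar : seq C -> R) b : (n < N)%N ->
  (forall c, 0 <= G c) ->
  (forall s, size s = n -> (\esum_(c in [set: C]) (kernel s c * G c)%:E = (Gbar s)%:E)%E) ->
  (forall s, size s = n -> 0 <= Gbar s <= b) ->
  integrable_rv P (fun om => f (history n om)) ->
  [/\ integrable_rv P (fun om => f (history n om) * G (Z n om)),
      integrable_rv P (fun om => f (history n om) * Gbar (history n om)) &
      mean P (fun om => f (history n om) * G (Z n om)) =
      mean P (fun om => f (history n om) * Gbar (history n om))].
Proof.
move=> nN G0 GE Gb hf.
have mh F : discrete_rv (fun om => F (history n om) : R).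
  by apply: discrete_rv_comp; exact: history_measurable.
have Gbom om : 0 <= Gbar (history n om) <= b by apply: Gb; rewrite size_history.
have hbar (g : seq C -> R) : integrable_rv P (fun om => g (history n om)) ->
    integrable_rv P (fun om => g (history n om) * Gbar (history n om)).
  move=> hg; apply: (@le_integrable_rv _ _ _ _ _ (fun om => b * `|g (history n om)|)).
  - exact/measurable_fun_discrete/(mh (fun s => g s * Gbar s)).
  - move=> om; have /andP[Gb0 Gb1] := Gbom om.
    by rewrite normrM mulrC ler_wpM2r // ger0_norm.
  - apply: integrable_rvZ; exact: (integrable_norm hg).
have pos (g : seq C -> R) : (forall s, 0 <= g s) -> integrable_rv P (fun om => g (history n om)) ->
    integrable_rv P (fun om => g (history n om) * G (Z n om)) /\
    mean P (fun om => g (history n om) * G (Z n om)) =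
    mean P (fun om => g (history n om) * Gbar (history n om)).
  move=> g0 hg.
  have e : (\int[P]_om (g (history n om) * G (Z n om))%:E =
      \int[P]_om (g (history n om) * Gbar (history n om))%:E)%E.
    rewrite (@ge0_integral_next n (fun s c => (g s * G c)%:E)) // => [|s c]; last first.
      by rewrite lee_fin mulr_ge0.
    apply: eq_integral => om _.
    transitivity (\esum_(c in [set: C]) ((g (history n om))%:E *
        (kernel (history n om) c * G c)%:E))%E.
      by apply: eq_esum => c _; rewrite -!EFinM mulrCA.
    rewrite esumZ // ?GE ?size_history // => c.
    by rewrite lee_fin mulr_ge0.
  have hgG : integrable_rv P (fun om => g (history n om) * G (Z n om)).
    apply/integrableP; split.
      apply/measurable_EFinP/measurable_fun_discrete.
      apply: (discrete_rv_comp (fun p => g p.1 * G p.2)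
        (discrete_rv_pair (history_measurable n) (Z_meas n))).
    under eq_integral do rewrite gee0_abs ?lee_fin ?mulr_ge0 //.
    rewrite e; apply: integrable_lty => //; exact: hbar.
  by split=> //; rewrite /mean /Rintegral e.
pose fp s := (`|f s| + f s) / 2; pose fn s := (`|f s| - f s) / 2.
have fE s : f s = fp s - fn s.
  by rewrite /fp /fn; field.
have fp0 s : 0 <= fp s by have := ler_norm (- f s); rewrite normrN /fp; lra.
have fn0 s : 0 <= fn s by have := ler_norm (f s); rewrite /fn; lra.
have hfp : integrable_rv P (fun om => fp (history n om)).
  apply: (@le_integrable_rv _ _ _ _ _ (fun om => `|f (history n om)|)).
  - exact/measurable_fun_discrete/mh.
  - by move=> om; rewrite ger0_norm // /fp; have := ler_norm (f (history n om)); lra.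
  - exact: (integrable_norm hf).
have hfn : integrable_rv P (fun om => fn (history n om)).
  apply: (@le_integrable_rv _ _ _ _ _ (fun om => `|f (history n om)|)).
  - exact/measurable_fun_discrete/mh.
  - by move=> om; rewrite ger0_norm // /fn; have := ler_norm (- f (history n om)); rewrite normrN; lra.
  - exact: (integrable_norm hf).
have [ip ep] := pos _ fp0 hfp; have [im em] := pos _ fn0 hfn.
have EG : (fun om => f (history n om) * G (Z n om)) =
    (fun om => fp (history n om) * G (Z n om) - fn (history n om) * G (Z n om)).
  by apply/funext => om; rewrite -mulrBl -fE.
have Ebar : (fun om => f (history n om) * Gbar (history n om)) =
    (fun om => fp (history n om) * Gbar (history n om) - fn (history n om) * Gbar (history n om)).
  by apply/funext => om; rewrite -mulrBl -fE.
split; [by rewrite EG; exact: integrable_rvB|exact: hbar|].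
rewrite EG Ebar !meanB ?ep ?em //; exact: hbar.
Qed.

End SequentialSampling.

(** * The sequence of all draws of the algorithm *)

Section DrawLaws.
Context {R : realType} {S A : finType} (M : cmdp R S A).
Local Notation gamma := (discount M).
Local Notation u := ((1 - gamma)^-1).
Implicit Types (pi : S -> A -> R) (rho : S -> R).

Lemma from_pair_distr (x : S * A) : is_distr (from_pair R x).
Proof.
split=> [y|]; first exact: ler0n.
by rewrite (bigD1 x) //= /from_pair eqxx big1 ?addr0 // => y /negbTE ->.
Qed.

Lemma from_distr_distr rho pi : is_policy pi -> is_distr rho -> is_distr (from_distr rho pi).
Proof.
move=> hpi [rho0 rho1]; split=> [y|]; first by rewrite mulr_ge0 ?(hpi _).1.
have := sum_from_distr rho pi (fun=> 1).
under eq_bigr do rewrite mulr1; move=> ->.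
by under eq_bigr do rewrite -mulr_suml (hpi _).2 mul1r mulr1.
Qed.

Lemma qdraw_law_ge0 nu0 pi z : is_policy pi -> is_distr nu0 -> 0 <= qdraw_law M nu0 pi z.
Proof.
move=> hpi hnu; rewrite mulr_ge0 // rollout_law_ge0 //; exact: hnu.1.
Qed.

Lemma vdraw_law_ge0 rho pi z : is_policy pi -> is_distr rho -> 0 <= vdraw_law M rho pi z.
Proof.
by move=> hpi hrho; apply: rollout_law_ge0 => //; exact: (from_distr_distr hpi hrho).1.
Qed.

Lemma esum_qdraw nu0 pi (F : trajectory S A -> trajectory S A -> R) :
  is_policy pi -> is_distr nu0 -> (forall z1 z2, 0 <= F z1 z2) ->
  (\esum_(z in [set: qdraw S A]) (qdraw_law M nu0 pi z * F z.1 z.2)%:E =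
  \esum_(z1 in [set: trajectory S A]) ((rollout_law M nu0 pi z1)%:E *
    \esum_(z2 in [set: trajectory S A])
      (rollout_law M (from_pair R (accepted z1)) pi z2 * F z1 z2)%:E))%E.
Proof.
move=> hpi hnu F0.
have r0 z1 z2 : 0 <= rollout_law M (from_pair R z1) pi z2.
  by apply: rollout_law_ge0 => //; exact: (from_pair_distr _).1.
rewrite (esum_pair (f := fun z => (qdraw_law M nu0 pi z * F z.1 z.2)%:E)) => [|z]; last first.
  by rewrite lee_fin mulr_ge0 ?qdraw_law_ge0.
apply: eq_esum => z1 _; rewrite -esumZ => [||z2]; last 2 first.
- by rewrite rollout_law_ge0 //; exact: hnu.1.
- by rewrite lee_fin mulr_ge0.
apply: eq_esum => z2 _; rewrite -EFinM; congr (_%:E); exact/esym/mulrA.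
Qed.

Lemma esum_qdraw_accepted nu0 pi x : is_policy pi -> is_distr nu0 ->
  (\esum_(z in [set: qdraw S A]) (qdraw_law M nu0 pi z * (accepted z.1 == x)%:R)%:E =
  (nu_visit M nu0 pi x)%:E)%E.
Proof.
move=> hpi hnu.
rewrite (esum_qdraw (F := fun z1 _ => (accepted z1 == x)%:R)) // nu_visitE //.
rewrite -esum_rollout_accepted //; last exact: hnu.1.
apply: eq_esum => z1 _; under eq_esum do rewrite mulrC EFinM.
rewrite esumZ // => [|z2]; last first.
  by rewrite lee_fin rollout_law_ge0 //; exact: (from_pair_distr _).1.
rewrite esum_rollout_law ?mule1 ?EFinM //; exact: from_pair_distr.
Qed.

Lemma esum_qdraw_law nu0 pi : is_policy pi -> is_distr nu0 ->
  (\esum_(z in [set: qdraw S A]) (qdraw_law M nu0 pi z)%:E = 1)%E.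
Proof.
move=> hpi hnu; have := @esum_qdraw nu0 pi (fun _ _ => 1) hpi hnu.
under eq_esum do rewrite mulr1; move=> -> //.
rewrite -(esum_rollout_law M hpi hnu); apply: eq_esum => z1 _.
under eq_esum do rewrite mulr1.
rewrite esum_rollout_law ?mule1 //; exact: from_pair_distr.
Qed.

(** The accepted pair has law [nu_visit], and given that pair the second rollout is unbiased for Q.
    The indicator fixes the pair, so that expressions which depend on the past and on the accepted
    pair can be treated one pair at a time. *)
Lemma esum_qdraw_Qhat nu0 pi o x : is_policy pi -> is_distr nu0 ->
  (\esum_(z in [set: qdraw S A])
     (qdraw_law M nu0 pi z * ((accepted z.1 == x)%:R * Qhat M o z))%:E =
  (nu_visit M nu0 pi x * Q M o pi x)%:E)%E.
Proof.
move=> hpi hnu.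
have c0 y : 0 <= payoff M o y by case/andP: (payoff_itv M o y).
rewrite (esum_qdraw (F := fun z1 z2 => (accepted z1 == x)%:R * traj_total (payoff M o) z2)) //;
  last by move=> z1 z2; rewrite mulr_ge0 ?traj_total_ge0.
transitivity (\esum_(z in [set: trajectory S A])
    (rollout_law M nu0 pi z * ((accepted z == x)%:R * Q M o pi (accepted z)))%:E)%E.
  apply: eq_esum => z1 _; under eq_esum do rewrite mulrCA EFinM.
  rewrite esumZ // => [|z2]; last first.
    by rewrite lee_fin mulr_ge0 ?traj_total_ge0 // rollout_law_ge0 //; exact: (from_pair_distr _).1.
  rewrite esum_rollout_total //.
  rewrite (bigD1 (accepted z1)) //= big1 => [|y yx]; last by rewrite /from_pair (negbTE yx) mul0r.
  by rewrite /from_pair eqxx mul1r addr0 -!EFinM QE.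
rewrite (@esum_rollout_accepted _ _ _ M nu0 pi (fun y => (y == x)%:R * Q M o pi y) hpi hnu.1); last first.
  by move=> y; rewrite mulr_ge0 //; case/andP: (Q_itv M o y hpi).
rewrite -sum_nu_visit // (bigD1 x) //= eqxx mul1r big1 ?addr0 // => y yx.
by rewrite (negbTE yx) mul0r mulr0.
Qed.

Lemma esum_qdraw_size_sq nu0 pi a : is_policy pi -> is_distr nu0 -> 0 <= a ->
  (\esum_(z in [set: qdraw S A])
     (qdraw_law M nu0 pi z * (a + (size z.2.2).+1%:R) ^+ 2)%:E <=
  (a ^+ 2 + 2 * a * u + 2 * u ^+ 2 - u)%:E)%E.
Proof.
move=> hpi hnu a0; set b := _ - u.
have b0 : 0 <= b.
  by rewrite -lee_fin; apply: le_trans (esum_rollout_size_sq M hpi hnu a0);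
    apply: esum_ge0 => z _; rewrite lee_fin mulr_ge0 ?sqr_ge0 // rollout_law_ge0 //; exact: hnu.1.
rewrite (esum_qdraw (F := fun _ z2 => (a + (size z2.2).+1%:R) ^+ 2)) //; last first.
  by move=> *; exact: sqr_ge0.
have r0 z1 : 0 <= rollout_law M nu0 pi z1 by rewrite rollout_law_ge0 //; exact: hnu.1.
apply: (@le_trans _ _ (\esum_(z1 in [set: trajectory S A]) (b%:E * (rollout_law M nu0 pi z1)%:E))%E).
  apply: le_esum => z1 _; rewrite muleC lee_wpmul2r ?lee_fin //.
  by apply: esum_rollout_size_sq => //; exact: from_pair_distr.
by rewrite esumZ // ?esum_rollout_law ?mule1 // => z; rewrite lee_fin.
Qed.

Lemma traj_total_le (o : objective) tau : 0 <= traj_total (payoff M o) tau <= (size tau.2).+1%:R.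
Proof.
rewrite traj_total_ge0 => [|x]; last by case/andP: (payoff_itv M o x).
apply: (@le_trans _ _ (\sum_(x <- tau.1 :: tau.2) 1)).
  by apply: ler_sum => x _; case/andP: (payoff_itv M o x).
by rewrite big_const_seq count_predT iter_addr_0.
Qed.

End DrawLaws.

(** * All rounds as one sequence of draws *)

Section Flattening.
Context {R : realType} {S A : finType} (M : cmdp R S A).
Context {d : nat} (phi : S * A -> 'cV[R]_d).
Context (W xi eta1 eta2 : R) (alpha : nat -> R) (K : nat).
Context (rho : S -> R) (nu0 : S * A -> R) (x0 : S * A).
Hypotheses (hrho : is_distr rho) (hnu0 : is_distr nu0).
Local Notation C := (qdraw S A).
Local Notation "'L" := K.+1.

Lemma log_linear_policy (th : 'cV[R]_d) : is_policy (log_linear phi th).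
Proof.
move=> s; have D0 : 0 < \sum_a expR (dot th (phi (s, a))).
  rewrite (bigD1 x0.2) //= ltr_wpDr ?expR_gt0 // sumr_ge0 // => a _; exact: expR_ge0.
split=> [a|]; first by rewrite divr_ge0 ?expR_ge0 // ltW.
by rewrite -mulr_suml divff // gt_eqF.
Qed.

Lemma eq_sgd o z z' k : (forall j, (j < k)%N -> z j = z' j) ->
  sgd M phi W alpha o z k = sgd M phi W alpha o z' k.
Proof.
elim: k => [//|k IHk] zz' /=; rewrite IHk ?zz' // => j jk.
by apply: zz'; exact: ltnW.
Qed.

Lemma eq_what o z z' : (forall j, (j < K)%N -> z j = z' j) ->
  what M phi W alpha K o z = what M phi W alpha K o z'.
Proof.
move=> zz'; rewrite /what; congr (_ *: _); apply: eq_bigr => k _; congr (_ *: _).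
by apply: eq_sgd => j jk; apply: zz'; exact: ltn_trans jk (ltn_ord k).
Qed.

Lemma eq_npg_pd zq zq' zv zv' t :
  (forall i, (i < t)%N -> (forall k, (k < K)%N -> zq i k = zq' i k) /\ zv i = zv' i) ->
  npg_pd M phi W xi eta1 eta2 alpha K zq zv t = npg_pd M phi W xi eta1 eta2 alpha K zq' zv' t.
Proof.
elim: t => [//|t IHt] h /=; rewrite IHt => [|i it]; last by apply: h; exact: ltnW.
have [hq hv] := h t (ltnSn t).
by rewrite (eq_what obj_r hq) (eq_what obj_g hq) hv.
Qed.

Let c0 : C := ((x0, [::]), (x0, [::])).

Definition zq_of (s : seq C) t k : C := nth c0 s (t * 'L + k).
Definition zv_of (s : seq C) t : trajectory S A := (nth c0 s (t * 'L + K)).1.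
Definition iterate (s : seq C) t := npg_pd M phi W xi eta1 eta2 alpha K (zq_of s) (zv_of s) t.
Definition policy_at (s : seq C) t := log_linear phi (iterate s t).1.

(* The draws of all rounds are put in a single sequence, of which round t
   occupies the positions t(K+1), ..., t(K+1)+K, the last one being the value
   draw, paired with a dummy trajectory. *)
Definition draw_kernel (s : seq C) (c : C) : R :=
  let pi := policy_at s (size s %/ 'L) in
  if (size s %% 'L < K)%N then qdraw_law M nu0 pi c
  else vdraw_law M rho pi c.1 * (c.2 == c0.2)%:R.

Lemma policy_atP s t : is_policy (policy_at s t).
Proof. exact: log_linear_policy. Qed.

Lemma draw_kernel_ge0 s c : 0 <= draw_kernel s c.
Proof.
rewrite /draw_kernel; case: ifP => _; last rewrite mulr_ge0 //.
  by apply: qdraw_law_ge0 => //; exact: policy_atP.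
by apply: vdraw_law_ge0 => //; exact: policy_atP.
Qed.

Lemma esum_dummy (D : choiceType) (c : D) : (\esum_(z in [set: D]) ((z == c)%:R : R)%:E = 1)%E.
Proof.
rewrite (_ : 1%E = \esum_(z in [set c]) (1 : R)%:E)%E; last by rewrite esum_set1 // lee_fin.
rewrite [RHS]esum_mkcond; apply: eq_esum => z _; case: eqP => [->|zc].
  by rewrite ifT // inE.
by rewrite ifF //; apply/negP; rewrite inE.
Qed.

Lemma divn_block t k : (k < 'L)%N -> ((t * 'L + k) %/ 'L = t)%N.
Proof. by move=> kL; rewrite divnMDl // divn_small ?addn0. Qed.

Lemma modn_block t k : (k < 'L)%N -> ((t * 'L + k) %% 'L = k)%N.
Proof. by move=> kL; rewrite modnMDl modn_small. Qed.

Lemma draw_kernel_q s t k c : size s = (t * 'L + k)%N -> (k < K)%N ->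
  draw_kernel s c = qdraw_law M nu0 (policy_at s t) c.
Proof.
move=> sz kK; rewrite /draw_kernel sz divn_block ?modn_block ?kK //; exact: ltnW.
Qed.

Lemma draw_kernel_v s t c : size s = (t * 'L + K)%N ->
  draw_kernel s c = vdraw_law M rho (policy_at s t) c.1 * (c.2 == c0.2)%:R.
Proof.
by move=> sz; rewrite /draw_kernel sz divn_block ?modn_block ?ltnn.
Qed.

Lemma esum_draw_kernel_v s t (G : trajectory S A -> R) : size s = (t * 'L + K)%N ->
  (forall z, 0 <= G z) ->
  (\esum_(c in [set: C]) (draw_kernel s c * G c.1)%:E =
  \esum_(z in [set: trajectory S A]) (vdraw_law M rho (policy_at s t) z * G z)%:E)%E.
Proof.
move=> sz G0; have v0 z := vdraw_law_ge0 M z (policy_atP s t) hrho.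
rewrite (esum_pair (f := fun c => (draw_kernel s c * G c.1)%:E)) => [|c]; last first.
  by rewrite lee_fin mulr_ge0 ?draw_kernel_ge0.
apply: eq_esum => z _.
transitivity (\esum_(y in [set: trajectory S A])
    ((vdraw_law M rho (policy_at s t) z * G z)%:E * ((y == c0.2)%:R : R)%:E))%E.
  by apply: eq_esum => y _; rewrite (draw_kernel_v _ sz) -EFinM /= mulrAC.
by rewrite esumZ ?(mulr_ge0 (v0 z) (G0 z)) ?esum_dummy ?mule1.
Qed.

Lemma draw_kernel_sum s : (\esum_(c in [set: C]) (draw_kernel s c)%:E = 1)%E.
Proof.
have [kK|kK] := ltnP (size s %% 'L) K.
  have sz := divn_eq (size s) 'L.
  under eq_esum do rewrite (draw_kernel_q _ sz kK).
  by rewrite esum_qdraw_law //; exact: policy_atP.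
have sz : size s = (size s %/ 'L * 'L + K)%N.
  rewrite {1}(divn_eq (size s) 'L); congr (_ + _)%N; apply/eqP.
  by rewrite eqn_leq kK -ltnS ltn_pmod.
have := @esum_draw_kernel_v s _ (fun=> 1) sz.
under eq_esum do rewrite mulr1; move=> -> //.
under eq_esum do rewrite mulr1.
rewrite esum_rollout_law //; first exact: policy_atP.
by apply: from_distr_distr => //; exact: policy_atP.
Qed.

Lemma prod_blocks T (F : nat -> R) :
  \prod_(n < T * 'L) F n = \prod_(t < T) \prod_(k < 'L) F (t * 'L + k)%N.
Proof.
elim: T => [|T IHT]; first by rewrite mul0n !big_ord0.
rewrite [RHS]big_ord_recr /= -IHT mulSn addnC -(big_mkord xpredT F).
rewrite (big_cat_nat (n := T * 'L)) ?leq_addr //= big_mkord; congr (_ * _).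
rewrite -{1}[(T * 'L)%N]add0n big_addn addKn big_mkord.
by apply: eq_bigr => k _; rewrite addnC.
Qed.

Lemma block_lt i t k : (i < t)%N -> (k < 'L)%N -> (i * 'L + k < t * 'L)%N.
Proof. by move=> it kL; rewrite -ltn_divLR // divn_block. Qed.

(** The iterate of round [t] reads only the blocks before [t]. Hence the kernel, which sees a prefix
    of the sequence, uses the same policy as the sampling law, which sees the full tables. *)
Lemma iterate_take s n t : (t * 'L <= n)%N -> iterate (take n s) t = iterate s t.
Proof.
move=> tn; apply: eq_npg_pd => i it.
have iL k : (k < 'L)%N -> (i * 'L + k < n)%N.
  by move=> kL; apply: leq_trans tn; exact: block_lt.
split=> [k kK|]; rewrite /zq_of /zv_of nth_take // iL //.
exact: ltnW.
Qed.

Context {disp : measure_display} {Omega : measurableType disp} (P : probability Omega R).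
Context (T : nat) (X : nat -> nat -> Omega -> C) (Y : nat -> Omega -> trajectory S A).
Hypothesis hXY : npg_pd_sampling M phi W xi eta1 eta2 alpha K nu0 rho T P X Y.

Definition flat_draw n om : C :=
  if (n %% 'L < K)%N then X (n %/ 'L) (n %% 'L) om else (Y (n %/ 'L) om, c0.2).

Lemma flat_draw_q t k om : (k < K)%N -> flat_draw (t * 'L + k) om = X t k om.
Proof. by move=> kK; rewrite /flat_draw modn_block ?divn_block ?kK // ltnW. Qed.

Lemma flat_draw_v t om : flat_draw (t * 'L + K) om = (Y t om, c0.2).
Proof. by rewrite /flat_draw modn_block ?divn_block ?ltnn. Qed.

Lemma flat_draw_measurable n : discrete_rv (flat_draw n).
Proof.
case: hXY => mX mY _; have [nK|nK] := ltnP (n %% 'L) K.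
  rewrite (_ : flat_draw n = X (n %/ 'L) (n %% 'L)); first exact: mX.
  by apply/funext => om; rewrite /flat_draw nK.
rewrite (_ : flat_draw n = fun om => (Y (n %/ 'L) om, c0.2)).
  by apply: (discrete_rv_comp (fun y => (y, c0.2))); exact: mY.
by apply/funext => om; rewrite /flat_draw ltnNge nK.
Qed.

(** If every value slot of [s] carries the dummy, event and product are those of [npg_pd_sampling].
    Otherwise the event is empty and the kernel factor of that slot is 0. *)
Lemma flat_draw_law s : size s = (T * 'L)%N ->
  P [set om | history flat_draw (T * 'L) om = s] = (path_prob draw_kernel c0 s)%:E.
Proof.
case: hXY => _ _ law sz.
have idx t k : (t < T)%N -> (k < 'L)%N -> (t * 'L + k < T * 'L)%N by exact: block_lt.
have pathE : path_prob draw_kernel c0 s = \prod_(t < T) \prod_(k < 'L)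
    draw_kernel (take (t * 'L + k) s) (nth c0 s (t * 'L + k)).
  by rewrite /path_prob sz (prod_blocks T (fun n => draw_kernel (take n s) (nth c0 s n))).
have szt t k : (t < T)%N -> (k < 'L)%N -> size (take (t * 'L + k) s) = (t * 'L + k)%N.
  by move=> tT kL; rewrite size_takel // sz ltnW // idx.
have polE t k : policy_at (take (t * 'L + k) s) t = policy_at s t.
  by rewrite /policy_at iterate_take // leq_addr.
have [/forallP dummy|] := boolP [forall t : 'I_T, (nth c0 s (t * 'L + K)).2 == c0.2].
  rewrite (_ : [set om | _] = [set om | forall t, (t < T)%N ->
      (forall k, (k < K)%N -> X t k om = zq_of s t k) /\ Y t om = zv_of s t]).
    rewrite law pathE; congr (_%:E); apply: eq_bigr => t _ /=.
    rewrite big_ord_recr /=; congr (_ * _).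
      apply: eq_bigr => k _ /=.
      by rewrite (draw_kernel_q _ (szt t k (ltn_ord t) (ltnW (ltn_ord k))) (ltn_ord k)) polE.
    by rewrite (draw_kernel_v _ (szt t K (ltn_ord t) (ltnSn K))) polE (eqP (dummy t)) eqxx mulr1.
  apply/seteqP; split => om /=.
    move=> <- t tT; split => [k kK|]; rewrite /zq_of /zv_of nth_mkseq ?idx //.
    - by rewrite flat_draw_q.
    - exact: ltnW.
    - by rewrite flat_draw_v.
  move=> h; apply: (@eq_from_nth _ c0); rewrite size_history // => n nN.
  rewrite nth_mkseq //.
  have nT : (n %/ 'L < T)%N by rewrite ltn_divLR.
  have [hq hv] := h _ nT.
  have [nK|nK] := ltnP (n %% 'L) K.
    by rewrite {1 2}(divn_eq n 'L) flat_draw_q // hq.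
  have nE : n = (n %/ 'L * 'L + K)%N.
    rewrite {1}(divn_eq n 'L); congr (_ + _)%N; apply/eqP.
    by rewrite eqn_leq nK -ltnS ltn_pmod.
  rewrite nE flat_draw_v hv /zv_of -nE; have /eqP <- := dummy (Ordinal nT).
  by rewrite /= -nE -surjective_pairing.
rewrite negb_forall => /existsP [t ht].
rewrite pathE (bigD1 t) //= big_ord_recr /= (draw_kernel_v _ (szt t K (ltn_ord t) (ltnSn K))).
rewrite (negbTE ht) mulr0 mulr0 mul0r.
rewrite (_ : [set om | _] = set0) ?measure0 //; apply/seteqP; split => // om /= hs.
move: ht; rewrite -hs nth_mkseq ?idx // flat_draw_v /= eqxx.
by [].
Qed.

Lemma zq_of_history n om t k : (k < K)%N -> (t * 'L + k < n)%N ->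
  zq_of (history flat_draw n om) t k = X t k om.
Proof. by move=> kK lt; rewrite /zq_of nth_mkseq // flat_draw_q. Qed.

Lemma iterate_history n om t : (t * 'L <= n)%N ->
  iterate (history flat_draw n om) t =
  npg_pd M phi W xi eta1 eta2 alpha K (fun i k => X i k om) (fun i => Y i om) t.
Proof.
move=> tn; apply: eq_npg_pd => i it.
have iL k : (k < 'L)%N -> (i * 'L + k < n)%N.
  by move=> kL; apply: leq_trans tn; exact: block_lt.
split=> [k kK|]; first by rewrite zq_of_history // iL // ltnW.
by rewrite /zv_of nth_mkseq ?iL // flat_draw_v.
Qed.

End Flattening.

(** * Log-linear policy improvement and the duality gap *)

Section LogLinearPolicies.
Context {R : realType} {S A : finType} {d : nat} (phi : S * A -> 'cV[R]_d) (B : R).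
Hypotheses (phiB : forall x, norm2 (phi x) <= B) (x0 : S * A).

Lemma log_linear_gt0 (th : 'cV[R]_d) s a : 0 < log_linear phi th s a.
Proof.
rewrite divr_gt0 ?expR_gt0 // (bigD1 a) //= ltr_wpDr ?expR_gt0 // sumr_ge0 // => b _.
Qed.

(** A parameter shift is a multiplicative-weights update. The normalizer is a partition function
    under the old policy, the form to which [log_partition_le] applies. *)
Lemma log_linear_shift (th v : 'cV[R]_d) s a : log_linear phi (th + v) s a =
  log_linear phi th s a * expR (dot v (phi (s, a))) /
  \sum_b log_linear phi th s b * expR (dot v (phi (s, b))).
Proof.
pose Z := \sum_b expR (dot th (phi (s, b))).
have Z0 : 0 < Z.
  by rewrite /Z (bigD1 a) //= ltr_wpDr ?expR_gt0 // sumr_ge0 // => b _; exact: expR_ge0.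
have -> : \sum_b log_linear phi th s b * expR (dot v (phi (s, b))) =
    (\sum_b expR (dot (th + v) (phi (s, b)))) / Z.
  by rewrite mulr_suml; apply: eq_bigr => b _; rewrite dotDl expRD /log_linear -/Z mulrAC.
rewrite /log_linear -/Z dotDl expRD; set Z' := \sum_b _.
have Z'0 : 0 < Z'.
  by rewrite /Z' (bigD1 a) //= ltr_wpDr ?expR_gt0 // sumr_ge0 // => b _; exact: expR_ge0.
by field; rewrite !gt_eqF.
Qed.

(** The exponents [dot v phi] are at most [B * norm2 v] in absolute value; this is where
    [beta = B^2] enters the constants. *)
Lemma ln_log_linear_shift_ge (th v : 'cV[R]_d) s a :
  dot v (phi (s, a)) - \sum_b log_linear phi th s b * dot v (phi (s, b))
  - (B * norm2 v) ^+ 2 / 2 <=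
  ln (log_linear phi (th + v) s a) - ln (log_linear phi th s a).
Proof.
have p0 b : 0 < log_linear phi th s b by exact: log_linear_gt0.
have Z0 : 0 < \sum_b log_linear phi th s b * expR (dot v (phi (s, b))).
  rewrite (bigD1 a) //= ltr_wpDr //.
    by apply: sumr_ge0 => b _; rewrite mulr_ge0 ?expR_ge0 // ltW.
  by apply: mulr_gt0 => //; exact: expR_gt0.
have lnE p e z : 0 < p -> 0 < z -> ln (p * expR e / z) = ln p + e - ln z :> R.
  by move=> hp hz; rewrite ln_div ?posrE ?mulr_gt0 ?expR_gt0 // lnM ?posrE ?expR_gt0 // expRK.
rewrite log_linear_shift lnE //.
have := @log_partition_le R A (log_linear phi th s) (fun b => dot v (phi (s, b)))
  (B * norm2 v) (log_linear_policy phi x0 th s).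
have h b : `|dot v (phi (s, b))| <= B * norm2 v.
  by rewrite mulrC (le_trans (cauchy_schwarz _ _)) // ler_wpM2l ?norm2_ge0.
move=> /(_ h); lra.
Qed.

Lemma log_linear0 s a : log_linear phi 0 s a = #|A|%:R^-1.
Proof.
rewrite /log_linear dot0l expR0 div1r; congr (_^-1).
by under eq_bigr do rewrite dot0l expR0; rewrite sumr_const.
Qed.

Lemma log_linear_le1 th s a : log_linear phi th s a <= 1.
Proof.
have [p0 <-] := log_linear_policy phi x0 th s; rewrite (bigD1 a) //= lerDl.
by apply: sumr_ge0 => b _; exact: p0.
Qed.

Lemma rel_cond_le (nustar nu0 : S * A -> R) w :
  (forall x, 0 <= nustar x) -> (forall x, 0 <= nu0 x) ->
  rel_cond phi nustar nu0 \is a fin_num ->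
  0 <= fine (rel_cond phi nustar nu0) /\
  \sum_x nustar x * dot (phi x) w ^+ 2 <=
  fine (rel_cond phi nustar nu0) * \sum_x nu0 x * dot (phi x) w ^+ 2.
Proof.
move=> ns0 n0 fin.
pose q nu v := \sum_x nu x * dot (phi x) v ^+ 2.
have q0 nu v : (forall x, 0 <= nu x) -> 0 <= q nu v.
  by move=> h; apply: sumr_ge0 => x _; rewrite mulr_ge0 ?sqr_ge0.
have ub v : ((q nustar v)%:E / (q nu0 v)%:E <= (fine (rel_cond phi nustar nu0))%:E)%E.
  rewrite fineK //; apply: ereal_sup_ubound; exists v => //.
  by rewrite /q -!qform_sum.
split.
  have := ub 0; rewrite /q big1 => [|x _]; last by rewrite dotC dot0l expr0n mulr0.
  by rewrite mul0e lee_fin.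
(* With a zero denominator the quotient is 0 or [+oo]; a finite supremum forces the numerator to be
   0 as well. *)
have := ub w; rewrite -!/(q _ w); have [e0|e0] := eqVneq (q nu0 w) 0.
  rewrite e0 inve0 mulr0; have [-> //|e1] := eqVneq (q nustar w) 0.
  by rewrite gt0_muley ?lte_fin ?lt_def ?e1 ?q0 // leNgt ltry.
rewrite inver (negbTE e0) -EFinM lee_fin ler_pdivrMr // lt_def e0; exact: q0.
Qed.

End LogLinearPolicies.

Lemma sqr_mean_le {R : realType} (X : finType) (p f : X -> R) : is_distr p ->
  (\sum_x p x * f x) ^+ 2 <= \sum_x p x * f x ^+ 2.
Proof.
move=> [p0 p1]; set m := \sum_x _.
rewrite -subr_ge0.
have -> : \sum_x p x * f x ^+ 2 - m ^+ 2 = \sum_x p x * (f x - m) ^+ 2.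
  transitivity (\sum_x (p x * f x ^+ 2 - 2 * m * (p x * f x) + m ^+ 2 * p x)).
    by rewrite big_split sumrB /= -!mulr_sumr p1 -/m; ring.
  by apply: eq_bigr => x _; ring.
by apply: sumr_ge0 => x _; rewrite mulr_ge0 ?sqr_ge0.
Qed.

(** Jensen over states, then over actions, and finally [pi s a <= 1] to compare with the uniform law
    on actions. This is the source of the factor [|A|]; it serves [pistar] and the current policy
    alike. *)
Lemma mean_abs_le_sqrt {R : realType} {S A : finType} (D : S -> R) (pi : S -> A -> R)
    (f : S * A -> R) : is_distr D -> is_policy pi ->
  \sum_s D s * policy_mean pi (fun x => `|f x|) s <=
  Num.sqrt (#|A|%:R * \sum_x D x.1 * #|A|%:R^-1 * f x ^+ 2).
Proof.
move=> hD hpi.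
have m0 : 0 <= \sum_s D s * policy_mean pi (fun x => `|f x|) s.
  apply: sumr_ge0 => s _; rewrite mulr_ge0 ?hD.1 // sumr_ge0 // => a _.
  by rewrite mulr_ge0 ?(hpi s).1.
rewrite -[leLHS]ger0_norm // -sqrtr_sqr; apply: ler_wsqrtr.
apply: le_trans (sqr_mean_le _ hD) _.
have -> : #|A|%:R * \sum_x D x.1 * #|A|%:R^-1 * f x ^+ 2 =
    \sum_s \sum_a #|A|%:R * (D s * #|A|%:R^-1 * f (s, a) ^+ 2).
  by rewrite mulr_sumr pair_bigA; apply: eq_bigr => -[s a] _.
apply: ler_sum => s _.
have -> : \sum_a #|A|%:R * (D s * #|A|%:R^-1 * f (s, a) ^+ 2) = D s * \sum_a f (s, a) ^+ 2.
  rewrite mulr_sumr; apply: eq_bigr => a _.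
  have nA : #|A|%:R != 0 :> R by rewrite pnatr_eq0 -lt0n; apply/card_gt0P; exists a.
  by field.
rewrite ler_wpM2l ?hD.1 // (le_trans (sqr_mean_le _ (hpi s))) //.
apply: ler_sum => a _; rewrite real_normK ?num_real // -[leRHS]mul1r ler_wpM2r ?sqr_ge0 //.
by have [p0 <-] := hpi s; rewrite (bigD1 a) //= lerDl sumr_ge0.
Qed.

Lemma duality_gap_ge {R : realType} {S A : finType} (M : cmdp R S A) (rho : S -> R) (xi : R)
    (pistar : S -> A -> R) (T : nat) (p : nat -> S -> A -> R) :
  is_distr rho -> 0 < xi -> slater M rho xi -> optimal M rho pistar ->
  (0 < T)%N -> (forall t, is_policy (p t)) ->
  - ((1 - discount M)^-1 / xi) *
    Num.max (T%:R^-1 * \sum_(t < T) (threshold M - V M rho obj_g (p t))) 0 <=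
  T%:R^-1 * \sum_(t < T) (V M rho obj_r pistar - V M rho obj_r (p t)).
Proof.
move=> hrho xi0 [q [hq hs]] [[hps _] hopt] T0 hp.
set v := T%:R^-1 * _; set vp := Num.max v 0.
have vp0 : 0 <= vp by rewrite le_max lexx orbT.
have vvp : v <= vp by rewrite le_max lexx.
have Tn0 : T%:R != 0 :> R by rewrite pnatr_eq0 -lt0n.
pose z := V M rho obj_g q - threshold M.
have zxi : xi <= z by [].
have z0 : 0 < z by exact: lt_le_trans zxi.
have vz0 : 0 < vp + z by rewrite ltr_wpDl.
(* Chosen so that [(1 - th) * vp = th * z]: in the mixture the slack of the Slater policy exactly
   pays for the average violation. *)
pose th := vp / (vp + z).
have th0 : 0 <= th by rewrite divr_ge0 // ltW.
have th1 : th <= 1 by rewrite ler_pdivrMr // mul1r lerDl ltW.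
(* [None] stands for the Slater policy and [Some t] for the policy of round [t]. *)
pose w (i : option 'I_T) : R := if i is Some _ then (1 - th) / T%:R else th.
pose pp (i : option 'I_T) := if i is Some t then p t else q.
have sumO (F : option 'I_T -> R) : \sum_i F i = F None + \sum_(t < T) F (Some t).
  rewrite (bigD1 None) //=; congr (_ + _).
  rewrite (reindex_omap Some id) /=; last by case.
  by apply: eq_bigl => t; rewrite eqxx.
have hw : is_distr w.
  split=> [[t|]|] //=; first by rewrite divr_ge0 // subr_ge0.
  by rewrite sumO /= sumr_const card_ord -[_ *+ T]mulr_natr divfK // addrC subrK.
have [pi [hpi piE]] := @policy_mixture R S A M rho _ w pp hrho hw (fun i => match i with Some t => hp t | None => hq end).
have VE' o : V M rho o pi = th * V M rho o q + (1 - th) * (T%:R^-1 * \sum_(t < T) V M rho o (p t)).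
  by rewrite piE sumO /= -mulr_sumr mulrA.
have avgE (c : R) o : T%:R^-1 * \sum_(t < T) (c - V M rho o (p t)) = c - T%:R^-1 * \sum_(t < T) V M rho o (p t).
  by rewrite sumrB sumr_const card_ord -[c *+ T]mulr_natr mulrBr mulrCA mulVf // mulr1.
have thE : (1 - th) * vp = th * z.
  by rewrite /th; field; rewrite gt_eqF.
have feas : feasible M rho pi.
  split=> //; rewrite VE'.
  have := avgE (threshold M) obj_g; rewrite -/v => vE.
  have -> : T%:R^-1 * \sum_(t < T) V M rho obj_g (p t) = threshold M - v by rewrite vE; ring.
  have -> : V M rho obj_g q = threshold M + z by rewrite /z; ring.
  nra.
have := hopt _ feas; rewrite VE' avgE.
set a := T%:R^-1 * _; set Vs := V M rho obj_r pistar.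
have /andP[Vq0 _] := V_itv M obj_r hq hrho.
have /andP[_ Vsu] := V_itv M obj_r hps hrho.
rewrite -/Vs in Vsu; set uu := (1 - discount M)^-1 in Vsu *.
move=> hle.
have th1' : 0 < 1 - th.
  have -> : 1 - th = z / (vp + z) by rewrite /th; field; rewrite gt_eqF.
  by rewrite divr_gt0.
have u0 : 0 <= uu by rewrite invr_ge0 ltW // subr1_discount_gt0.
(* The reward of the feasible mixture is at most that of [pistar]; the reward of the Slater policy
   is dropped as nonnegative, and that of [pistar] is at most [u]. *)
have g1 : - (th * uu) <= (1 - th) * (Vs - a) by nra.
have g2 : - (vp * uu) <= z * (Vs - a).
  rewrite -(ler_pM2l th1').
  have : z * - (th * uu) <= z * ((1 - th) * (Vs - a)) by rewrite ler_pM2l.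
  have -> : z * - (th * uu) = - (th * z * uu) by ring.
  rewrite -thE; lra.
have -> : - (uu / xi) * vp = - (vp * uu) / xi by ring.
rewrite ler_pdivrMr //.
(* The slack [z] is replaced by the smaller [xi], which preserves the bound when the gap is
   negative; a nonnegative gap is immediate. *)
have [ga|ga] := leP 0 (Vs - a); first by have : 0 <= vp * uu by [rewrite mulr_ge0]; nra.
nra.
Qed.

(** * Value gaps in terms of fitted linear directions *)

Section PolicyImprovement.
Context {R : realType} {S A : finType} (M : cmdp R S A) (rho : S -> R) (hrho : is_distr rho).
Context {d : nat} (phi : S * A -> 'cV[R]_d) (B : R) (x0 : S * A).
Hypothesis phiB : forall x, norm2 (phi x) <= B.
Context (pistar : S -> A -> R) (hstar : is_policy pistar).
Local Notation D := (d_visit M rho pistar).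
Local Notation linear_value w := (fun x => dot w (phi x)).

(* Up to an additive constant, minus the mean under D of the relative entropy
   of pistar with respect to the policy. *)
Definition log_likelihood (th : 'cV[R]_d) : R :=
  \sum_s D s * policy_mean pistar (fun x => ln (log_linear phi th x.1 x.2)) s.

(** The performance difference with Q replaced by the linear function of parameter [w]. It is linear
    in [w], hence compatible with the direction that combines reward and utility fits. *)
Definition advantage_gap (th w : 'cV[R]_d) : R :=
  \sum_s D s * (policy_mean pistar (linear_value w) s -
                policy_mean (log_linear phi th) (linear_value w) s).

Let D_distr : is_distr D. Proof. exact: d_visit_distr. Qed.

Lemma advantage_gapD th v w :
  advantage_gap th (v + w) = advantage_gap th v + advantage_gap th w.
Proof.
rewrite /advantage_gap -big_split; apply: eq_bigr => s _ /=; rewrite -mulrDr; congr (_ * _).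
rewrite addrACA -opprD -!big_split /=.
by congr (_ - _); apply: eq_bigr => a _; rewrite dotDl mulrDr.
Qed.

Lemma advantage_gapZ th c w : advantage_gap th (c *: w) = c * advantage_gap th w.
Proof.
rewrite /advantage_gap mulr_sumr; apply: eq_bigr => s _; rewrite [RHS]mulrCA; congr (_ * _).
rewrite mulrBr /policy_mean !mulr_sumr.
by congr (_ - _); apply: eq_bigr => a _; rewrite dotZl mulrCA.
Qed.

Lemma log_likelihood_le0 th : log_likelihood th <= 0.
Proof.
rewrite -oppr_ge0 -sumrN; apply: sumr_ge0 => s _; rewrite -mulrN mulr_ge0 ?D_distr.1 //.
rewrite -sumrN; apply: sumr_ge0 => a _; rewrite -mulrN mulr_ge0 ?(hstar s).1 //=.
by rewrite oppr_ge0 -ln1 ler_ln ?posrE ?log_linear_gt0 ?ltr01 // log_linear_le1.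
Qed.

Lemma log_likelihood0 : log_likelihood 0 = - ln #|A|%:R.
Proof.
have nA : 0 < #|A|%:R :> R by rewrite ltr0n; apply/card_gt0P; exists x0.2.
transitivity (\sum_s D s * - ln #|A|%:R); last by rewrite -mulr_suml D_distr.2 mul1r.
apply: eq_bigr => s _; congr (_ * _); rewrite /policy_mean.
under eq_bigr do rewrite log_linear0 lnV ?posrE //.
by rewrite -mulr_suml (hstar s).2 mul1r.
Qed.

Lemma log_likelihood_shift_ge th v :
  advantage_gap th v - (B * norm2 v) ^+ 2 / 2 <=
  log_likelihood (th + v) - log_likelihood th.
Proof.
have -> : advantage_gap th v - (B * norm2 v) ^+ 2 / 2 =
    \sum_s D s * (policy_mean pistar (linear_value v) s -
      policy_mean (log_linear phi th) (linear_value v) s - (B * norm2 v) ^+ 2 / 2).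
  under [RHS]eq_bigr do rewrite mulrBr.
  by rewrite sumrB -[in RHS]mulr_suml D_distr.2 mul1r.
rewrite /log_likelihood -sumrB; apply: ler_sum => s _.
rewrite -mulrBr ler_wpM2l ?D_distr.1 //.
set q := policy_mean (log_linear phi th) _ s; set c := _ / 2; rewrite /policy_mean -[leRHS]sumrB.
have -> : \sum_a pistar s a * dot v (phi (s, a)) - q - c =
    \sum_a pistar s a * (dot v (phi (s, a)) - q - c).
  under [RHS]eq_bigr do rewrite -addrA mulrDr.
  by rewrite [RHS]big_split /= -[X in _ = _ + X]mulr_suml (hstar s).2 mul1r -addrA.
apply: ler_sum => a _ /=; rewrite -mulrBr ler_wpM2l ?(hstar s).1 //.
exact: ln_log_linear_shift_ge.
Qed.

Lemma nu_star_distr : is_distr (nu_star M rho pistar).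
Proof.
split=> [x|]; first by rewrite mulr_ge0 ?invr_ge0 // D_distr.1.
rewrite -(pair_bigA _ (fun s a => nu_star M rho pistar (s, a))) -[RHS]D_distr.2.
apply: eq_bigr => s _; rewrite /nu_star /= sumr_const -[_ *+ _]mulr_natr divfK //.
by rewrite pnatr_eq0 -lt0n; apply/card_gt0P; exists x0.2.
Qed.

(** Performance difference with Q written as linear fit plus error. The error enters once under
    [pistar] and once under the current policy, both with states from [D], hence the factor 2; each
    part is split at [wst] into bias and estimation. *)
Lemma value_gap_le o th w wst :
  (1 - discount M) * (V M rho o pistar - V M rho o (log_linear phi th)) <=
  advantage_gap th w +
  2 * (Num.sqrt (#|A|%:R * fit_error M phi o (nu_star M rho pistar) wst th) +
       Num.sqrt (#|A|%:R * \sum_x nu_star M rho pistar x * dot (phi x) (w - wst) ^+ 2)).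
Proof.
have hpi := log_linear_policy phi x0 th; set pi := log_linear phi th in hpi *.
rewrite -performance_difference //.
pose f1 x := Q M o pi x - dot wst (phi x); pose f2 x := dot (phi x) (w - wst).
have h1 p := @mean_abs_le_sqrt R S A D p f1 D_distr.
have h2 p := @mean_abs_le_sqrt R S A D p f2 D_distr.
pose e (f : S * A -> R) (p : S -> A -> R) := \sum_s D s * policy_mean p (fun x => `|f x|) s.
have -> : fit_error M phi o (nu_star M rho pistar) wst th =
  \sum_x D x.1 * #|A|%:R^-1 * f1 x ^+ 2 by [].
apply: (@le_trans _ _ (advantage_gap th w + (e f1 pistar + e f2 pistar + (e f1 pi + e f2 pi)))).
  rewrite /advantage_gap /e -!big_split /=; apply: ler_sum => s _.
  rewrite -!mulrDr ler_wpM2l ?D_distr.1 // VsE // -/(policy_mean pi (Q M o pi) s).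
  (* The sign [sg] is 1 for [pistar] and -1 for the current policy, because Q must be bounded from
     above in one mean and from below in the other. *)
  have hm p (hp : is_policy p) (sg : R) : `|sg| = 1 ->
      sg * policy_mean p (Q M o pi) s <= sg * policy_mean p (linear_value w) s +
      (policy_mean p (fun x => `|f1 x|) s + policy_mean p (fun x => `|f2 x|) s).
    move=> sg1; rewrite /policy_mean !mulr_sumr -!big_split /=; apply: ler_sum => a _.
    rewrite mulrCA [sg * (_ * dot _ _)]mulrCA -!mulrDr ler_wpM2l ?(hp s).1 //.
    rewrite -lerBlDl -mulrBr (le_trans (ler_norm _)) // normrM sg1 mul1r.
    rewrite (_ : Q M o pi (s, a) - dot w (phi (s, a)) = f1 (s, a) - f2 (s, a)).
      exact: ler_normB.
    by rewrite /f1 /f2 dotDr dotNr !(dotC (phi _)); ring.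
  have := hm _ hstar 1 (normr1 R); have := hm _ hpi (-1) (normrN1 R).
  by rewrite !mul1r !mulN1r; lra.
rewrite lerD2l.
have := h1 _ hstar; have := h2 _ hstar; have := h1 _ hpi; have := h2 _ hpi.
rewrite -!/(e _ _); lra.
Qed.

End PolicyImprovement.

(** * Comparison of constants *)

Section Rates.
Context {R : realType} (u xi l w e p q : R).
Hypotheses (u1 : 1 <= u) (xi0 : 0 < xi) (xiu : xi <= u).
Hypotheses (l0 : 0 <= l) (w0 : 0 <= w) (e0 : 0 <= e) (p0 : 0 <= p) (q0 : 0 <= q).

Let z := xi^-1.

Let u_gt0 : 0 < u. Proof. exact: lt_le_trans u1. Qed.

Let z_gt0 : 0 < z. Proof. by rewrite invr_gt0. Qed.

Let uz1 : 1 <= u * z. Proof. by rewrite ler_pdivlMr // mul1r. Qed.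

Let ler_exp_u m n : (m <= n)%N -> u ^+ m <= u ^+ n.
Proof. by move=> mn; rewrite ler_weXn2l. Qed.

(** To be read with [l = ln |A|], [w = beta W^2], [e = 1 / sqrt T], [p] the bias term and [q] the
    statistical one. The 5 of [C5] rounds up 9/2, which comes from [1 + 2 u / xi <= 3 u / xi]. *)
Lemma reward_rate_le :
  e * (l + w * (1 + 2 * u / xi) ^+ 2 * u ^+ 2 / 2 + (3 * u ^+ 2 - u) / 2) +
    u * (2 * (1 + 2 * u / xi) * (p + u * q)) <=
  (2 + l + 5 * w / xi ^+ 2) * u ^+ 5 * e + (2 + 4 / xi) * u ^+ 3 * (p + q).
Proof.
have -> : 5 * w / xi ^+ 2 = 5 * w * z ^+ 2 by rewrite exprVn.
rewrite -/z; have h12 := @ler_exp_u 1 2 isT; have h23 := @ler_exp_u 2 3 isT.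
have h25 := @ler_exp_u 2 5 isT; have h45 := @ler_exp_u 4 5 isT; have h05 := @ler_exp_u 0 5 isT.
rewrite expr0 in h05; rewrite expr1 in h12.
apply: lerD.
  rewrite [leRHS]mulrC ler_wpM2l //.
  have A : l <= l * u ^+ 5 by rewrite ler_peMr.
  have Bz : (1 + 2 * u * z) ^+ 2 <= 9 * (u * z) ^+ 2.
    by rewrite -mulrA; move: (u * z) uz1 => y; nra.
  have C : w * (1 + 2 * u * z) ^+ 2 * u ^+ 2 / 2 <= 5 * w * z ^+ 2 * u ^+ 5.
    apply: (@le_trans _ _ (w * (9 * (u * z) ^+ 2) * u ^+ 2 / 2)).
      by rewrite !ler_wpM2r ?sqr_ge0 // ler_wpM2l.
    have wz : 0 <= w * z ^+ 2 by rewrite mulr_ge0 ?sqr_ge0.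
    have := ler_wpM2l wz h45; have : 0 <= w * z ^+ 2 * u ^+ 5 by rewrite mulr_ge0 // exprn_ge0 // ltW.
    have -> : w * (9 * (u * z) ^+ 2) * u ^+ 2 / 2 = 9 / 2 * (w * z ^+ 2 * u ^+ 4) by ring.
    have -> : 5 * w * z ^+ 2 * u ^+ 5 = 5 * (w * z ^+ 2 * u ^+ 5) by ring.
    by move: (w * z ^+ 2 * u ^+ 4) (w * z ^+ 2 * u ^+ 5) => x y; lra.
  have -> : (2 + l + 5 * w * z ^+ 2) * u ^+ 5 =
    2 * u ^+ 5 + l * u ^+ 5 + 5 * w * z ^+ 2 * u ^+ 5 by ring.
  have := sqr_ge0 u; move: u_gt0 h25 C A.
  move: (w * _ * _ / 2) (5 * w * _ * _) (l * u ^+ 5) => x y m.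
  move: (u ^+ 5) (u ^+ 2) => v2 v5; lra.
have zu3 : 0 <= z * u ^+ 3 by rewrite mulr_ge0 ?exprn_ge0 // ltW.
have c1 : 2 * u * (1 + 2 * u * z) <= (2 + 4 * z) * u ^+ 3.
  have := ler_wpM2l (ltW z_gt0) h23.
  have -> : 2 * u * (1 + 2 * u * z) = 2 * u + 4 * (z * u ^+ 2) by ring.
  have -> : (2 + 4 * z) * u ^+ 3 = 2 * u ^+ 3 + 4 * (z * u ^+ 3) by ring.
  lra.
have c2 : 2 * u ^+ 2 * (1 + 2 * u * z) <= (2 + 4 * z) * u ^+ 3.
  have -> : 2 * u ^+ 2 * (1 + 2 * u * z) = 2 * u ^+ 2 + 4 * (z * u ^+ 3) by ring.
  have -> : (2 + 4 * z) * u ^+ 3 = 2 * u ^+ 3 + 4 * (z * u ^+ 3) by ring.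
  lra.
have -> : u * (2 * (1 + 2 * u * z) * (p + u * q)) =
    2 * u * (1 + 2 * u * z) * p + 2 * u ^+ 2 * (1 + 2 * u * z) * q by ring.
by rewrite [leRHS]mulrDr lerD // ler_wpM2r.
Qed.

(** Multiplying by [xi / u] isolates [m]; this saves one power of [u] against the reward bound and
    turns the powers of [1 / xi] into the two-sided form of [C6]. *)
Lemma violation_rate_le (m : R) :
  u / xi * m <=
    e * (l + w * (1 + 2 * u / xi) ^+ 2 * u ^+ 2 / 2 + (3 * u ^+ 2 - u) / 2 +
      (2 * u / xi) ^+ 2 / 2 + (2 * u ^+ 2 - u) / 2) +
    u * (2 * (1 + 2 * u / xi) * (p + u * q)) ->
  m <= ((2 + l + w) * xi + (2 + 4 * w) / xi) * u ^+ 4 * e +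
    (4 + 2 * xi) * u ^+ 2 * (p + q).
Proof.
have un0 : u != 0 by rewrite gt_eqF.
have xin0 : xi != 0 by rewrite gt_eqF.
have c0 : 0 <= xi / u by rewrite divr_ge0 // ltW.
move=> /(ler_wpM2l c0); rewrite [xi / u * (u / xi * m)]mulrA (_ : xi / u * (u / xi) = 1); last by field; rewrite xin0 un0.
rewrite mul1r => /le_trans; apply; rewrite mulrDr lerD //.
  have -> : xi / u * (e * (l + w * (1 + 2 * u / xi) ^+ 2 * u ^+ 2 / 2 + (3 * u ^+ 2 - u) / 2 +
      (2 * u / xi) ^+ 2 / 2 + (2 * u ^+ 2 - u) / 2)) =
    (l * (xi / u) + w * (u * xi / 2 + 2 * u ^+ 2 + 2 * (u ^+ 3 * z)) +
     xi * (5 / 2 * u - 1) + 2 * (u * z)) * e by rewrite /z; field; rewrite xin0 un0.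
  rewrite ler_wpM2r //.
  have -> : ((2 + l + w) * xi + (2 + 4 * w) / xi) * u ^+ 4 =
    l * (xi * u ^+ 4) + w * (xi * u ^+ 4 + 4 * (u ^+ 4 * z)) + xi * (2 * u ^+ 4) +
    2 * (u ^+ 4 * z) by rewrite /z; ring.
  have h14 := @ler_exp_u 1 4 isT; have h23 := @ler_exp_u 2 3 isT; rewrite expr1 in h14.
  have h34 := @ler_exp_u 3 4 isT; have h13 := @ler_exp_u 1 3 isT; rewrite expr1 in h13.
  have h04 := @ler_exp_u 0 4 isT; rewrite expr0 in h04.
  rewrite !lerD //.
  - rewrite ler_wpM2l // ler_wpM2l ?(ltW xi0) // (le_trans _ h04) //.
    by rewrite invf_le1.
  - rewrite ler_wpM2l //.
    (* Expanding [(1 + 2 u / xi)^2] leaves a cross term [2 u^2]. It is absorbed by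
       [2 <= xi / 2 + 2 / xi], which yields the coefficients 1 and 4 of [w]. *)
    have am : 2 * u ^+ 3 <= xi * u ^+ 3 / 2 + 2 * (u ^+ 3 * z).
      have : 0 <= u ^+ 3 * z * (xi - 2) ^+ 2.
        by rewrite mulr_ge0 ?sqr_ge0 // mulr_ge0 ?exprn_ge0 // ltW.
      have -> : u ^+ 3 * z * (xi - 2) ^+ 2 = xi * u ^+ 3 - 4 * u ^+ 3 + 4 * (u ^+ 3 * z).
        by rewrite /z; field.
      move: (xi * u ^+ 3) (u ^+ 3 * z) => x y; lra.
    have k1 := ler_wpM2l (ltW xi0) h13; have k2 := ler_wpM2l (ltW xi0) h34.
    have k3 := ler_wpM2l (ltW z_gt0) h34; rewrite ![z * _]mulrC in k3.
    rewrite [u * xi]mulrC.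
    move: am k1 k2 k3 h23.
    move: (xi * u ^+ 3) (u ^+ 3 * z) (xi * u ^+ 4) (u ^+ 4 * z) (xi * u) (u ^+ 3) (u ^+ 2).
    move=> x1 x2 x3 x4 x5 x6 x7; lra.
  - rewrite ler_wpM2l ?(ltW xi0) //.
    (* Nonnegativity of [u^4 - 4 u + 3] for [u >= 1], from which [5/2 u - 1 <= 2 u^4]. *)
    have : 0 <= (u - 1) * (u ^+ 3 + u ^+ 2 + u - 3).
      rewrite mulr_ge0 ?subr_ge0 //.
      have := @ler_exp_u 0 3 isT; have := @ler_exp_u 0 2 isT; rewrite !expr0; move: u1; lra.
    have -> : (u - 1) * (u ^+ 3 + u ^+ 2 + u - 3) = u ^+ 4 - 4 * u + 3 by ring.
    have := u1; lra.
  - by rewrite ler_wpM2l // ler_wpM2r // ltW.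
have h12 := @ler_exp_u 1 2 isT; rewrite expr1 in h12.
have -> : xi / u * (u * (2 * (1 + 2 * u / xi) * (p + u * q))) =
    (2 * xi + 4 * u) * p + (2 * xi * u + 4 * u ^+ 2) * q.
  by field; rewrite xin0 un0.
rewrite [leRHS]mulrDr lerD // ler_wpM2r //.
  have := ler_wpM2l (ltW xi0) (le_trans u1 h12); rewrite mulr1.
  move: (u ^+ 2) h12 => v; nra.
have := ler_wpM2l (ltW xi0) h12.
have -> : 2 * xi * u = 2 * (xi * u) by ring.
have -> : (4 + 2 * xi) * u ^+ 2 = 4 * u ^+ 2 + 2 * (xi * u ^+ 2) by ring.
lra.
Qed.

End Rates.

(** * A run of the algorithm *)

Section Run.
Context {R : realType} {S A : finType} (M : cmdp R S A).
Local Notation gamma := (discount M).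
Local Notation u := ((1 - gamma)^-1).
Context {d : nat} (phi : S * A -> 'cV[R]_d).
Context (W xi eta1 eta2 : R) (alpha : nat -> R) (K : nat).
Context (rho : S -> R) (nu0 : S * A -> R) (x0 : S * A).
Hypotheses (hrho : is_distr rho) (hnu0 : is_distr nu0).
Context {disp : measure_display} {Omega : measurableType disp} (P : probability Omega R).
Context (T : nat) (X : nat -> nat -> Omega -> qdraw S A) (Y : nat -> Omega -> trajectory S A).
Hypothesis hXY : npg_pd_sampling M phi W xi eta1 eta2 alpha K nu0 rho T P X Y.
Local Notation "'L" := K.+1.

Let hist := history (flat_draw K x0 X Y).

Definition run t om :=
  npg_pd M phi W xi eta1 eta2 alpha K (fun i k => X i k om) (fun i => Y i om) t.
Definition run_policy t om := log_linear phi (run t om).1.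
Definition run_sgd o t k om := sgd M phi W alpha o (fun j => X t j om) k.

(** Replaces measurability with respect to a filtration: the past consists of finitely many discrete
    draws, so dependence on it is an explicit function of the list. *)
Definition adapted {D : Type} n (f : Omega -> D) : Prop :=
  exists F : seq (qdraw S A) -> D, forall om, f om = F (hist n om).

Lemma run_policyP t om : is_policy (run_policy t om).
Proof. exact: log_linear_policy. Qed.

Lemma adapted_discrete {D : Type} n (f : Omega -> D) : adapted n f -> discrete_rv f.
Proof.
move=> [F fF]; rewrite (_ : f = fun om => F (hist n om)); last exact/funext.
apply: discrete_rv_comp; exact: (history_measurable (flat_draw_measurable x0 hXY) n).
Qed.

Lemma adapted_le {D : Type} m n (f : Omega -> D) : (m <= n)%N -> adapted m f -> adapted n f.
Proof.
move=> mn [F fF]; exists (fun s => F (take m s)) => om; rewrite fF; congr (F _).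
by rewrite /hist /history /mkseq -map_take take_iota (minn_idPl mn).
Qed.

Lemma adapted_comp {D D' : Type} n (G : D -> D') (f : Omega -> D) :
  adapted n f -> adapted n (fun om => G (f om)).
Proof. by move=> [F fF]; exists (fun s => G (F s)) => om; rewrite fF. Qed.

Lemma adapted_comp2 {D1 D2 D' : Type} n (G : D1 -> D2 -> D')
    (f : Omega -> D1) (g : Omega -> D2) :
  adapted n f -> adapted n g -> adapted n (fun om => G (f om) (g om)).
Proof.
by move=> [F fF] [F' gF']; exists (fun s => G (F s) (F' s)) => om; rewrite fF gF'.
Qed.

Lemma adapted_sum {I : Type} (r : seq I) n (f : I -> Omega -> R) :
  (forall i, adapted n (f i)) -> adapted n (fun om => \sum_(i <- r) f i om).
Proof.
move=> hf; elim: r => [|i r IHr]; first by exists (fun=> 0) => om; rewrite big_nil.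
rewrite (_ : (fun om => _) = fun om => f i om + \sum_(j <- r) f j om); last first.
  by apply/funext => om; rewrite big_cons.
exact: (adapted_comp2 (fun a b => a + b)).
Qed.

Lemma adapted_run n t : (t * 'L <= n)%N -> adapted n (run t).
Proof.
move=> tn; exists (fun s => iterate M phi W xi eta1 eta2 alpha K x0 s t) => om.
by rewrite iterate_history.
Qed.

Lemma adapted_sgd n o t k : (k <= K)%N -> (t * 'L + k <= n)%N -> adapted n (run_sgd o t k).
Proof.
move=> kK tn; exists (fun s => sgd M phi W alpha o (zq_of K x0 s t) k) => om.
apply: eq_sgd => j jk; rewrite zq_of_history ?(leq_trans jk kK) //.
by apply: leq_trans tn; rewrite ltn_add2l.
Qed.

Lemma adapted_Y n t : (t * 'L + K < n)%N -> adapted n (Y t).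
Proof.
move=> tn; exists (fun s => zv_of K x0 s t) => om.
by rewrite /zv_of nth_mkseq // flat_draw_v.
Qed.

Lemma adapted_integrable n (f : Omega -> R) c : adapted n f -> (forall om, `|f om| <= c) ->
  integrable_rv P f.
Proof. by move=> hf fc; apply: (@bounded_integrable_rv _ _ _ _ _ c) => //; exact: adapted_discrete hf. Qed.

Lemma mean_next_draw n (f : Omega -> R) (G : qdraw S A -> R) (Gbar : seq (qdraw S A) -> R)
    (g : Omega -> R) b : (n < T * 'L)%N -> adapted n f -> integrable_rv P f ->
  (forall c, 0 <= G c) ->
  (forall s, size s = n -> (\esum_(c in [set: qdraw S A])
    (draw_kernel M phi W xi eta1 eta2 alpha K rho nu0 x0 s c * G c)%:E = (Gbar s)%:E)%E) ->
  (forall s, size s = n -> 0 <= Gbar s <= b) ->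
  (forall om, g om = Gbar (hist n om)) ->
  [/\ integrable_rv P (fun om => f om * G (flat_draw K x0 X Y n om)),
      integrable_rv P (fun om => f om * g om) &
      mean P (fun om => f om * G (flat_draw K x0 X Y n om)) = mean P (fun om => f om * g om)].
Proof.
move=> nN [F fF] hf G0 GE Gb gE.
have -> : f = fun om => F (hist n om) by exact/funext.
have -> : g = fun om => Gbar (hist n om) by exact/funext.
apply: (mean_next (flat_draw_measurable x0 hXY)
  (draw_kernel_ge0 M phi W xi eta1 eta2 alpha K x0 hrho hnu0)
  (fun s _ => draw_kernel_sum M phi W xi eta1 eta2 alpha K x0 hrho hnu0 s)
  (@flat_draw_law _ _ _ _ _ _ _ _ _ _ _ _ _ _ x0 _ _ _ _ _ _ hXY) nN G0 GE Gb).
by rewrite (_ : (fun om => _) = f) //; apply/funext => om; rewrite fF.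
Qed.

Lemma nu_visit_itv pi x : is_policy pi -> 0 <= nu_visit M nu0 pi x <= 1.
Proof.
move=> hpi; have [h0 h1] := nu_visit_distr M hpi hnu0; rewrite h0 -h1 (bigD1 x) //=.
by rewrite lerDl sumr_ge0.
Qed.

Section Round.
Context (t : nat) (tT : (t < T)%N).

Lemma mean_qdraw_accepted k x (f : Omega -> R) : (k < K)%N ->
  adapted (t * 'L + k) f -> integrable_rv P f ->
  [/\ integrable_rv P (fun om => f om * (accepted (X t k om).1 == x)%:R),
      integrable_rv P (fun om => f om * nu_visit M nu0 (run_policy t om) x) &
      mean P (fun om => f om * (accepted (X t k om).1 == x)%:R) =
      mean P (fun om => f om * nu_visit M nu0 (run_policy t om) x)].
Proof.
move=> kK af hf.
have := @mean_next_draw (t * 'L + k) f (fun z => (accepted z.1 == x)%:R)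
  (fun s => nu_visit M nu0 (policy_at M phi W xi eta1 eta2 alpha K x0 s t) x)
  (fun om => nu_visit M nu0 (run_policy t om) x) 1 (block_lt tT (ltnW kK)) af hf.
rewrite (_ : (fun om => f om * (accepted (flat_draw K x0 X Y (t * 'L + k) om).1 == x)%:R) =
   fun om => f om * (accepted (X t k om).1 == x)%:R); last first.
  by apply/funext => om; rewrite flat_draw_q.
apply => [c|s sz|s sz|om]; first exact: ler0n.
- under eq_esum do rewrite (draw_kernel_q _ _ _ _ _ _ _ _ _ _ _ sz kK).
  apply: esum_qdraw_accepted => //; exact: policy_atP.
- by apply: nu_visit_itv; exact: policy_atP.
- by rewrite /run_policy /run -(iterate_history _ _ _ _ _ _ _ x0 _ _ _ (leq_addr k (t * 'L))).
Qed.

Lemma mean_qdraw_Qhat o k x (f : Omega -> R) : (k < K)%N ->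
  adapted (t * 'L + k) f -> integrable_rv P f ->
  [/\ integrable_rv P (fun om => f om * ((accepted (X t k om).1 == x)%:R * Qhat M o (X t k om))),
      integrable_rv P (fun om => f om *
        (nu_visit M nu0 (run_policy t om) x * Q M o (run_policy t om) x)) &
      mean P (fun om => f om * ((accepted (X t k om).1 == x)%:R * Qhat M o (X t k om))) =
      mean P (fun om => f om *
        (nu_visit M nu0 (run_policy t om) x * Q M o (run_policy t om) x))].
Proof.
move=> kK af hf.
have := @mean_next_draw (t * 'L + k) f (fun z => (accepted z.1 == x)%:R * Qhat M o z)
  (fun s => let pi := policy_at M phi W xi eta1 eta2 alpha K x0 s t in
    nu_visit M nu0 pi x * Q M o pi x)
  (fun om => nu_visit M nu0 (run_policy t om) x * Q M o (run_policy t om) x)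
  u (block_lt tT (ltnW kK)) af hf.
rewrite (_ : (fun om => f om * ((accepted (flat_draw K x0 X Y (t * 'L + k) om).1 == x)%:R * _)) =
   fun om => f om * ((accepted (X t k om).1 == x)%:R * Qhat M o (X t k om))); last first.
  by apply/funext => om; rewrite flat_draw_q.
apply => [c|s sz|s sz|om].
- by rewrite mulr_ge0 // traj_total_ge0 // => y; case/andP: (payoff_itv M o y).
- under eq_esum do rewrite (draw_kernel_q _ _ _ _ _ _ _ _ _ _ _ sz kK).
  apply: esum_qdraw_Qhat => //; exact: policy_atP.
- have hp := policy_atP M phi W xi eta1 eta2 alpha K x0 s t.
  have /andP[n0 n1] := nu_visit_itv x hp; have /andP[q0 q1] := Q_itv M o x hp.
  by rewrite mulr_ge0 //= -[u]mul1r ler_pM.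
- by rewrite /run_policy /run -(iterate_history _ _ _ _ _ _ _ x0 _ _ _ (leq_addr k (t * 'L))).
Qed.

Lemma qdraw_size_sq k a : (k < K)%N -> 0 <= a ->
  integrable_rv P (fun om => (a + (size (X t k om).2.2).+1%:R) ^+ 2) /\
  mean P (fun om => (a + (size (X t k om).2.2).+1%:R) ^+ 2) <=
    a ^+ 2 + 2 * a * u + 2 * u ^+ 2 - u.
Proof.
move=> kK a0.
rewrite (_ : (fun om => _) =
    fun om => (a + (size (flat_draw K x0 X Y (t * 'L + k) om).2.2).+1%:R) ^+ 2); last first.
  by apply/funext => om; rewrite flat_draw_q.
apply: (next_integrable (flat_draw_measurable x0 hXY)
  (draw_kernel_ge0 M phi W xi eta1 eta2 alpha K x0 hrho hnu0)
  (fun s _ => draw_kernel_sum M phi W xi eta1 eta2 alpha K x0 hrho hnu0 s)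
  (@flat_draw_law _ _ _ _ _ _ _ _ _ _ _ _ _ _ x0 _ _ _ _ _ _ hXY)
  (block_lt tT (ltnW kK)) (G := fun z => (a + (size z.2.2).+1%:R) ^+ 2)) => [c|s sz].
  exact: sqr_ge0.
under eq_esum do rewrite (draw_kernel_q _ _ _ _ _ _ _ _ _ _ _ sz kK).
by apply: esum_qdraw_size_sq => //; exact: policy_atP.
Qed.

Lemma mean_vdraw (f : Omega -> R) :
  adapted (t * 'L + K) f -> integrable_rv P f ->
  [/\ integrable_rv P (fun om => f om * Vhat_g M (Y t om)),
      integrable_rv P (fun om => f om * V M rho obj_g (run_policy t om)) &
      mean P (fun om => f om * Vhat_g M (Y t om)) =
      mean P (fun om => f om * V M rho obj_g (run_policy t om))].
Proof.
move=> af hf.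
have Vhat0 z : 0 <= Vhat_g M z by apply: traj_total_ge0 => y; case/andP: (payoff_itv M obj_g y).
have := @mean_next_draw (t * 'L + K) f (fun z => Vhat_g M z.1)
  (fun s => V M rho obj_g (policy_at M phi W xi eta1 eta2 alpha K x0 s t))
  (fun om => V M rho obj_g (run_policy t om)) u (block_lt tT (ltnSn K)) af hf.
rewrite (_ : (fun om => f om * Vhat_g M (flat_draw K x0 X Y (t * 'L + K) om).1) =
   fun om => f om * Vhat_g M (Y t om)); last first.
  by apply/funext => om; rewrite flat_draw_v.
apply => [c|s sz|s sz|om]; first exact: Vhat0.
- rewrite (esum_draw_kernel_v M phi W xi eta1 eta2 alpha x0 hrho hnu0 sz Vhat0).
  have hp := policy_atP M phi W xi eta1 eta2 alpha K x0 s t.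
  rewrite esum_rollout_total //; last 2 first.
  + exact: (from_distr_distr hp hrho).1.
  + by move=> y; case/andP: (payoff_itv M obj_g y).
  by rewrite VE //; congr (_%:E); apply: eq_bigr => y _; rewrite QE.
- by apply: V_itv => //; exact: policy_atP.
- by rewrite /run_policy /run -(iterate_history _ _ _ _ _ _ _ x0 _ _ _ (leq_addr K (t * 'L))).
Qed.

Lemma vdraw_size_sq :
  integrable_rv P (fun om => (size (Y t om).2).+1%:R ^+ 2) /\
  mean P (fun om => (size (Y t om).2).+1%:R ^+ 2) <= 2 * u ^+ 2 - u.
Proof.
rewrite (_ : (fun om => _) =
    fun om => (size (flat_draw K x0 X Y (t * 'L + K) om).1.2).+1%:R ^+ 2); last first.
  by apply/funext => om; rewrite flat_draw_v.
apply: (next_integrable (flat_draw_measurable x0 hXY)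
  (draw_kernel_ge0 M phi W xi eta1 eta2 alpha K x0 hrho hnu0)
  (fun s _ => draw_kernel_sum M phi W xi eta1 eta2 alpha K x0 hrho hnu0 s)
  (@flat_draw_law _ _ _ _ _ _ _ _ _ _ _ _ _ _ x0 _ _ _ _ _ _ hXY)
  (block_lt tT (ltnSn K)) (G := fun z => (size z.1.2).+1%:R ^+ 2)) => [c|s sz].
  exact: sqr_ge0.
rewrite (esum_draw_kernel_v M phi W xi eta1 eta2 alpha x0 hrho hnu0 sz
  (G := fun z => (size z.2).+1%:R ^+ 2)) => [|z]; last exact: sqr_ge0.
have hp := policy_atP M phi W xi eta1 eta2 alpha K x0 s t.
have := esum_rollout_size_sq M hp (from_distr_distr hp hrho) (lexx 0).
rewrite expr0n /= mulr0 mul0r !add0r; apply: le_trans.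
by apply: le_esum => z _; rewrite add0r.
Qed.

End Round.

(** * Mean-square error of the averaged SGD output *)

Section Sgd.
Context (B sigmaF : R) (wstar : objective -> 'cV[R]_d -> 'cV[R]_d).
Hypothesis phiB : forall x, norm2 (phi x) <= B.
Hypotheses (W_ge0 : 0 <= W) (sigma_gt0 : 0 < sigmaF) (K_gt0 : (0 < K)%N).
Hypothesis alphaE : forall k, alpha k = 2 / (sigmaF * k.+1%:R).
Hypothesis coverage : {ae P, forall om, forall t, (t < T)%N ->
  loewner_le (sigmaF%:M) (Sigma phi (nu_visit M nu0 (run_policy t om)))}.
Hypothesis wstar_min : forall o th, is_argmin (ball2 W)
  (fun w => fit_error M phi o (nu_visit M nu0 (log_linear phi th)) w th) (wstar o th).

Let a := W * B.

Lemma B_ge0 : 0 <= B.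
Proof. exact: le_trans (norm2_ge0 _) (phiB x0). Qed.

Lemma dot_phi_le x w c : norm2 w <= c -> `|dot (phi x) w| <= B * c.
Proof.
move=> wc; rewrite (le_trans (cauchy_schwarz _ _)) // ler_pM ?norm2_ge0 //.
Qed.

Lemma norm2_wstar o th : norm2 (wstar o th) <= W.
Proof. by have [] := wstar_min o th. Qed.

Lemma norm2_sgd o z k : norm2 (sgd M phi W alpha o z k) <= W.
Proof. by case: k => [|k] /=; rewrite ?norm2_0 // proj_ball2_in. Qed.

Lemma loewner_scalar (nu : S * A -> R) w : loewner_le sigmaF%:M (Sigma phi nu) ->
  sigmaF * dot w w <= \sum_x nu x * dot (phi x) w ^+ 2.
Proof.
move=> /(_ w); rewrite /qform mulmxBl dotDr dotNr mul_scalar_mx dotZr subr_ge0.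
by move=> h; rewrite (le_trans h) // -/(qform _ w) /Sigma qform_sum.
Qed.

(** Nonexpansiveness of the projection, then expansion of the square. The squared gradient is
    controlled by the rollout length, since [Qhat] is at most that length and
    [|dot phi v| <= W B]. *)
Lemma sgd_step_le o z k w v x : norm2 w <= W ->
  v = sgd M phi W alpha o z k -> x = accepted (z k).1 ->
  dot (sgd M phi W alpha o z k.+1 - w) (sgd M phi W alpha o z k.+1 - w) <=
  dot (v - w) (v - w) - 4 * alpha k * (dot (phi x) v * dot (phi x) (v - w))
  + 4 * alpha k * (dot (phi x) (v - w) * Qhat M o (z k))
  + 4 * alpha k ^+ 2 * B ^+ 2 * (a + (size (z k).2.2).+1%:R) ^+ 2.
Proof.
move=> hw vE xE; set c := 2 * alpha k * (dot (phi x) v - Qhat M o (z k)).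
have -> : sgd M phi W alpha o z k.+1 =
  Defs.proj (@norm2 R d) (ball2 W) (v - c *: phi x) by rewrite /c vE xE.
apply: le_trans (proj_ball2_nonexpansive _ W_ge0 hw) _.
have -> : v - c *: phi x - w = (v - w) - c *: phi x by rewrite addrAC.
have sq (e p : 'cV[R]_d) (b : R) :
    dot (e - b *: p) (e - b *: p) = dot e e - 2 * b * dot p e + b ^+ 2 * dot p p.
  by rewrite !dot_lin (dotC e p); ring.
set e := v - w.
have -> : dot (e - c *: phi x) (e - c *: phi x) =
    dot e e - 2 * c * dot (phi x) e + c ^+ 2 * dot (phi x) (phi x).
  exact: sq.
have -> : dot e e - 4 * alpha k * (dot (phi x) v * dot (phi x) e)
    + 4 * alpha k * (dot (phi x) e * Qhat M o (z k)) = dot e e - 2 * c * dot (phi x) e.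
  by rewrite /c; ring.
rewrite lerD2l.
have /andP[q0 q1] := traj_total_le M o (z k).2.
have vB : `|dot (phi x) v| <= a by rewrite /a mulrC dot_phi_le // vE norm2_sgd.
have cle : (dot (phi x) v - Qhat M o (z k)) ^+ 2 <= (a + (size (z k).2.2).+1%:R) ^+ 2.
  rewrite -real_normK ?num_real // lerXn2r ?nnegrE ?addr_ge0 ?mulr_ge0 ?B_ge0 //.
  by rewrite (le_trans (ler_normB _ _)) // lerD // ger0_norm.
have pB : dot (phi x) (phi x) <= B ^+ 2 by rewrite -norm2_le ?B_ge0.
have -> : c ^+ 2 = 4 * alpha k ^+ 2 * (dot (phi x) v - Qhat M o (z k)) ^+ 2.
  by rewrite /c; ring.
have al0 : 0 <= 4 * alpha k ^+ 2 by rewrite mulr_ge0 ?sqr_ge0.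
rewrite -[leRHS]mulrA -[leLHS]mulrA ler_wpM2l // mulrC.
by rewrite ler_pM ?dot_ge0 ?sqr_ge0.
Qed.

Section SgdRound.
Context (t : nat) (tT : (t < T)%N) (o : objective).

Let ws om := wstar o (run t om).1.
Let err k om := run_sgd o t k om - ws om.
Let dist k om := dot (err k om) (err k om).
Let nu om := nu_visit M nu0 (run_policy t om).
Let quad om (e : 'cV[R]_d) := \sum_x nu om x * dot (phi x) e ^+ 2.

Lemma nu_ge0 om x : 0 <= nu om x.
Proof. exact: (nu_visit_distr M (run_policyP t om) hnu0).1. Qed.

Lemma norm2_err k om : norm2 (err k om) <= 2 * W.
Proof.
rewrite (le_trans (ler_norm2B _ _)) // mulrC mulr_natr mulr2n lerD //.
  exact: norm2_sgd.
exact: norm2_wstar.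
Qed.

Lemma dist_itv k om : 0 <= dist k om <= (2 * W) ^+ 2.
Proof. by rewrite dot_ge0 /= -norm2_le ?norm2_err // mulr_ge0. Qed.

Lemma quad_itv om e c : norm2 e <= c -> 0 <= quad om e <= (B * c) ^+ 2.
Proof.
move=> ec; apply: mean_itv => [|x]; first exact: (nu_visit_distr M (run_policyP t om) hnu0).
rewrite sqr_ge0 /= -real_normK ?num_real // lerXn2r ?nnegrE ?dot_phi_le //.
by rewrite mulr_ge0 ?B_ge0 // (le_trans (norm2_ge0 e)).
Qed.

Lemma adapted_run_policy n (D : Type) (G : (S -> A -> R) -> D) :
  (t * 'L <= n)%N -> adapted n (fun om => G (run_policy t om)).
Proof. by move=> tn; exact: (adapted_comp (fun r => G (log_linear phi r.1)) (adapted_run tn)). Qed.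

Lemma adapted_ws n : (t * 'L <= n)%N -> adapted n ws.
Proof. by move=> tn; exact: (adapted_comp (fun r => wstar o r.1) (adapted_run tn)). Qed.

Lemma adapted_err k n : (k <= K)%N -> (t * 'L + k <= n)%N -> adapted n (err k).
Proof.
move=> kK tn; apply: (adapted_comp2 (fun v w => v - w)); first exact: adapted_sgd.
by apply: adapted_ws; rewrite (leq_trans _ tn) // leq_addr.
Qed.

Lemma adapted_quad k n : (k <= K)%N -> (t * 'L + k <= n)%N ->
  adapted n (fun om => quad om (err k om)).
Proof.
move=> kK tn.
apply: (adapted_comp2 (fun pi e => \sum_x nu_visit M nu0 pi x * dot (phi x) e ^+ 2)).
  by apply: (adapted_run_policy id); rewrite (leq_trans _ tn) // leq_addr.
exact: adapted_err.
Qed.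

Lemma integrable_dist k : (k <= K)%N -> integrable_rv P (dist k).
Proof.
move=> kK; apply: (@adapted_integrable (t * 'L + k) _ ((2 * W) ^+ 2)).
  by apply: (adapted_comp (fun e => dot e e)); exact: adapted_err.
by move=> om; have /andP[h0 h1] := dist_itv k om; rewrite ger0_norm.
Qed.

Lemma integrable_quad k : (k <= K)%N -> integrable_rv P (fun om => quad om (err k om)).
Proof.
move=> kK; apply: (@adapted_integrable (t * 'L + k) _ ((B * (2 * W)) ^+ 2)).
  exact: adapted_quad.
by move=> om; have /andP[h0 h1] := quad_itv om (norm2_err k om); rewrite ger0_norm.
Qed.

Lemma first_order_wstar om e : norm2 (ws om + e) <= W ->
  0 <= \sum_x nu om x * ((dot (phi x) (ws om) - Q M o (run_policy t om) x) * dot (phi x) e).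
Proof.
move=> he.
have := @argmin_least_squares _ _ _ phi (nu om) (Q M o (run_policy t om)) W
  (ws om) (ws om + e) (wstar_min o (run t om).1) he.
rewrite addrAC subrr add0r; under eq_bigr do rewrite !(dotC _ (phi _)).
by [].
Qed.

(** In the mean [Qhat] becomes Q. Then [dot phi v - Q] is [dot phi err] plus the residual of the
    best fit: the first summand produces the quadratic form, the second contributes a nonnegative
    amount by optimality of the fit over the ball. *)
Lemma mean_gradient k : (k < K)%N ->
  let e x om := dot (phi x) (err k om) in
  let z om := X t k om in
  let g om := dot (phi (accepted (z om).1)) (run_sgd o t k om) * e (accepted (z om).1) om
     - e (accepted (z om).1) om * Qhat M o (z om) in
  integrable_rv P g /\ mean P (fun om => quad om (err k om)) <= mean P g.
Proof.
move=> kK e z g.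
pose f x om := dot (phi x) (run_sgd o t k om) * e x om.
have ee x om : `|e x om| <= B * (2 * W) by apply: dot_phi_le; exact: norm2_err.
have ad_e x : adapted (t * 'L + k) (e x).
  by apply: (adapted_comp (fun v => dot (phi x) v)); apply: adapted_err => //; exact: ltnW.
have ad_f x : adapted (t * 'L + k) (f x).
  apply: (adapted_comp2 (fun v y => dot (phi x) v * y)) => //.
  by apply: adapted_sgd => //; exact: ltnW.
have int_e x : integrable_rv P (e x) by exact: adapted_integrable (ad_e x) (ee x).
have int_f x : integrable_rv P (f x).
  apply: (@adapted_integrable (t * 'L + k) _ (B * W * (B * (2 * W)))) => // om.
  rewrite normrM ler_pM //; apply: dot_phi_le; exact: norm2_sgd.
have m1 x := mean_qdraw_accepted tT x kK (ad_f x) (int_f x).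
have m2 x := mean_qdraw_Qhat tT o x kK (ad_e x) (int_e x).
(* The pair at which the gradient is taken is random. Summing over its possible values [x] makes
   each term a function of the past times a function of the draw. *)
pose g' om := \sum_x (f x om * (accepted (z om).1 == x)%:R -
    e x om * ((accepted (z om).1 == x)%:R * Qhat M o (z om))).
have gE : g = g'.
  apply/funext => om; rewrite /g' (bigD1 (accepted (z om).1)) //= eqxx mulr1 mul1r.
  rewrite big1 ?addr0 // => x xz.
  by rewrite eq_sym (negbTE xz) mul0r !mulr0 subrr.
have int_g x : integrable_rv P (fun om => f x om * (accepted (z om).1 == x)%:R -
    e x om * ((accepted (z om).1 == x)%:R * Qhat M o (z om))).
  by apply: integrable_rvB; [case: (m1 x)|case: (m2 x)].
pose gbar x om := f x om * nu om x - e x om * (nu om x * Q M o (run_policy t om) x).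
have int_gbar x : integrable_rv P (gbar x).
  by apply: integrable_rvB; [case: (m1 x)|case: (m2 x)].
have mE : mean P g = mean P (fun om => \sum_x gbar x om).
  rewrite gE !mean_sum //; apply: eq_bigr => x _.
  have [i1 i1' e1] := m1 x; have [i2 i2' e2] := m2 x.
  by rewrite !meanB // e1 e2.
split; first by rewrite gE; exact: integrable_rv_sum.
rewrite mE; apply: le_mean.
- by apply: integrable_quad; exact: ltnW.
- exact: integrable_rv_sum.
move=> om; have he : norm2 (ws om + err k om) <= W.
  by rewrite /err addrC subrK; exact: norm2_sgd.
have := first_order_wstar he; rewrite -(lerD2l (quad om (err k om))) addr0.
move=> /le_trans; apply; rewrite /quad -big_split le_eqVlt; apply/orP; left; apply/eqP.
apply: eq_bigr => x _ /=; rewrite /gbar /f /e.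
have -> : run_sgd o t k om = ws om + err k om by rewrite /err addrC subrK.
by rewrite dotDr; ring.
Qed.

Lemma mean_sgd_step k : (k < K)%N ->
  mean P (dist k.+1) <= mean P (dist k) -
    4 * alpha k * mean P (fun om => quad om (err k om)) +
    4 * alpha k ^+ 2 * B ^+ 2 * (a ^+ 2 + 2 * a * u + 2 * u ^+ 2 - u).
Proof.
move=> kK.
have a0 : 0 <= a by rewrite mulr_ge0 ?B_ge0.
have al0 : 0 <= alpha k by rewrite alphaE divr_ge0 // mulr_ge0 // ltW.
have [int_s mean_s] := qdraw_size_sq tT kK a0.
have [int_g mean_g] := mean_gradient kK.
set g := (fun om => _ - _) in int_g mean_g.
have int_d := integrable_dist (ltnW kK).
apply: (@le_trans _ _ (mean P (fun om => dist k om + - (4 * alpha k) * g om +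
    4 * alpha k ^+ 2 * B ^+ 2 * (a + (size (X t k om).2.2).+1%:R) ^+ 2))).
  apply: le_mean; first exact: integrable_dist.
    apply: integrable_rvD; last exact: integrable_rvZ.
    by apply: integrable_rvD => //; exact: integrable_rvZ.
  move=> om.
  have := @sgd_step_le o (fun j => X t j om) k (ws om) _ _ (norm2_wstar _ _) erefl erefl.
  move=> /le_trans; apply; rewrite /g /dist /err /run_sgd lerD2r.
  by rewrite le_eqVlt; apply/orP; left; apply/eqP; ring.
have int1 := integrable_rvD int_d (integrable_rvZ (- (4 * alpha k)) int_g).
rewrite (meanD int1) ?(meanD int_d) ?meanZ //; try exact: integrable_rvZ.
rewrite lerD //.
  by rewrite mulNr lerD2l lerN2 ler_wpM2l // mulr_ge0.
by rewrite ler_wpM2l // !mulr_ge0 ?sqr_ge0 ?B_ge0.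
Qed.

Lemma sigma_mean_dist k : (k <= K)%N ->
  sigmaF * mean P (dist k) <= mean P (fun om => quad om (err k om)).
Proof.
move=> kK; rewrite -meanZ; last exact: integrable_dist.
apply: ae_le_mean.
- by apply: integrable_rvZ; exact: integrable_dist.
- exact: integrable_quad.
- by move=> om; rewrite mulr_ge0 ?(ltW sigma_gt0) // dot_ge0.
- by move=> om; have /andP[] := quad_itv om (norm2_err k om).
apply: filterS coverage => om /(_ t tT) h.
exact: loewner_scalar.
Qed.

(** A potential argument with [sigmaF / 4 * k^2] times the mean squared distance: for this step
    size, multiplying the recursion by [sigmaF / 4 * (k + 1)^2] makes the noise term equal to
    [G / sigmaF] at every step. *)
Lemma sgd_weighted_le :
  \sum_(k < K) k.+1%:R * mean P (fun om => quad om (err k om)) <=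
  2 / 3 * (K%:R * (4 * B ^+ 2 * (a ^+ 2 + 2 * a * u + 2 * u ^+ 2 - u) / sigmaF)).
Proof.
set G := 4 * _ * _.
pose q k := mean P (fun om => quad om (err k om)).
(* A step gains [2 (k + 1) q k]. The growth of the weight from [k^2] to [(k + 1)^2] costs at most
   [(2 k + 1) / 4 * q k], by strong convexity, which is below [(k + 1) / 2 * q k]; this leaves the
   factor 3/2. *)
have inv k : (k <= K)%N -> \sum_(j < k) 3 / 2 * (j.+1%:R * q j) +
    sigmaF / 4 * k%:R ^+ 2 * mean P (dist k) <= k%:R * (G / sigmaF).
  elim: k => [|k IHk] kK; first by rewrite big_ord0 expr0n /= mulr0 !mul0r addr0.
  have := IHk (ltnW kK); rewrite big_ord_recr /=.
  have := mean_sgd_step kK; have := sigma_mean_dist (ltnW kK); rewrite -/(q k).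
  set D := mean P (dist k); set D' := mean P (dist k.+1); set Sm := \sum_(_ < _) _.
  rewrite -/G alphaE -[k.+1%:R]natr1; move: (ler0n R k); move: (k%:R : R) => n n0.
  have s0 := sigma_gt0; set s := sigmaF in s0 *; move=> hD hstep hind.
  have n1 : 0 < n + 1 by rewrite ltr_wpDl.
  have c0 : 0 <= s / 4 * (n + 1) ^+ 2 by rewrite mulr_ge0 ?sqr_ge0 // divr_ge0 // ltW.
  have := ler_wpM2l c0 hstep.
  have -> : s / 4 * (n + 1) ^+ 2 * (D - 4 * (2 / (s * (n + 1))) * q k +
      4 * (2 / (s * (n + 1))) ^+ 2 * B ^+ 2 * (a ^+ 2 + 2 * a * u + 2 * u ^+ 2 - u)) =
      s / 4 * (n + 1) ^+ 2 * D - 2 * (n + 1) * q k + G / s.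
    by rewrite /G; field; rewrite !gt_eqF // subr1_discount_gt0.
  have q0 : 0 <= q k.
    by apply: mean_ge0 => om; have /andP[] := quad_itv om (norm2_err k om).
  have h1 : 0 <= (2 * n + 1) * (q k - s * D) by rewrite mulr_ge0 ?subr_ge0 //; lra.
  move: (G / s) hind h1 => g hind h1; lra.
have := inv K (leqnn K); rewrite -mulr_sumr.
have : 0 <= sigmaF / 4 * K%:R ^+ 2 * mean P (dist K).
  rewrite !mulr_ge0 ?sqr_ge0 ?(ltW sigma_gt0) //.
  by apply: mean_ge0 => om; exact: dot_ge0.
rewrite -/G; set x := K%:R * (G / sigmaF); rewrite -/q.
set y := \sum_(_ < _) _.
lra.
Qed.

(** Brings the second moment into the shape of [G^2]; the factor 3/2 cancels the 2/3 of
    [sgd_weighted_le]. Twice the difference is a quadratic in [a] with leading coefficient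
    [3 v - 2], whose minimum is nonnegative for [v >= 1] and equal to 0 at [v = 1]. *)
Lemma sgd_noise_le :
  a ^+ 2 + 2 * a * u + 2 * u ^+ 2 - u <= 3 / 2 * u * (a ^+ 2 + 2 * u ^+ 2).
Proof.
have u1 : 1 <= u by rewrite invf_ge1 ?subr1_discount_gt0 // gerBl discount_ge0.
move: (u) u1 => v v1.
have : 0 <= (3 * v - 2) * (a - 2 * v / (3 * v - 2)) ^+ 2.
  by rewrite mulr_ge0 ?sqr_ge0 //; lra.
have h : 0 < 3 * v - 2 by lra.
have -> : (3 * v - 2) * (a - 2 * v / (3 * v - 2)) ^+ 2 =
    (3 * v - 2) * a ^+ 2 - 4 * v * a + 4 * v ^+ 2 / (3 * v - 2).
  by field; rewrite gt_eqF.
have : 4 * v ^+ 2 / (3 * v - 2) <= 6 * v ^+ 3 - 4 * v ^+ 2 + 2 * v.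
  by rewrite ler_pdivrMr //; nra.
move: (_ / (3 * v - 2)) => y; nra.
Qed.

Lemma sgd_weights_distr :
  is_distr (fun k : 'I_K => 2 * k.+1%:R / (K%:R * K.+1%:R) : R).
Proof.
split=> [k|]; first by rewrite divr_ge0 // mulr_ge0.
rewrite -mulr_suml -mulr_sumr.
have -> n : \sum_(k < n) k.+1%:R = n%:R * n.+1%:R / 2 :> R.
  elim: n => [|k IHk]; first by rewrite big_ord0 !mul0r.
  by rewrite big_ord_recr /= IHk -[k.+2%:R]natr1 -[k.+1%:R]natr1; field.
set x := K%:R * K.+1%:R.
have xn0 : x != 0 by rewrite mulf_neq0 ?pnatr_eq0 // -lt0n.
by field.
Qed.

Lemma what_err om : what M phi W alpha K o (fun k => X t k om) - ws om =
  \sum_(k < K) (2 * k.+1%:R / (K%:R * K.+1%:R)) *: err k om.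
Proof.
under eq_bigr do rewrite scalerBr.
rewrite sumrB -scaler_suml sgd_weights_distr.2 scale1r; congr (_ - _).
by rewrite /what scaler_sumr; apply: eq_bigr => k _; rewrite scalerA mulrAC.
Qed.

Lemma adapted_what n : (t * 'L + K <= n)%N ->
  adapted n (fun om => what M phi W alpha K o (fun k => X t k om)).
Proof.
move=> tn; exists (fun s => what M phi W alpha K o (zq_of K x0 s t)) => om.
apply: eq_what => k kK; rewrite zq_of_history //.
by apply: leq_trans tn; rewrite ltn_add2l.
Qed.

Lemma norm2_what om : norm2 (what M phi W alpha K o (fun k => X t k om)) <= W.
Proof.
have [p0 p1] := sgd_weights_distr.
rewrite /what scaler_sumr (le_trans (ler_norm2_sum _)) //.
rewrite -[leRHS]mul1r -[X in _ <= X * _]p1 mulr_suml; apply: ler_sum => k _.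
rewrite !norm2Z mulrA ger0_norm ?divr_ge0 // ger0_norm // [2 / _ * _]mulrAC.
by rewrite ler_wpM2l ?p0 // norm2_sgd.
Qed.

(** Convexity passes the weighted sum to the averaged output. The factor [K] of [sgd_weighted_le]
    cancels against the normalization [2 / (K (K + 1))], which leaves the rate [1 / (K + 1)]. *)
Lemma mean_what_err :
  integrable_rv P (fun om => quad om (what M phi W alpha K o (fun k => X t k om) - ws om)) /\
  mean P (fun om => quad om (what M phi W alpha K o (fun k => X t k om) - ws om)) <=
  2 * u * (4 * (W ^+ 2 * B ^+ 2 + 2 / (1 - gamma) ^+ 2) * B ^+ 2) / (sigmaF * K.+1%:R).
Proof.
have int_q : integrable_rv P (fun om => quad om (what M phi W alpha K o (fun k => X t k om) - ws om)).
  apply: (@adapted_integrable (t * 'L + K) _ ((B * (2 * W)) ^+ 2)) => [|om].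
    apply: (adapted_comp2 (fun pi e => \sum_x nu_visit M nu0 pi x * dot (phi x) e ^+ 2)).
      by apply: (adapted_run_policy id); rewrite leq_addr.
    apply: (adapted_comp2 (fun v w => v - w)); first exact: adapted_what.
    by apply: adapted_ws; rewrite leq_addr.
  have : norm2 (what M phi W alpha K o (fun k => X t k om) - ws om) <= 2 * W.
    rewrite (le_trans (ler_norm2B _ _)) // mulrC mulr_natr mulr2n lerD //.
      exact: norm2_what.
    exact: norm2_wstar.
  by move=> /(quad_itv om) /andP[h0 h1]; rewrite ger0_norm.
split=> //.
pose p (k : 'I_K) : R := 2 * k.+1%:R / (K%:R * K.+1%:R).
apply: (@le_trans _ _ (mean P (fun om => \sum_(k < K) p k * quad om (err k om)))).
  apply: le_mean => // [|om].
    by apply: integrable_rv_sum => k; apply/integrable_rvZ/integrable_quad/ltnW.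
  rewrite what_err; apply: sum_dot_sq_convex; first exact: nu_ge0.
  exact: sgd_weights_distr.
rewrite mean_sum => [|k]; last by apply/integrable_rvZ/integrable_quad/ltnW.
have -> : \sum_(k < K) mean P (fun om => p k * quad om (err k om)) =
    2 / (K%:R * K.+1%:R) * \sum_(k < K) k.+1%:R * mean P (fun om => quad om (err k om)).
  rewrite mulr_sumr; apply: eq_bigr => k _.
  by rewrite meanZ; [rewrite /p mulrA; congr (_ * _); rewrite mulrAC|apply/integrable_quad/ltnW].
have K0 : (0 : R) < K%:R by rewrite ltr0n.
have K1 : (0 : R) < K.+1%:R by rewrite ltr0n.
have s0 := sigma_gt0.
have c0 : 0 <= 2 / (K%:R * K.+1%:R) :> R by rewrite divr_ge0 // mulr_ge0.
apply: le_trans (ler_wpM2l c0 sgd_weighted_le) _.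
set N0 := a ^+ 2 + _ + _ - u.
have -> : 2 / (K%:R * K.+1%:R) * (2 / 3 * (K%:R * (4 * B ^+ 2 * N0 / sigmaF))) =
    (16 / 3 * B ^+ 2 / (sigmaF * K.+1%:R)) * N0.
  by field; rewrite !gt_eqF.
have c1 : 0 <= 16 / 3 * B ^+ 2 / (sigmaF * K.+1%:R).
  by rewrite divr_ge0 ?mulr_ge0 ?sqr_ge0 ?B_ge0 // ltW.
apply: le_trans (ler_wpM2l c1 sgd_noise_le) _.
have g0 := subr1_discount_gt0 M.
rewrite le_eqVlt; apply/orP; left; apply/eqP; rewrite /a.
by field; rewrite !gt_eqF.
Qed.

End SgdRound.

(** * Regret, optimality gap and constraint violation *)

Section Regret.
Context (pistar : S -> A -> R) (eps : R).
Hypotheses (xi_gt0 : 0 < xi) (hslater : slater M rho xi) (hopt : optimal M rho pistar).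
Hypothesis T_gt0 : (0 < T)%N.
Hypotheses (eta1E : eta1 = (Num.sqrt T%:R)^-1) (eta2E : eta2 = (Num.sqrt T%:R)^-1).
Local Notation nustar := (nu_star M rho pistar).
Hypothesis kappa_fin : rel_cond phi nustar nu0 \is a fin_num.
Hypothesis bias_le : forall o t, (t < T)%N ->
  mean P (fun om => fit_error M phi o nustar (wstar o (run t om).1) (run t om).1) <= eps.

Let eta : R := (Num.sqrt T%:R)^-1.
Let Lam := 2 / ((1 - gamma) * xi).
Let nA : R := #|A|%:R.
Let b := threshold M.
Let lam t om := (run t om).2.
Let wh o t om := what M phi W alpha K o (fun k => X t k om).
Let dir t om := wh obj_r t om + lam t om *: wh obj_g t om.
Let Vt o t om := V M rho o (run_policy t om).
Let Vh t om := Vhat_g M (Y t om).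
Let G2 := 4 * (W ^+ 2 * B ^+ 2 + 2 / (1 - gamma) ^+ 2) * B ^+ 2.
Let err o t om :=
  Num.sqrt (nA * fit_error M phi o nustar (wstar o (run t om).1) (run t om).1) +
  Num.sqrt (nA * \sum_x nustar x * dot (phi x) (wh o t om - wstar o (run t om).1) ^+ 2).
Let ebar := Num.sqrt (nA * eps) +
  u * Num.sqrt (2 * fine (rel_cond phi nustar nu0) * nA * G2 / (sigmaF * K.+1%:R)).
(** Second-order cost of one policy update per [eta^2]: the parameter moves by at most
    [eta * u * W * (1 + Lam)]. *)
Let CW := (B * W * (1 + Lam) * u) ^+ 2 / 2.

Lemma pistar_policy : is_policy pistar.
Proof. by have [[]] := hopt. Qed.

Lemma horizon_gt0 : 0 < u.
Proof. by rewrite invr_gt0 subr1_discount_gt0. Qed.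

Lemma horizon_ge1 : 1 <= u.
Proof. by rewrite invf_ge1 ?subr1_discount_gt0 // gerBl discount_ge0. Qed.

Lemma T_neq0 : T%:R != 0 :> R.
Proof. by rewrite pnatr_eq0 -lt0n. Qed.

Lemma eta_gt0 : 0 < eta.
Proof. by rewrite invr_gt0 sqrtr_gt0 ltr0n. Qed.

Lemma T_eta : T%:R * eta ^+ 2 = 1.
Proof. by rewrite exprVn sqr_sqrtr ?ler0n // divff // T_neq0. Qed.

Lemma LamE : Lam = 2 * u / xi.
Proof. by rewrite /Lam invfM mulrA. Qed.

Lemma Lam_ge0 : 0 <= Lam.
Proof. by rewrite LamE !mulr_ge0 ?invr_ge0 ?(ltW xi_gt0) ?(ltW horizon_gt0) // ltW ?subr1_discount_gt0. Qed.

Lemma runS t om : run t.+1 om = ((run t om).1 + (eta / (1 - gamma)) *: dir t om,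
  Defs.proj Num.norm `[0, Lam] (lam t om - eta * (Vh t om - b))).
Proof.
rewrite /run /= -/(run t om) /dir /lam eta1E eta2E -/eta.
by case: (run t om).
Qed.

Lemma lam_itv t om : 0 <= lam t om <= Lam.
Proof.
case: t => [|t]; first by rewrite lexx Lam_ge0.
by rewrite /lam runS; have [] := proj_itv_nonexpansive (lam t om - eta * (Vh t om - b)) Lam_ge0.
Qed.

Lemma dual_step c t om : 0 <= c <= Lam ->
  eta * ((lam t om - c) * (Vh t om - b)) <=
  (lam t om - c) ^+ 2 / 2 - (lam t.+1 om - c) ^+ 2 / 2 + eta ^+ 2 / 2 * (Vh t om - b) ^+ 2.
Proof.
move=> hc; have [_ /(_ _ hc)] := proj_itv_nonexpansive (lam t om - eta * (Vh t om - b)) Lam_ge0.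
rewrite [lam t.+1 om]/lam runS /=; move: (Defs.proj _ _ _) => p; nra.
Qed.

Lemma norm2_dir t om : norm2 (dir t om) <= W * (1 + Lam).
Proof.
have /andP[l0 l1] := lam_itv t om.
rewrite (le_trans (ler_norm2D _ _)) // mulrDr mulr1 lerD ?norm2_what //.
by rewrite norm2Z ger0_norm // mulrC ler_pM ?norm2_ge0 // norm2_what.
Qed.

Let Phi t om := log_likelihood M rho phi pistar (run t om).1.

Lemma err_ge0 o t om : 0 <= err o t om.
Proof. by rewrite addr_ge0 ?sqrtr_ge0. Qed.

Lemma primal_step t om :
  eta * ((V M rho obj_r pistar - Vt obj_r t om) + lam t om * (b - Vt obj_g t om)) <=
  Phi t.+1 om - Phi t om + eta * u * (2 * (err obj_r t om + Lam * err obj_g t om)) +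
  eta ^+ 2 * CW.
Proof.
have g0 := subr1_discount_gt0 M; have u0 := horizon_gt0.
have /andP[l0 l1] := lam_itv t om.
have hs := pistar_policy.
have hphi := log_likelihood_shift_ge M hrho x0 phiB hs (run t om).1 ((eta / (1 - gamma)) *: dir t om).
have gap o := @value_gap_le R S A M rho hrho d phi x0 pistar hs o (run t om).1 (wh o t om)
  (wstar o (run t om).1).
have := gap obj_r; have := gap obj_g; rewrite -!/(err _ _ _) -!/(Vt _ _ _).
rewrite -!/(run_policy t om) -!/(Vt _ _ _).
move: hphi; rewrite /Phi runS /= advantage_gapZ {1}/dir advantage_gapD advantage_gapZ.
set Ar := advantage_gap _ _ _ _ _ (wh obj_r t om).
set Ag := advantage_gap _ _ _ _ _ (wh obj_g t om).
set p := log_likelihood _ _ _ _ _; set p' := log_likelihood _ _ _ _ _.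
rewrite -/(dir t om) => hphi hg hr.
have hn : (B * norm2 ((eta / (1 - gamma)) *: dir t om)) ^+ 2 / 2 <= eta ^+ 2 * CW.
  have -> : eta ^+ 2 * CW = (B * ((eta / (1 - gamma)) * (W * (1 + Lam)))) ^+ 2 / 2.
    by rewrite /CW; ring.
  rewrite ler_wpM2r // lerXn2r ?nnegrE ?mulr_ge0 ?norm2_ge0 ?B_ge0 ?addr_ge0 ?Lam_ge0 ?(ltW eta_gt0) ?(ltW u0) //.
  rewrite ler_wpM2l ?B_ge0 // norm2Z ger0_norm ?mulr_ge0 ?(ltW eta_gt0) ?(ltW u0) //.
  by rewrite ler_wpM2l ?norm2_dir // mulr_ge0 ?(ltW eta_gt0) ?(ltW u0).
(* Feasibility of [pistar] and nonnegativity of the multiplier allow [b] to stand for the utility of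
   [pistar]. *)
have bV : b <= V M rho obj_g pistar by have [[]] := hopt.
have eu0 : 0 <= eta * u by rewrite mulr_ge0 ?(ltW eta_gt0) ?(ltW u0).
have e0 := eta_gt0.
(* Moved to the right-hand side, the factor [1 - gamma] of the performance difference matches the
   step size [eta / (1 - gamma)] of the update. *)
have h1 : eta * (V M rho obj_r pistar - Vt obj_r t om) <=
    eta * u * (Ar + 2 * err obj_r t om).
  rewrite -mulrA ler_pM2l // -(ler_pM2l g0) mulrA divff ?gt_eqF // mul1r.
  exact: hr.
have h2 : eta * (lam t om * (b - Vt obj_g t om)) <=
    eta * u * (lam t om * Ag + 2 * (Lam * err obj_g t om)).
  rewrite -mulrA ler_pM2l // -(ler_pM2l g0) [leRHS]mulrA divff ?gt_eqF // mul1r.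
  have := err_ge0 obj_g t om.
  have := ler_wpM2l l0 hg.
  have : lam t om * ((1 - gamma) * (b - Vt obj_g t om)) <=
    lam t om * ((1 - gamma) * (V M rho obj_g pistar - Vt obj_g t om)).
    by rewrite ler_wpM2l // ler_pM2l // lerB.
  set e := err obj_g t om => k1 k2 k3.
  have : lam t om * e <= Lam * e by rewrite ler_wpM2r.
  lra.
lra.
Qed.

(** The last term arises because the policy step involves the true utility value and the multiplier
    step its estimate; as [lam t] depends on earlier rounds only, it has mean 0. *)
Let rest t om := eta * u * (2 * (err obj_r t om + Lam * err obj_g t om)) + eta ^+ 2 * CW +
  eta ^+ 2 / 2 * (Vh t om - b) ^+ 2 - eta * (lam t om * (Vh t om - Vt obj_g t om)).

Lemma primal_dual c om : 0 <= c <= Lam ->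
  eta * \sum_(t < T) ((V M rho obj_r pistar - Vt obj_r t om) + c * (b - Vh t om)) <=
  ln nA + c ^+ 2 / 2 + \sum_(t < T) rest t om.
Proof.
move=> hc; pose F t := Phi t om - (lam t om - c) ^+ 2 / 2.
have step t : eta * ((V M rho obj_r pistar - Vt obj_r t om) + c * (b - Vh t om)) <=
    F t.+1 - F t + rest t om.
  have := primal_step t om; have := dual_step t om hc; rewrite /F /rest.
  by move: (Phi t.+1 om) (Phi t om) => p p'; lra.
have : \sum_(t < T) (F t.+1 - F t) <= ln nA + c ^+ 2 / 2.
  rewrite -(big_mkord xpredT (fun t => F t.+1 - F t)) telescope_sumr //.
  have hT : Phi T om <= 0 by rewrite /Phi; apply: (log_likelihood_le0 M hrho phi x0 pistar_policy).
  have h0 : Phi 0 om = - ln nA by rewrite /Phi; apply: (log_likelihood0 M hrho phi x0 pistar_policy).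
  rewrite /F h0 {2}/lam /=.
  move: (Phi T om) (lam T om) (ln nA) hT => p l n hT.
  have := sqr_ge0 (l - c); lra.
rewrite -(lerD2r (\sum_(t < T) rest t om)) -big_split /=; apply: le_trans.
by rewrite mulr_sumr; apply: ler_sum => t _; exact: step.
Qed.

Lemma fit_error_itv o t om :
  0 <= fit_error M phi o nustar (wstar o (run t om).1) (run t om).1 <= (u + B * W) ^+ 2.
Proof.
have u0 := horizon_gt0.
have ns := nu_star_distr M hrho x0 pistar_policy.
apply: mean_itv => // x; rewrite sqr_ge0 /= -real_normK ?num_real //.
have /andP[q0 q1] := Q_itv M o x (run_policyP t om).
rewrite lerXn2r ?nnegrE ?addr_ge0 ?mulr_ge0 ?B_ge0 ?(ltW u0) //.
rewrite (le_trans (ler_normB _ _)) // lerD //; first by rewrite ger0_norm.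
by rewrite dotC; apply: dot_phi_le; exact: norm2_wstar.
Qed.

Lemma integrable_fit_error o t : integrable_rv P
  (fun om => fit_error M phi o nustar (wstar o (run t om).1) (run t om).1).
Proof.
apply: (@adapted_integrable (t * 'L) _ ((u + B * W) ^+ 2)) => [|om]; last first.
  by have /andP[h0 h1] := fit_error_itv o t om; rewrite ger0_norm.
exact: (adapted_comp (fun r => fit_error M phi o nustar (wstar o r.1) r.1) (adapted_run (leqnn _))).
Qed.

(** The bias part is the hypothesis under Jensen for the root. For the estimation part, [nu^star] is
    at most [kappa nu0], hence at most [kappa u nu^(t)], as quadratic forms; the SGD bound brings a
    second [u], and the root extracts [u]. *)
Lemma mean_err o t : (t < T)%N -> integrable_rv P (err o t) /\ mean P (err o t) <= ebar.
Proof.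
move=> tT; have u0 := horizon_gt0.
have nA0 : 0 <= nA by rewrite ler0n.
have ns := nu_star_distr M hrho x0 pistar_policy.
pose f om := fit_error M phi o nustar (wstar o (run t om).1) (run t om).1.
pose g om := \sum_x nustar x * dot (phi x) (wh o t om - wstar o (run t om).1) ^+ 2.
have f_itv om : 0 <= f om <= (u + B * W) ^+ 2 := fit_error_itv o t om.
have int_f : integrable_rv P f := integrable_fit_error o t.
pose e om := wh o t om - wstar o (run t om).1.
pose q om := \sum_x nu_visit M nu0 (run_policy t om) x * dot (phi x) (e om) ^+ 2.
have g0 om : 0 <= g om by apply: sumr_ge0 => x _; rewrite mulr_ge0 ?ns.1 ?sqr_ge0.
have [int_q mean_q] := mean_what_err tT o.
have int_g : integrable_rv P g.
  apply: (@adapted_integrable (t * 'L + K) _ ((B * (2 * W)) ^+ 2)) => [|om].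
    apply: (adapted_comp (fun e => \sum_x nustar x * dot (phi x) e ^+ 2)).
    apply: (adapted_comp2 (fun v w => v - w)); first exact: adapted_what.
    by apply: adapted_ws; rewrite leq_addr.
  have e2 : norm2 (e om) <= 2 * W.
    by rewrite (le_trans (ler_norm2B _ _)) // mulrC mulr_natr mulr2n lerD ?norm2_what ?norm2_wstar.
  rewrite ger0_norm //; have /andP[] // : 0 <= g om <= (B * (2 * W)) ^+ 2.
  apply: mean_itv => // x; rewrite sqr_ge0 /= -real_normK ?num_real //.
  by rewrite lerXn2r ?nnegrE ?dot_phi_le // !mulr_ge0 ?B_ge0.
set kap := fine (rel_cond phi nustar nu0).
have [k0 _] := rel_cond_le 0 ns.1 hnu0.1 kappa_fin; rewrite -/kap in k0.
have gq om : g om <= kap * u * q om.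
  have [_ h] := rel_cond_le (e om) ns.1 hnu0.1 kappa_fin.
  apply: le_trans h _; rewrite -/kap -mulrA ler_wpM2l // mulr_sumr; apply: ler_sum => x _.
  rewrite mulrA ler_wpM2r ?sqr_ge0 // -(ler_pM2l (subr1_discount_gt0 M)) mulrA.
  rewrite divff ?gt_eqF ?subr1_discount_gt0 // mul1r.
  exact: nu_visit_ge (run_policyP t om) hnu0.
have mean_g : mean P (fun om => nA * g om) <=
    u ^+ 2 * (2 * kap * nA * G2 / (sigmaF * K.+1%:R)).
  have c0 : 0 <= nA * (kap * u) by rewrite !mulr_ge0 // ltW.
  apply: (@le_trans _ _ (mean P (fun om => nA * (kap * u) * q om))).
    apply: le_mean; [exact: integrable_rvZ|exact: integrable_rvZ|move=> om].
    by rewrite -mulrA ler_wpM2l.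
  rewrite meanZ //; apply: le_trans (ler_wpM2l c0 mean_q) _.
  by rewrite le_eqVlt; apply/orP; left; apply/eqP; rewrite /G2; ring.
have [i1 m1] : integrable_rv P (fun om => Num.sqrt (nA * f om)) /\
    mean P (fun om => Num.sqrt (nA * f om)) <= Num.sqrt (nA * eps).
  apply: mean_sqrt_le => [|om|]; first exact: integrable_rvZ.
    by rewrite mulr_ge0 //; have /andP[] := f_itv om.
  by rewrite meanZ // ler_wpM2l // bias_le.
have [i2 m2] : integrable_rv P (fun om => Num.sqrt (nA * g om)) /\
    mean P (fun om => Num.sqrt (nA * g om)) <=
    Num.sqrt (u ^+ 2 * (2 * kap * nA * G2 / (sigmaF * K.+1%:R))).
  apply: mean_sqrt_le => // [|om]; first exact: integrable_rvZ.
  by rewrite mulr_ge0.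
split; first exact: integrable_rvD.
rewrite /err meanD // lerD //; apply: le_trans m2 _.
by rewrite sqrtrM ?sqr_ge0 // sqrtr_sqr ger0_norm // ltW.
Qed.

Lemma V_abs_le o t om : `|Vt o t om| <= u.
Proof.
by have /andP[v0 v1] := V_itv M o (run_policyP t om) hrho; rewrite ger0_norm.
Qed.

Lemma adapted_V o t n : (t * 'L <= n)%N -> adapted n (Vt o t).
Proof. exact: adapted_run_policy. Qed.

Lemma integrable_V o t : integrable_rv P (Vt o t).
Proof. apply: adapted_integrable (V_abs_le o t); exact: adapted_V (leqnn _). Qed.

Lemma adapted_lam t n : (t * 'L <= n)%N -> adapted n (lam t).
Proof. by move=> tn; exact: (adapted_comp snd (adapted_run tn)). Qed.

Lemma integrable_lam t : integrable_rv P (lam t).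
Proof.
apply: (@adapted_integrable (t * 'L) _ Lam) => [|om]; first exact: adapted_lam.
by have /andP[l0 l1] := lam_itv t om; rewrite ger0_norm.
Qed.

Lemma mean_noise t f : (t < T)%N -> adapted (t * 'L) f -> integrable_rv P f ->
  integrable_rv P (fun om => f om * (Vh t om - Vt obj_g t om)) /\
  mean P (fun om => f om * (Vh t om - Vt obj_g t om)) = 0.
Proof.
move=> tT af hf; have [i1 i2 e] := mean_vdraw tT (adapted_le (leq_addr K _) af) hf.
rewrite (_ : (fun om => _) = fun om => f om * Vh t om - f om * Vt obj_g t om); last first.
  by apply/funext => om; rewrite mulrBr.
by split; [exact: integrable_rvB | rewrite meanB //; apply/eqP; rewrite subr_eq0; exact/eqP].
Qed.

Lemma adapted_Vh t n : (t * 'L + K < n)%N -> adapted n (Vh t).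
Proof. by move=> tn; exact: (adapted_comp (@Vhat_g _ _ _ M) (adapted_Y tn)). Qed.

Lemma adapted_measurable n (f : Omega -> R) : adapted n f -> measurable_fun setT f.
Proof. by move=> /adapted_discrete; exact: measurable_fun_discrete. Qed.

Lemma Vh_itv t om : 0 <= Vh t om <= (size (Y t om).2).+1%:R.
Proof. exact: traj_total_le. Qed.

Lemma integrable_Vh t : (t < T)%N -> integrable_rv P (Vh t).
Proof.
move=> tT; have a1 : adapted (t * 'L + K) (fun=> 1 : R) by exists (fun=> 1).
have [h _ _] := mean_vdraw tT a1 (integrable_rv_cst P 1).
by rewrite (_ : Vh t = fun om => 1 * Vhat_g M (Y t om)) //; apply/funext => om; rewrite mul1r.
Qed.

Lemma mean_Vh_sq t : (t < T)%N -> integrable_rv P (fun om => Vh t om ^+ 2) /\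
  mean P (fun om => Vh t om ^+ 2) <= 2 * u ^+ 2 - u.
Proof.
move=> tT; have [i m] := vdraw_size_sq tT.
have h om : Vh t om ^+ 2 <= (size (Y t om).2).+1%:R ^+ 2.
  by have /andP[v0 v1] := Vh_itv t om; rewrite lerXn2r ?nnegrE.
have int_h : integrable_rv P (fun om => Vh t om ^+ 2).
  apply: le_integrable_rv i => [|om]; last by rewrite ger0_norm ?sqr_ge0.
  exact: (adapted_measurable (adapted_comp (fun v => v ^+ 2) (adapted_Vh (ltnSn _)))).
by split=> //; apply: le_trans m; exact: le_mean.
Qed.

Lemma mean_sq_dev t : (t < T)%N -> integrable_rv P (fun om => (Vh t om - b) ^+ 2) /\
  mean P (fun om => (Vh t om - b) ^+ 2) <= 3 * u ^+ 2 - u.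
Proof.
move=> tT; have [i m] := mean_Vh_sq tT.
have /andP[b0 bu] := threshold_itv M; rewrite -/b in b0 bu.
(* [Vh] and [b] are nonnegative, so the cross term has the favourable sign. *)
have h om : (Vh t om - b) ^+ 2 <= Vh t om ^+ 2 + u ^+ 2.
  by have /andP[v0 v1] := Vh_itv t om; have := horizon_gt0; nra.
have int_g : integrable_rv P (fun om => Vh t om ^+ 2 + u ^+ 2).
  by apply: integrable_rvD => //; exact: integrable_rv_cst.
have int_h : integrable_rv P (fun om => (Vh t om - b) ^+ 2).
  apply: le_integrable_rv int_g => [|om]; last by rewrite ger0_norm ?sqr_ge0.
  exact: (adapted_measurable (adapted_comp (fun v => (v - b) ^+ 2) (adapted_Vh (ltnSn _)))).
split=> //; apply: (@le_trans _ _ (mean P (fun om => Vh t om ^+ 2 + u ^+ 2))).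
  exact: le_mean.
rewrite meanD // ?mean_cst; last exact: integrable_rv_cst.
lra.
Qed.

(** A variance is at most the second moment: [Vt] depends on the past, so its product with the noise
    has mean 0. *)
Lemma mean_noise_sq t : (t < T)%N ->
  integrable_rv P (fun om => (Vh t om - Vt obj_g t om) ^+ 2) /\
  mean P (fun om => (Vh t om - Vt obj_g t om) ^+ 2) <= 2 * u ^+ 2 - u.
Proof.
move=> tT; have [i m] := mean_Vh_sq tT.
have [i1 e1] := mean_noise tT (adapted_V obj_g (leqnn _)) (integrable_V obj_g t).
have int_VV : integrable_rv P (fun om => Vt obj_g t om ^+ 2).
  apply: (@adapted_integrable (t * 'L) _ (u ^+ 2)) => [|om].
    exact: (adapted_comp (fun v => v ^+ 2) (adapted_V obj_g (leqnn _))).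
  by rewrite normrX lerXn2r ?nnegrE ?V_abs_le ?(ltW horizon_gt0).
have VV0 : 0 <= mean P (fun om => Vt obj_g t om ^+ 2) by apply: mean_ge0 => om; exact: sqr_ge0.
rewrite (_ : (fun om => _) = fun om => Vh t om ^+ 2 - Vt obj_g t om ^+ 2
    - 2 * (Vt obj_g t om * (Vh t om - Vt obj_g t om))); last by apply/funext => om; ring.
have i2 := integrable_rvB i int_VV; have i3 := integrable_rvZ 2 i1.
split; first exact: integrable_rvB.
rewrite (meanB i2 i3) (meanB i int_VV) meanZ // e1; lra.
Qed.

Let noise_sum n om := \sum_(t < n) (Vh t om - Vt obj_g t om).

Lemma adapted_noise_sum n : adapted (n * 'L) (noise_sum n).
Proof.
apply: adapted_sum => t.
have tn : (t * 'L + K < n * 'L)%N by rewrite block_lt.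
apply: (adapted_comp2 (fun v w => v - w)); first exact: adapted_Vh.
by apply: adapted_V; rewrite (leq_trans (leq_addr K _)) // ltnW.
Qed.

(** Martingale differences are orthogonal, so their variances add up. The order [n] matters: for
    [n = T] it is compensated exactly by [eta^2 = 1 / T]. *)
Lemma mean_noise_sum_sq n : (n <= T)%N -> integrable_rv P (fun om => noise_sum n om ^+ 2) /\
  mean P (fun om => noise_sum n om ^+ 2) <= n%:R * (2 * u ^+ 2 - u).
Proof.
elim: n => [|n IHn] nT.
  rewrite (_ : (fun om => _) = fun=> 0); last first.
    by apply/funext => om; rewrite /noise_sum big_ord0 expr0n.
  by rewrite mean_cst mul0r; split=> //; exact: integrable_rv_cst.
have [i m] := IHn (ltnW nT); have [i' m'] := mean_noise_sq nT.
have int_n : integrable_rv P (noise_sum n).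
  apply: integrable_rv_sum => t; apply: integrable_rvB; last exact: integrable_V.
  by apply: integrable_Vh; rewrite (ltn_trans (ltn_ord t)).
have [i1 e1] := mean_noise nT (adapted_noise_sum n) int_n.
rewrite (_ : (fun om => _) = fun om => noise_sum n om ^+ 2 +
    2 * (noise_sum n om * (Vh n om - Vt obj_g n om)) + (Vh n om - Vt obj_g n om) ^+ 2); last first.
  by apply/funext => om; rewrite /noise_sum big_ord_recr /=; ring.
have i2 := integrable_rvD i (integrable_rvZ 2 i1).
split; first exact: integrable_rvD.
rewrite (meanD i2 i') (meanD i (integrable_rvZ 2 i1)) meanZ // e1 -natr1; lra.
Qed.

Lemma mean_rest t : (t < T)%N -> integrable_rv P (rest t) /\
  mean P (rest t) <= eta * u * (2 * (1 + Lam) * ebar) + eta ^+ 2 * CW +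
    eta ^+ 2 / 2 * (3 * u ^+ 2 - u).
Proof.
move=> tT.
have aux (c L x y E k h z Z : R) : 0 <= c -> 0 <= L -> 0 <= h -> x <= E -> y <= E -> z <= Z ->
    c * (2 * (x + L * y)) + k + h * z <= c * (2 * (1 + L) * E) + k + h * Z.
  move=> c0 L0 h0 xE yE zZ; rewrite !lerD ?(ler_wpM2l h0) // ler_wpM2l //.
  by rewrite -mulrA ler_wpM2l // mulrDl mul1r lerD // ler_wpM2l.
have [ir mr] := mean_err obj_r tT; have [ig mg] := mean_err obj_g tT.
have [i1 m1] := mean_sq_dev tT.
have [i2 e2] := mean_noise tT (adapted_lam (leqnn _)) (integrable_lam t).
have ig' := integrable_rvZ Lam ig; have irg := integrable_rvD ir ig'.
have j1 := integrable_rvZ (eta * u) (integrable_rvZ 2 irg).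
have jc := integrable_rv_cst P (eta ^+ 2 * CW).
have j2 := integrable_rvD j1 jc; have j3 := integrable_rvZ (eta ^+ 2 / 2) i1.
have j4 := integrable_rvD j2 j3; have j5 := integrable_rvZ eta i2.
split; first exact: integrable_rvB j4 j5.
rewrite /rest (meanB j4 j5) (meanD j2 j3) (meanD j1 jc) mean_cst.
rewrite (meanZ _ (integrable_rvZ 2 irg)) (meanZ _ irg) (meanD ir ig') (meanZ _ ig) (meanZ _ i1) (meanZ _ i2).
rewrite e2 mulr0 subr0; apply: (aux _ _ _ _ _ _ _ _ _ _ Lam_ge0 _ mr mg m1).
  exact: ltW (mulr_gt0 eta_gt0 horizon_gt0).
by rewrite divr_ge0 ?sqr_ge0.
Qed.

Lemma mean_sum_rest : integrable_rv P (fun om => \sum_(t < T) rest t om) /\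
  mean P (fun om => \sum_(t < T) rest t om) <=
  u * (2 * (1 + Lam) * ebar) / eta + CW + (3 * u ^+ 2 - u) / 2.
Proof.
split; first by apply: integrable_rv_sum => t; have [] := mean_rest (ltn_ord t).
rewrite mean_sum => [|t]; last by have [] := mean_rest (ltn_ord t).
set c := (leRHS); pose c' := eta * u * (2 * (1 + Lam) * ebar) + eta ^+ 2 * CW +
    eta ^+ 2 / 2 * (3 * u ^+ 2 - u).
have -> : c = \sum_(t < T) c'.
  rewrite sumr_const card_ord -[_ *+ T]mulr_natl /c'.
  have TE : T%:R = (eta ^+ 2)^-1 by rewrite -[LHS](mulfK (x := eta ^+ 2)) ?T_eta ?mul1r // expf_neq0 // gt_eqF ?eta_gt0.
  rewrite TE /c; move: eta_gt0 => e0.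
  by field; rewrite !gt_eqF // subr1_discount_gt0.
by apply: ler_sum => t _; have [] := mean_rest (ltn_ord t).
Qed.

Lemma sum_rest_scaled : eta * (u * (2 * (1 + Lam) * ebar) / eta) = u * (2 * (1 + Lam) * ebar).
Proof. by rewrite mulrC divfK // gt_eqF ?eta_gt0. Qed.

Lemma invT : T%:R^-1 = eta ^+ 2.
Proof. by apply: (mulfI T_neq0); rewrite T_eta divff ?T_neq0. Qed.

Let avg_gap om := T%:R^-1 * \sum_(t < T) (V M rho obj_r pistar - Vt obj_r t om).
Let avg_viol om := T%:R^-1 * \sum_(t < T) (b - Vt obj_g t om).

Lemma integrable_avg_gap : integrable_rv P avg_gap.
Proof.
apply/integrable_rvZ/integrable_rv_sum => t.
by apply: integrable_rvB; [exact: integrable_rv_cst | exact: integrable_V].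
Qed.

(** The comparator 0 removes the utility from the regret. *)
Lemma mean_avg_gap_le : mean P avg_gap <=
  eta * (ln nA + CW + (3 * u ^+ 2 - u) / 2) + u * (2 * (1 + Lam) * ebar).
Proof.
have [ir mr] := mean_sum_rest.
have ic := integrable_rv_cst P (ln nA).
have step om : avg_gap om <= eta * (ln nA + \sum_(t < T) rest t om).
  rewrite /avg_gap invT expr2 -mulrA ler_pM2l ?eta_gt0 //.
  have := @primal_dual 0 om; rewrite lexx Lam_ge0 expr0n /= mul0r addr0 => /(_ isT).
  by under [X in eta * X]eq_bigr do rewrite mul0r addr0.
apply: (@le_trans _ _ (mean P (fun om => eta * (ln nA + \sum_(t < T) rest t om)))).
  by apply: le_mean => //; [exact: integrable_avg_gap | apply/integrable_rvZ/integrable_rvD].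
rewrite meanZ; last exact: integrable_rvD.
rewrite (meanD ic ir) mean_cst -sum_rest_scaled -mulrDr ler_pM2l ?eta_gt0 //.
by rewrite -!addrA lerD2l [leRHS]addrA [leRHS]addrC [leRHS]addrA.
Qed.

Lemma integrable_viol : integrable_rv P (fun om => Num.max (avg_viol om) 0).
Proof.
have ad : adapted (T * 'L) avg_viol.
  apply: (adapted_comp (fun x => T%:R^-1 * x)); apply: adapted_sum => t.
  by apply: (adapted_comp (fun v => b - v)); apply: adapted_V; rewrite leq_mul2r ltnW ?orbT.
apply: (@adapted_integrable (T * 'L) _ b); first exact: (adapted_comp (fun x => Num.max x 0)).
have /andP[b0 _] := threshold_itv M; rewrite -/b in b0.
move=> om; rewrite ger0_norm ?le_max ?lexx ?orbT // ge_max (ltW b0) andbT.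
rewrite /avg_viol -(ler_pM2l (_ : 0 < T%:R)) ?ltr0n // mulrA divff ?T_neq0 // mul1r.
rewrite mulr_natl -[X in _ <= _ *+ X]card_ord -sumr_const; apply: ler_sum => t _.
by rewrite gerBl; have /andP[] := V_itv M obj_g (run_policyP t om) hrho.
Qed.

Lemma mean_noise_sum : integrable_rv P (noise_sum T) /\ mean P (noise_sum T) = 0.
Proof.
have h (t : 'I_T) : integrable_rv P (fun om => Vh t om - Vt obj_g t om) /\
    mean P (fun om => Vh t om - Vt obj_g t om) = 0.
  have a1 : adapted (t * 'L) (fun=> 1 : R) by exists (fun=> 1).
  have := mean_noise (ltn_ord t) a1 (integrable_rv_cst P 1).
  by rewrite (_ : (fun om => _) = fun om => Vh t om - Vt obj_g t om) //; apply/funext => om; rewrite mul1r.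
split; first by apply: integrable_rv_sum => t; have [] := h t.
rewrite mean_sum => [|t]; last by have [] := h t.
by apply: big1 => t _; have [] := h t.
Qed.

(** The comparator takes only the values 0 and [Lam], so [c^2 + (Lam - c)^2 = Lam^2]. Writing
    [c * noise] as [Lam * noise - (Lam - c) * noise], the first part has mean 0, and the second is
    absorbed by [(Lam - c)^2 / 2] at the cost of half the square of [eta * noise]. The violation is
    multiplied by the slack [Lam - u / xi = u / xi] left by the duality gap. *)
Lemma violation_path om :
  u / xi * Num.max (avg_viol om) 0 <= eta * (ln nA + Lam ^+ 2 / 2 + \sum_(t < T) rest t om +
    eta * Lam * noise_sum T om + eta ^+ 2 / 2 * noise_sum T om ^+ 2).
Proof.
set vp := Num.max _ _; pose c := if 0 < avg_viol om then Lam else 0.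
have cE : c * avg_viol om = Lam * vp.
  by rewrite /c /vp; case: ltP => _ //; rewrite mul0r mulr0.
have c_itv : 0 <= c <= Lam by rewrite /c; case: ifP; rewrite ?lexx ?Lam_ge0.
have c2 : c ^+ 2 + (Lam - c) ^+ 2 = Lam ^+ 2.
  by rewrite /c; case: ifP => _; rewrite ?subrr ?subr0 expr0n /= ?addr0 ?add0r.
have := primal_dual om c_itv.
have -> : \sum_(t < T) ((V M rho obj_r pistar - Vt obj_r t om) + c * (b - Vh t om)) =
    T%:R * (avg_gap om + Lam * vp) - c * noise_sum T om.
  have sumE (F : R) : T%:R * (T%:R^-1 * F) = F by rewrite mulrA divff ?mul1r ?T_neq0.
  rewrite -cE mulrDr [T%:R * (c * _)]mulrCA !sumE big_split /= -mulr_sumr -addrA -mulrBr -sumrB.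
  by congr (_ + c * _); apply: eq_bigr => t _; ring.
have dual : - (u / xi) * vp <= avg_gap om.
  exact: (duality_gap_ge hrho xi_gt0 hslater hopt T_gt0 (fun t => run_policyP t om)).
have {}dual : u / xi * vp <= avg_gap om + Lam * vp.
  have -> : u / xi * vp = - (u / xi) * vp + Lam * vp by rewrite LamE; ring.
  by rewrite lerD2r.
have scaled (y : R) : y = eta * (eta * (T%:R * y)).
  by rewrite mulrA -expr2 mulrA [eta ^+ 2 * T%:R]mulrC T_eta mul1r.
rewrite [u / xi * vp]scaled.
rewrite ler_pM2l ?eta_gt0 // => h.
have : eta * (T%:R * (u / xi * vp)) <= eta * (T%:R * (avg_gap om + Lam * vp)).
  by rewrite ler_pM2l ?eta_gt0 // ler_pM2l ?ltr0n.
move=> /le_trans; apply.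
have := sqr_ge0 (Lam - c + eta * noise_sum T om).
move: h c2; move: (T%:R * _) (\sum_(t < T) rest t om) (noise_sum T om) (ln nA) => x r n l.
move: (eta) (Lam) (c) => e L y; lra.
Qed.

Lemma mean_viol_le : u / xi * mean P (fun om => Num.max (avg_viol om) 0) <=
  eta * (ln nA + CW + (3 * u ^+ 2 - u) / 2 + Lam ^+ 2 / 2 + (2 * u ^+ 2 - u) / 2) +
  u * (2 * (1 + Lam) * ebar).
Proof.
have [ir mr] := mean_sum_rest; have [i1 e1] := mean_noise_sum.
have [i2 m2] := mean_noise_sum_sq (leqnn T).
have ic := integrable_rv_cst P (ln nA + Lam ^+ 2 / 2).
have j1 := integrable_rvD ic ir; have j2 := integrable_rvZ (eta * Lam) i1.
have j3 := integrable_rvD j1 j2; have j4 := integrable_rvZ (eta ^+ 2 / 2) i2.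
have j5 := integrable_rvD j3 j4.
rewrite -meanZ; last exact: integrable_viol.
apply: (@le_trans _ _ (mean P (fun om => eta * (ln nA + Lam ^+ 2 / 2 + \sum_(t < T) rest t om +
    eta * Lam * noise_sum T om + eta ^+ 2 / 2 * noise_sum T om ^+ 2)))).
  apply: le_mean => [||om]; [exact/integrable_rvZ/integrable_viol | exact: integrable_rvZ |].
  exact: violation_path.
rewrite meanZ // (meanD j3 j4) (meanD j1 j2) (meanD ic ir) mean_cst (meanZ _ i1) (meanZ _ i2) e1 mulr0 addr0.
rewrite -sum_rest_scaled -mulrDr ler_pM2l ?eta_gt0 //.
have c0 : 0 <= eta ^+ 2 / 2 by rewrite divr_ge0 ?sqr_ge0.
have := ler_wpM2l c0 m2.
have -> : eta ^+ 2 / 2 * (T%:R * (2 * u ^+ 2 - u)) = (T%:R * eta ^+ 2) * ((2 * u ^+ 2 - u) / 2) by ring.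
rewrite T_eta mul1r; move: mr.
move: (u) (Lam) (ln nA) (CW) (u * _ / eta) (mean P _) (_ * mean P _) => v L l w k m m3.
lra.
Qed.

(** The Slater slack is below a utility value, itself at most [u]; the rates use this in the form
    [1 <= u / xi]. *)
Lemma xi_le_horizon : xi <= u.
Proof.
have [q [hq hs]] := hslater; have /andP[b0 _] := threshold_itv M.
have /andP[_ hv] := V_itv M obj_g hq hrho; lra.
Qed.

Lemma regret_bounds :
  let nA : R := #|A|%:R in
  let q := Num.sqrt (2 * fine (rel_cond phi nustar nu0) * nA * G2 / (sigmaF * K.+1%:R)) in
  mean P avg_gap <= (2 + ln nA + 5 * (B ^+ 2 * W ^+ 2) / xi ^+ 2) * u ^+ 5 * eta +
    (2 + 4 / xi) * u ^+ 3 * (Num.sqrt (nA * eps) + q) /\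
  mean P (fun om => Num.max (avg_viol om) 0) <=
    ((2 + ln nA + B ^+ 2 * W ^+ 2) * xi + (2 + 4 * (B ^+ 2 * W ^+ 2)) / xi) * u ^+ 4 * eta +
    (4 + 2 * xi) * u ^+ 2 * (Num.sqrt (nA * eps) + q).
Proof.
move=> n q.
have n1 : 1 <= n by rewrite ler1n; apply/card_gt0P; exists x0.2.
have l0 : 0 <= ln n by rewrite ln_ge0.
have w0 : 0 <= B ^+ 2 * W ^+ 2 by rewrite mulr_ge0 ?sqr_ge0.
have CWE : CW = B ^+ 2 * W ^+ 2 * (1 + 2 * u / xi) ^+ 2 * u ^+ 2 / 2 by rewrite /CW LamE; ring.
split.
  have := mean_avg_gap_le; rewrite CWE LamE => /le_trans; apply.
  apply: (reward_rate_le horizon_ge1 xi_gt0 xi_le_horizon l0 w0 (ltW eta_gt0)); exact: sqrtr_ge0.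
apply: (violation_rate_le horizon_ge1 xi_gt0 l0 w0 (ltW eta_gt0) (sqrtr_ge0 _) (sqrtr_ge0 _)).
by have := mean_viol_le; rewrite CWE LamE.
Qed.

End Regret.

End Sgd.
End Run.

Theorem theorem22 (R : realType) (S A : finType) (M : cmdp R S A)
    (rho : S -> R) (nu0 : S * A -> R) (xi : R)
    (d : nat) (phi : S * A -> 'cV[R]_d) (B W sigmaF eps_bias : R) (T K : nat)
    (pistar : S -> A -> R)
    (disp : measure_display) (Omega : measurableType disp)
    (P : probability Omega R)
    (X : nat -> nat -> Omega -> qdraw S A)
    (Y : nat -> Omega -> trajectory S A)
    (wstar : objective -> 'cV[R]_d -> 'cV[R]_d) :
  let gamma := discount M in
  let eta := (Num.sqrt T%:R)^-1 in
  let alpha := fun k : nat => 2 / (sigmaF * k.+1%:R) in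
  let theta := fun (t : nat) (om : Omega) =>
    (npg_pd M phi W xi eta eta alpha K
       (fun i k => X i k om) (fun i => Y i om) t).1 in
  let pol := fun (t : nat) (om : Omega) => log_linear phi (theta t om) in
  let nustar := nu_star M rho pistar in
  let kappa := rel_cond phi nustar nu0 in
  let beta := B ^+ 2 in
  let nA : R := #|A|%:R in
  let C5 := 2 + ln nA + 5 * beta * W ^+ 2 / xi ^+ 2 in
  let C6 := (2 + ln nA + beta * W ^+ 2) * xi + (2 + 4 * beta * W ^+ 2) / xi in
  let G2 := 4 * (W ^+ 2 * B ^+ 2 + 2 / (1 - gamma) ^+ 2) * B ^+ 2 in
  let err := Num.sqrt (nA * eps_bias) +
    Num.sqrt (2 * fine kappa * nA * G2 / (sigmaF * K.+1%:R)) in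
  let avg_gap := fun om : Omega => T%:R^-1 *
    \sum_(t < T) (V M rho obj_r pistar - V M rho obj_r (pol t om)) in
  let avg_viol := fun om : Omega => T%:R^-1 *
    \sum_(t < T) (threshold M - V M rho obj_g (pol t om)) in
  is_distr rho -> is_distr nu0 ->
  0 < xi -> slater M rho xi ->
  optimal M rho pistar ->
  (forall x, norm2 (phi x) <= B) ->
  0 < W -> (0 < T)%N -> (0 < K)%N ->
  npg_pd_sampling M phi W xi eta eta alpha K nu0 rho T P X Y ->
  0 < sigmaF ->
  {ae P, forall om, forall t, (t < T)%N ->
    loewner_le (sigmaF%:M) (Sigma phi (nu_visit M nu0 (pol t om)))} ->
  (forall o th, is_argmin (ball2 W)
    (fun w => fit_error M phi o (nu_visit M nu0 (log_linear phi th)) w th)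
    (wstar o th)) ->
  (forall o t, (t < T)%N ->
    ('E_P[fun om => fit_error M phi o nustar
            (wstar o (theta t om)) (theta t om)] <= eps_bias%:E)%E) ->
  kappa \is a fin_num ->
  ('E_P[avg_gap]
   <= (C5 / (1 - gamma) ^+ 5 * (Num.sqrt T%:R)^-1
       + (2 + 4 / xi) / (1 - gamma) ^+ 3 * err)%:E)%E
  /\
  ('E_P[fun om => Num.max (avg_viol om) 0%R]
   <= (C6 / (1 - gamma) ^+ 4 * (Num.sqrt T%:R)^-1
       + (4 + 2 * xi) / (1 - gamma) ^+ 2 * err)%:E)%E.
Proof.
move=> gamma eta alpha theta pol nustar kappa beta nA C5 C6 G2 err avg_gap avg_viol.
move=> hrho hnu0 xi0 hslater hopt phiB W0 T0 K0 hXY s0 cov wmin bias kfin.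
have hps : is_policy pistar by have [[]] := hopt.
(* A default pair [x0] is required by the flattened sequence; it exists because [rho] and [pistar s]
   have total mass 1. *)
have inhab (D : finType) (p : D -> R) : is_distr p -> inhabited D.
  move=> [_ p1]; have [x _|D0] := pickP (fun _ : D => true); first by exists.
  by move: p1; rewrite big_pred0 // => /eqP; rewrite eq_sym oner_eq0.
have [s] := inhab _ _ hrho; have [a] := inhab _ _ (hps s); pose x0 := (s, a).
have int_fit o t := integrable_fit_error x0 hrho hXY phiB (ltW W0) wmin hopt o t.
have int_gap := integrable_avg_gap x0 hrho hXY pistar.
have int_viol := integrable_viol x0 hrho hXY T0.
have bias' o t : (t < T)%N -> mean P (fun om =>
    fit_error M phi o nustar (wstar o (theta t om)) (theta t om)) <= eps_bias.
  by move=> tT; have := bias o t tT; rewrite (expectationE (int_fit o t)) lee_fin.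
rewrite (expectationE int_gap) (expectationE int_viol) !lee_fin.
have [] := regret_bounds x0 hrho hnu0 hXY phiB (ltW W0) s0 K0 (fun=> erefl) cov wmin
  xi0 hslater hopt T0 erefl erefl kfin bias'.
rewrite -/nA -/gamma -/nustar -/kappa -/G2 -/eta -/err => h1 h2.
split; [apply: le_trans h1 _ | apply: le_trans h2 _].
  by rewrite /C5 /beta -!exprVn !mulrA.
by rewrite /C6 /beta -!exprVn !mulrA.
Qed.
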